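(* Let $\omega$ be a modulus of continuity. Let $\lambda_1,\lambda_2\in\mathbb{R}$ be any prescribed numbers with $0<|\lambda_1|\leqslant|\lambda_2|<1$, put $\alpha_0:=1-\frac{\log|\lambda_2|}{\log|\lambda_1|}\in[0,1)$ and $\Lambda:=\begin{pmatrix}\lambda_1&0\\0&\lambda_2\end{pmatrix}$. Then: (I) If $\int_0^1\frac{\omega(t)}{t^{\alpha_0+1}}\,dt<+\infty$, then every planar $C_{1,\omega}$ diffeomorphism $F:(\mathbb{R}^2,O)\to(\mathbb{R}^2,O)$ with $DF(O)=\Lambda$ is locally $C^1$ linearizable. (II) If $\int_0^1\frac{\omega(t)}{t^{\alpha_0+1}}\,dt=+\infty$, then there exists a planar $C_{1,\omega}$ diffeomorphism $F:(\mathbb{R}^2,O)\to(\mathbb{R}^2,O)$ with $DF(O)=\Lambda$ that is not locally $C^1$ linearizable. Equivalently, all planar $C_{1,\omega}$ diffeomorphisms $F$ with $F(O)=O$ and $DF(O)=\Lambda$ are locally $C^1$ linearizable if and only if $\int_0^1\frac{\omega(t)}{t^{\alpha_0+1}}\,dt<+\infty$.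
   Context: $O=(0,0)^\top$ is the origin of $\mathbb{R}^2$; $|\cdot|$ is the supremum norm on $\mathbb{R}^2$ and the induced operator norm on matrices. A modulus of continuity is a continuous, strictly increasing, concave function $\omega:[0,\infty)\to[0,\infty)$ with $\omega(0)=0$ (only its values near $0$ matter). All diffeomorphisms are understood locally: $F:(\mathbb{R}^2,O)\to(\mathbb{R}^2,O)$ denotes a $C^1$ diffeomorphism from a neighborhood of $O$ onto a neighborhood of $O$ with $F(O)=O$. We write $F\in C_{1,\omega}$ if there are a neighborhood of $O$ and a constant $L>0$ such that $|DF(x)-DF(y)|\leqslant L\,\omega(|x-y|)$ for all $x,y$ in that neighborhood. $F$ with $DF(O)=\Lambda$ is called locally $C^1$ linearizable if there exists a local $C^1$ diffeomorphism $\Phi:(\mathbb{R}^2,O)\to(\mathbb{R}^2,O)$ with $\Phi(O)=O$, $D\Phi(O)=\mathrm{Id}$ and $\Phi\circ F=\Lambda\circ\Phi$ near $O$. *)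

(* Defs.v *)
From mathcomp Require Import all_boot all_order all_algebra.
From mathcomp Require Import all_classical all_reals all_analysis.

Set Implicit Arguments.
Unset Strict Implicit.
Unset Printing Implicit Defensive.

Import Order.TTheory GRing.Theory Num.Theory.
Import numFieldNormedType.Exports.

Local Open Scope classical_set_scope.
Local Open Scope ring_scope.

(* Points of the plane are row vectors, so matrices act on the right and the
   library Jacobian ['J F x] satisfies ['d F x v = v *m 'J F x] (it is the
   transpose of the column-vector convention).  The library norm of a row
   vector is the supremum norm.

   A map germ at the origin is represented by a total function; the definitions
   below constrain it only near the origin. *)

(* The library norm of a matrix is the largest absolute value of an entry; this
   is instead the norm of the linear map [v |-> v *m A] induced by the supremum
   norm. *)
Definition opnorm (R : realType) (n : nat) (A : 'M[R]_n) : R :=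
  sup [set `|v *m A| | v in [set v : 'rV[R]_n | `|v| <= 1]].

(* Only the restriction of [w] to [0, +oo) is relevant. *)
Definition modulus_of_continuity (R : realType) (w : R -> R) : Prop :=
  [/\ w 0 = 0,
      forall t : R, 0 <= t -> 0 <= w t,
      {within [set` `[0, +oo[], continuous w},
      forall s t : R, 0 <= s -> s < t -> w s < w t &
      forall s t k : R, 0 <= s -> 0 <= t -> 0 <= k -> k <= 1 ->
        k * w s + (1 - k) * w t <= w (k * s + (1 - k) * t)].

Definition C1_on (R : realType) (n : nat) (U : set 'rV[R]_n)
    (F : 'rV[R]_n -> 'rV[R]_n) : Prop :=
  forall x, U x -> differentiable F x /\ {for x, continuous (jacobian F)}.

Definition local_C1_diffeo (R : realType) (n : nat)
    (F : 'rV[R]_n -> 'rV[R]_n) : Prop :=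
  F 0 = 0 /\
  exists (U V : set 'rV[R]_n) (G : 'rV[R]_n -> 'rV[R]_n),
    [/\ open_nbhs (0 : 'rV[R]_n) U, open_nbhs (0 : 'rV[R]_n) V, set_bij U V F,
        forall x, U x -> G (F x) = x & C1_on U F /\ C1_on V G].

Definition C1w_diffeo (R : realType) (n : nat) (w : R -> R)
    (F : 'rV[R]_n -> 'rV[R]_n) : Prop :=
  local_C1_diffeo F /\
  exists (U : set 'rV[R]_n) (L : R),
    [/\ nbhs (0 : 'rV[R]_n) U, 0 < L &
        forall x y, U x -> U y ->
          opnorm ('J F x - 'J F y) <= L * w `|x - y|].

Definition locally_C1_linearizable (R : realType) (n : nat)
    (F : 'rV[R]_n -> 'rV[R]_n) : Prop :=
  exists Phi : 'rV[R]_n -> 'rV[R]_n,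
    [/\ local_C1_diffeo Phi, 'J Phi 0 = 1%:M &
        \forall x \near (0 : 'rV[R]_n), Phi (F x) = Phi x *m 'J F 0].

Definition diag2 (R : realType) (l1 l2 : R) : 'M[R]_2 :=
  diag_mx (\row_(i < 2) if i == 0 then l1 else l2).

Definition alpha0 (R : realType) (l1 l2 : R) : R := 1 - ln `|l2| / ln `|l1|.

Definition dini_integral (R : realType) (w : R -> R) (a : R) : \bar R :=
  (\int[lebesgue_measure]_(t in `]0%R, 1%R]) (w t / t `^ (a + 1))%:E)%E.

(* Main.v *)
(* Write [q = |l1|], [p = |l2|] and [a = alpha0], so that [q^a = q / p].  The Dini
   integral converges iff [sum_k (p/q)^k w(q^k)] does.

   Sufficiency.  After replacing [w] by a majorant [sg] with growth exponent
   slightly above [a], if [q < p] a graph transform for the inverse of [F] produces an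
   invariant curve [x1 = h(x2)] along the weak direction whose slope has modulus
   of continuity [sg].  After straightening the curve, the maps [L^-n F^n] converge
   in [C^1]: in the Jacobian cocycle the only factor not damped by [L^-n] is
   the coupling of the two directions, amplified by [(p/q)^n]; it vanishes on the
   curve and is therefore bounded by [sg] of the distance to the curve, of order [q^n].

   Necessity.  Perturb the linear map, in disjoint strips around [x1 = l1^k], by
   terms of size [q^(k+1) w(q^k)] varying in [x2] on the scale [q^k].  Along the
   orbit of [(l1^N, l2^N (b + s))] the relative displacement of the first
   coordinate grows at least like [s sum_k (p/q)^k w(q^k)] as long as it is
   small, while a [C^1] linearization would make it Lipschitz in [s]. *)

Require Import Defs.
From mathcomp Require Import all_boot all_order all_algebra.
From mathcomp Require Import all_classical all_reals all_analysis.
From mathcomp Require Import measurable_realfun ring lra.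
Import Order.TTheory GRing.Theory Num.Theory.
Import numFieldNormedType.Exports.
Local Open Scope classical_set_scope.
Local Open Scope ring_scope.

Set Implicit Arguments.
Unset Strict Implicit.
Unset Printing Implicit Defensive.

(** * Jacobians and the mean value inequality *)

(** The majorant of the modulus is forced by the graph transform. One step evaluates the modulus of
    the slope at [nu t] and multiplies it by [q nu], where the expansion rate [nu] is slightly above
    [1 / p]. Concavity alone turns this into the factor [q nu^2], which exceeds 1 as soon as
    [p^2 < q]. With growth exponent [g] the factor is [q nu^(1 + g)], close to
    [q p^-(1 + a) = q^(a^2)], which is below 1 when [a > 0]. When [q = p] this leaves no room, but
    then the coupling is not amplified either, and the axis [x1 = 0] can stand in for the curve. For
    [q < p] the curve is essential: orbits decay only at a rate near [p], so a coupling bounded by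
    the distance to the origin would require a sum like [sum_k (p/q)^k w(p^k)] to converge, while
    the distance to the curve decays like [q^k]. The transform uses the inverse of [F] because its
    invariance equation, solved for [h], is explicit and contracts by about [q]; the contracting
    form of the equation for [F] involves inverting the second coordinate along the curve. *)

Section MatrixNorm.
Variable R : realType.

Lemma mx_norm_le m n (A : 'M[R]_(m, n)) e :
  0 <= e -> (forall i j, `|A i j| <= e) -> `|A| <= e.
Proof.
move=> e0 Ae; rewrite [leLHS]/Num.Def.normr/= mx_normrE.
by apply: bigmax_le => // -[i j] _ /=.
Qed.

Lemma mx_norm_ge m n (A : 'M[R]_(m, n)) i j : `|A i j| <= `|A|.
Proof.
rewrite [leRHS]/Num.Def.normr/= mx_normrE.
exact: (le_bigmax _ (fun ij : 'I_m * 'I_n => `|A ij.1 ij.2|) (i, j)).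
Qed.

(** The largest-entry norm is not submultiplicative. The factor [n] becomes the recurring 2 in the
    estimates in the plane. *)
Lemma mx_normM m n p (A : 'M[R]_(m, n)) (B : 'M[R]_(n, p)) :
  `|A *m B| <= n%:R * `|A| * `|B|.
Proof.
apply: mx_norm_le => [|i j]; first by rewrite !mulr_ge0.
rewrite mxE (le_trans (ler_norm_sum _ _ _))//.
rewrite (@le_trans _ _ (\sum_(k < n) `|A| * `|B|))//; last first.
  by rewrite sumr_const card_ord -[leLHS]mulr_natl mulrA.
apply: ler_sum => k _; rewrite normrM ler_pM ?mx_norm_ge//.
Qed.

Lemma near_normP (V : normedModType R) (x : V) (P : V -> Prop) :
  (\forall y \near x, P y) <-> exists2 d, 0 < d & forall y, `|y - x| < d -> P y.
Proof.
rewrite nbhs_normP; split=> [[d d0 dP]|[d d0 dP]]; exists d => // y /=.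
  by move=> yx; apply: dP => /=; rewrite distrC.
by rewrite /ball_ /= distrC; apply: dP.
Qed.

Lemma is_diff_littleo (V W : normedModType R) (F : V -> W) (x : V) (L : {linear V -> W}) :
  continuous L ->
  (is_diff x F L <-> forall e, 0 < e -> exists2 d, 0 < d &
    forall y, `|y - x| < d -> `|F y - F x - L (y - x)| <= e * `|y - x|).
Proof.
move=> cL; split=> [[dF FL] e e0|FL].
  have /diff_locallyP[_ /eqaddoP/(_ e e0)] := dF.
  move=> /near_normP[d d0 dP]; exists d => // y yx.
  have := dP (y - x); rewrite subr0 => /(_ yx).
  by rewrite /= !fctE /= subrK opprD addrA FL.
have FE : F \o shift x = cst (F x) + L +o_ 0 id.
  apply/eqaddoP => e e0; have [d d0 dP] := FL e e0.
  apply/near_normP; exists d => // h; rewrite subr0 => hd.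
  have := dP (h + x); rewrite addrK => /(_ hd).
  by rewrite /= !fctE /= opprD addrA.
have dE := diff_unique cL FE.
by split=> //; apply/diff_locallyP; rewrite dE.
Qed.

(** Fréchet differentiability with a named matrix, in epsilon-delta form, so that quantitative
    estimates need no filters; [has_jacP] ties it to the library notion. *)
Definition has_jac n m (F : 'rV[R]_n -> 'rV[R]_m) (x : 'rV[R]_n) (A : 'M[R]_(n, m)) :=
  forall e, 0 < e -> exists2 d, 0 < d &
    forall y, `|y - x| < d -> `|F y - F x - (y - x) *m A| <= e * `|y - x|.

Lemma has_jacP n m (F : 'rV[R]_n -> 'rV[R]_m) x A :
  has_jac F x A <-> differentiable F x /\ 'J F x = A.
Proof.
have cA : continuous (mulmxr A : 'rV[R]_n -> 'rV[R]_m).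
  apply/linear_bounded_continuous/linear_boundedP; exists (n%:R * `|A|); split; first by rewrite num_real.
  by move=> r /ltW rA v; rewrite /= (le_trans (mx_normM _ _))// mulrAC ler_wpM2r.
split=> [/(is_diff_littleo _ _ cA)[dF FA]|[dF FA]].
  split=> //.
  by apply/row_matrixP => i; rewrite !rowE /jacobian mul_rV_lin1 FA.
apply/(is_diff_littleo _ _ cA); split=> //.
by apply/funext => v; rewrite /= -FA /jacobian mul_rV_lin1.
Qed.

Lemma has_jac_unique n m (F : 'rV[R]_n -> 'rV[R]_m) x A B :
  has_jac F x A -> has_jac F x B -> A = B.
Proof. by move=> /has_jacP[_ <-] /has_jacP[]. Qed.

Lemma has_jac_cont n m (F : 'rV[R]_n -> 'rV[R]_m) x A : has_jac F x A ->
  forall e, 0 < e -> exists2 d, 0 < d & forall y, `|y - x| < d -> `|F y - F x| <= e.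
Proof.
move=> FA e e0; have [d d0 dP] := FA 1 ltr01.
pose C := 1 + n%:R * `|A|.
have C0 : 0 < C by rewrite ltr_pwDl// mulr_ge0.
exists (Num.min d (e / C)) => [|y]; first by rewrite lt_min d0 divr_gt0.
rewrite lt_min => /andP[yd ye].
rewrite -[F y - F x](subrK ((y - x) *m A)) (le_trans (ler_normD _ _))//.
rewrite (le_trans (lerD (dP y yd) (mx_normM _ _)))//.
rewrite (_ : 1 * _ + _ = C * `|y - x|); last by rewrite /C; ring.
by rewrite mulrC -ler_pdivlMr// ltW.
Qed.

Lemma has_jac_comp n m p (F : 'rV[R]_n -> 'rV[R]_m) (G : 'rV[R]_m -> 'rV[R]_p) x A B :
  has_jac F x A -> has_jac G (F x) B -> has_jac (G \o F) x (A *m B).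
Proof.
move=> /has_jacP[dF JF] /has_jacP[dG JG]; apply/has_jacP; split.
  exact: differentiable_comp.
apply/row_matrixP => i; rewrite !rowE /jacobian mul_rV_lin1 diff_comp//=.
by rewrite -JF -JG mulmxA /jacobian !mul_rV_lin1.
Qed.

Lemma has_jac_near n m (F G : 'rV[R]_n -> 'rV[R]_m) x A d :
  0 < d -> (forall y, `|y - x| < d -> F y = G y) -> has_jac F x A -> has_jac G x A.
Proof.
move=> d0 FG FA e e0; have [d1 d10 d1P] := FA e e0.
exists (Num.min d d1) => [|y]; first by rewrite lt_min d0.
rewrite lt_min => /andP[yd yd1].
by rewrite -!FG ?subrr ?normr0//; exact: d1P.
Qed.

Lemma has_jac_line n m (F : 'rV[R]_n -> 'rV[R]_m)
    (x v : 'rV[R]_n) (t : R) (A : 'M[R]_(n, m)) j :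
  has_jac F (x + t *: v) A ->
  is_derive t 1 (fun s : R => F (x + s *: v) 0 j) ((v *m A) 0 j).
Proof.
move=> FA.
suff H : (fun h : R => h^-1 *: (((fun s : R => F (x + s *: v) 0 j) \o shift t)
     (h *: (1 : R)) - F (x + t *: v) 0 j)) @ 0^' --> (v *m A) 0 j.
  split; first by apply/cvg_ex; exists ((v *m A) 0 j).
  exact: (cvg_lim _ H).
apply/cvgrPdist_le => e e0.
pose C := `|v| + 1; have C0 : 0 < C by rewrite ltr_wpDl.
have [d d0 dP] := FA (e / C) (divr_gt0 e0 C0).
near=> h.
have h0 : h != 0 by near: h; exact: nbhs_dnbhs_neq.
have hd : `|h| < d / C.
  by near: h; apply: dnbhs0_lt; rewrite divr_gt0.
have hv : x + (h *: 1 + t) *: v - (x + t *: v) = h *: v.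
  by rewrite [h *: 1]mulr1 scalerDl addrCA addrK.
have := dP (x + (h *: 1 + t) *: v); rewrite hv normrZ => /(_ _)/wrap[].
  apply: le_lt_trans (_ : `|h| * C < _); first by rewrite ler_wpM2l// lerDl.
  by rewrite -ltr_pdivlMr.
move=> H.
have {}H : `|F (x + (h *: 1 + t) *: v) 0 j - F (x + t *: v) 0 j - h * (v *m A) 0 j| <= `|h| * e.
  have := le_trans (mx_norm_ge _ 0 j) H; rewrite !mxE => H1.
  have -> : h * \sum_k v 0 k * A k j = (h *: v *m A) 0 j by rewrite -scalemxAl !mxE.
  rewrite !mxE; apply: le_trans H1 _.
  rewrite mulrCA ler_wpM2l// mulrAC ler_pdivrMr// ler_wpM2l ?ltW// /C ltrDl//.
rewrite -(ler_pM2l (_ : 0 < `|h|)) ?normr_gt0// -normrM; apply: le_trans H.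
rewrite -normrN mulrBr opprB -[h^-1 *: _]/(h^-1 * _) mulrA divff// mul1r.
exact: lexx.
Unshelve. all: by end_near. Qed.

(** The scalar mean value theorem is applied to each coordinate, with its own intermediate point;
    the supremum norm then loses nothing, and the factor [n] comes from [mx_normM]. *)
Lemma mean_value_vec n m (F : 'rV[R]_n -> 'rV[R]_m) (J : 'rV[R]_n -> 'M[R]_(n, m))
    (x y : 'rV[R]_n) (A : 'M[R]_(n, m)) (e : R) :
  0 <= e ->
  (forall t : R, 0 <= t <= 1 -> has_jac F (x + t *: (y - x)) (J (x + t *: (y - x)))) ->
  (forall t : R, 0 <= t <= 1 -> `|J (x + t *: (y - x)) - A| <= e) ->
  `|F y - F x - (y - x) *m A| <= n%:R * e * `|y - x|.
Proof.
move=> e0 FJ JA; apply: mx_norm_le => [|i j]; first by rewrite !mulr_ge0.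
rewrite (ord1 i) {i}; set v := y - x.
pose f (t : R) := F (x + t *: v) 0 j.
have df (t : R) : 0 <= t <= 1 -> is_derive t 1 f ((v *m J (x + t *: v)) 0 j).
  by move=> t01; exact/has_jac_line/FJ.
have [|t|c /=] := @MVT_segment R f (fun t => (v *m J (x + t *: v)) 0 j) 0 1 ler01.
- move=> t; rewrite in_itv/= => /andP[t0 t1]; apply: df; lra.
- apply: derivable_within_continuous => s; rewrite in_itv/= => s01.
  by have [] := df s s01.
rewrite in_itv/= => c01; rewrite /f subr0 mulr1 scale1r scale0r addr0.
rewrite (_ : x + v = y) => [E|]; last by rewrite addrC subrK.
have -> : (F y - F x - v *m A) 0 j = (v *m (J (x + c *: v) - A)) 0 j.
  have mxB (a b : 'rV[R]_m) : (a - b) 0 j = a 0 j - b 0 j by rewrite !mxE.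
  by rewrite mulmxBr !mxB E.
rewrite (le_trans (mx_norm_ge _ _ _))// (le_trans (mx_normM _ _))// mulrAC.
by rewrite ler_wpM2r// ler_wpM2l// JA.
Qed.

End MatrixNorm.

(** * The inverse function theorem *)

Section Limits.
Variable R : realType.

(** A one-sided condition, [limsup b <= 0]: it is meant for error bounds, and domination from above
    ([tends0_le]) then suffices to transfer it. *)
Definition tends0 (b : nat -> R) :=
  forall e, 0 < e -> exists N, forall n, (N <= n)%N -> b n <= e.

Lemma le_tends0 (x : R) (b : nat -> R) N : tends0 b ->
  (forall n, (N <= n)%N -> x <= b n) -> x <= 0.
Proof.
move=> b0 xb; apply/ler_addgt0Pl => e /b0[M bM]; rewrite addr0.
by rewrite (le_trans (xb (maxn N M) _))// ?leq_maxl// bM ?leq_maxr.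
Qed.

Lemma tends0D (b c : nat -> R) : tends0 b -> tends0 c -> tends0 (fun n => b n + c n).
Proof.
move=> b0 c0 e e0; have e2 : 0 < e / 2 by rewrite divr_gt0.
have [N bN] := b0 _ e2; have [M cM] := c0 _ e2.
exists (maxn N M) => n; rewrite geq_max => /andP[Nn Mn].
by rewrite [leRHS]splitr lerD ?bN ?cM.
Qed.

Lemma tends0Z (b : nat -> R) k : 0 <= k -> tends0 b -> tends0 (fun n => k * b n).
Proof.
move=> k0 b0 e e0; have k1 : 0 < k + 1 by rewrite ltr_wpDl.
have [N bN] := b0 (e / (k + 1)) (divr_gt0 e0 k1).
exists N => n Nn; rewrite (le_trans (ler_wpM2l k0 (bN n Nn)))//.
by rewrite mulrCA ler_piMr ?(ltW e0)// ler_pdivrMr// mul1r lerDl.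
Qed.

Lemma tends0_le (b c : nat -> R) : (forall n, b n <= c n) -> tends0 c -> tends0 b.
Proof.
by move=> bc c0 e /c0[N cN]; exists N => n /cN; exact: le_trans.
Qed.

Lemma tends0_geometric (r : R) : 0 <= r < 1 -> tends0 (fun n => r ^+ n).
Proof.
move=> /andP[r0 r1] e e0.
have /cvgrPdist_le/(_ e e0)[N _ NP] : r ^+ n @[n --> \oo] --> 0.
  by apply: cvg_expr; rewrite ger0_norm.
exists N => n Nn; have := NP n Nn.
by rewrite sub0r normrN ger0_norm ?exprn_ge0.
Qed.

Lemma cauchy_rate (u b : nat -> R) : tends0 b ->
  (forall n m, (n <= m)%N -> `|u m - u n| <= b n) ->
  exists l, forall n, `|u n - l| <= b n.
Proof.
move=> b0 ub.
have /cauchy_cvgP/cvg_ex[/= l ul] : cauchy (u @ \oo).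
  apply: cauchy_exP => e e0; have [|N bN] := b0 (e / 2); first by rewrite divr_gt0.
  exists (u N); exists N => // n /= Nn.
  rewrite /ball/= distrC (le_lt_trans (ub _ _ Nn))// (le_lt_trans (bN N _))//.
  by rewrite ltr_pdivrMr// ltr_pMr// ltrDl.
exists l => n; rewrite -subr_le0.
suff b1 : tends0 (fun m => `|u m - l|).
  apply: (@le_tends0 _ _ n b1) => m nm; rewrite lerBlDl.
  by rewrite -(subrKA (u m)) (le_trans (ler_normD _ _))// lerD// distrC ub.
move=> e e0; move/cvgrPdist_le : ul => /(_ e e0)[N _ NP]; exists N => m Nm.
by rewrite distrC; exact: NP.
Qed.

Lemma cauchy_rate_mx k m (u : nat -> 'M[R]_(k, m)) (b : nat -> R) : tends0 b ->
  (forall n m, (n <= m)%N -> `|u m - u n| <= b n) ->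
  exists l, forall n, `|u n - l| <= b n.
Proof.
move=> b0 ub.
have /(_ _)/cid-/all_sig[l lP] : forall ij : 'I_k * 'I_m,
    exists l, forall n, `|u n ij.1 ij.2 - l| <= b n.
  move=> [i j] /=; apply: cauchy_rate => // n n' nn'.
  by have := le_trans (mx_norm_ge _ i j) (ub _ _ nn'); rewrite !mxE.
exists (\matrix_(i, j) l (i, j)) => n; apply: mx_norm_le => [|i j].
  by rewrite (le_trans _ (ub n n _)).
by rewrite !mxE; exact: (lP (i, j)).
Qed.

End Limits.

(** * C1 maps on balls around the origin *)

Section C1Ball.
Variable R : realType.

(** The Jacobian is carried as an explicit function, so that chain-rule products and limits of
    Jacobians remain formulas. *)
Definition C1_ball n m (F : 'rV[R]_n -> 'rV[R]_m) (J : 'rV[R]_n -> 'M[R]_(n, m)) r :=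
  forall x, `|x| < r -> has_jac F x (J x) /\
    forall e, 0 < e -> exists2 d, 0 < d & forall y, `|y - x| < d -> `|J y - J x| <= e.

Lemma open_normP (V : normedModType R) (U : set V) :
  open U <-> forall x, U x -> exists2 d, 0 < d & forall y, `|y - x| < d -> U y.
Proof.
rewrite openE; split=> H x /H; first by move=> /(near_normP _ _).1.
by move=> /(near_normP _ _).2.
Qed.

Lemma continuous_normP (V W : normedModType R) (f : V -> W) (x : V) :
  {for x, continuous f} <-> forall e, 0 < e ->
    exists2 d, 0 < d & forall y, `|y - x| < d -> `|f y - f x| <= e.
Proof.
split=> [/cvgrPdist_le cf e e0|cf].
  have [d d0 dP] := (near_normP _ _).1 (cf e e0).
  by exists d => // y yx; rewrite distrC dP.
apply/cvgrPdist_le => e e0; apply/near_normP.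
by have [d d0 dP] := cf e e0; exists d => // y yx; rewrite distrC dP.
Qed.

Lemma C1_onP n (U : set 'rV[R]_n) F : open_nbhs (0 : 'rV[R]_n) U -> C1_on U F ->
  exists2 r, 0 < r & C1_ball F (jacobian F) r /\ forall x, `|x| < r -> U x.
Proof.
move=> /open_nbhs_nbhs U0 FU.
have [r r0 rU] : exists2 r, 0 < r & forall y : 'rV[R]_n, `|y| < r -> U y.
  by have [r r0 rP] := (near_normP _ _).1 U0; exists r => // y yr; apply: rP; rewrite subr0.
exists r => //; split=> // x xr; have [dF cF] := FU x (rU x xr).
split; first by apply/has_jacP.
exact: (continuous_normP _ _).1 cF.
Qed.

Lemma C1_on_open n (U : set 'rV[R]_n) F J : open U ->
  (forall x, U x -> has_jac F x (J x)) ->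
  (forall x, U x -> forall e, 0 < e ->
     exists2 d, 0 < d & forall y, U y -> `|y - x| < d -> `|J y - J x| <= e) ->
  C1_on U F.
Proof.
move=> oU FJ cJ x Ux; have /has_jacP[dF JF] := FJ x Ux; split=> //.
apply: (continuous_normP _ _).2 => e e0; have [d d0 dP] := cJ x Ux e e0.
have Ux' : nbhs x U by exact: (open_nbhs_nbhs (conj oU Ux)).
have [d1 d10 d1P] := (near_normP x U).1 Ux'.
exists (Num.min d d1); first by rewrite lt_min d0.
move=> y.
rewrite lt_min => /andP[yd yd1]; have Uy := d1P y yd1.
have /has_jacP[_ Jy] := FJ y Uy; rewrite Jy JF; exact: (dP y Uy yd).
Qed.

Lemma normed_seg n (x y : 'rV[R]_n) (t r : R) : `|x| < r -> `|y| < r -> 0 <= t <= 1 ->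
  `|x + t *: (y - x)| < r.
Proof.
move=> xr yr /andP[t0 t1].
have -> : x + t *: (y - x) = (1 - t) *: x + t *: y.
  by rewrite scalerBr scalerBl scale1r addrA addrAC.
rewrite (le_lt_trans (ler_normD _ _))// !normrZ !ger0_norm ?subr_ge0//.
have [->|tn0] := eqVneq t 0; first by rewrite subr0 mul1r mul0r addr0.
have tp : 0 < t by rewrite lt_neqAle eq_sym tn0.
rewrite (_ : r = (1 - t) * r + t * r); last by ring.
by rewrite ler_ltD ?ler_wpM2l ?ltr_pM2l ?subr_ge0// ltW.
Qed.

Lemma C1_ball_mean n m (F : 'rV[R]_n -> 'rV[R]_m) J r A e x y : C1_ball F J r ->
  (forall z, `|z| < r -> `|J z - A| <= e) -> `|x| < r -> `|y| < r ->
  `|F y - F x - (y - x) *m A| <= n%:R * e * `|y - x|.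
Proof.
move=> FJ JA xr yr; apply: (@mean_value_vec _ _ _ F J).
- by rewrite (le_trans _ (JA x xr)).
- by move=> t t01; have [] := FJ (x + t *: (y - x)) (normed_seg xr yr t01).
- by move=> t t01; apply: JA; exact: normed_seg.
Qed.

Lemma norm_le_double (V : normedModType R) (a b : V) :
  `|b - a| <= 2^-1 * `|a| -> `|a| <= 2 * `|b|.
Proof. by move=> H; have := ler_normB b (b - a); rewrite subKr; lra. Qed.

(** [A B^-1] is within 1/2 of the identity, hence bounded below by 1/2, hence injective, and
    injectivity of a square matrix is invertibility. *)
Lemma near_unit n (A B : 'M[R]_n) : B \in unitmx ->
  (forall v : 'rV_n, `|v *m (A *m invmx B - 1%:M)| <= 2^-1 * `|v|) ->
  A \in unitmx /\ forall v : 'rV_n, `|v| <= 2 * `|v *m A *m invmx B|.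
Proof.
move=> uB AB.
have H (v : 'rV_n) : `|v| <= 2 * `|v *m A *m invmx B|.
  by apply: norm_le_double; have := AB v; rewrite mulmxBr mulmx1 mulmxA.
split=> //; rewrite -row_free_unit; apply: inj_row_free => v vA.
by have := H v; rewrite vA mul0mx normr0 mulr0 normr_le0 => /eqP.
Qed.

End C1Ball.

Section InverseFunction.
Variables (R : realType) (n : nat) (F : 'rV[R]_n -> 'rV[R]_n) (J : 'rV[R]_n -> 'M[R]_n).
Variable r0 : R.
Hypotheses (r00 : 0 < r0) (F0 : F 0 = 0) (FJ : C1_ball F J r0) (uJ : J 0 \in unitmx).

Let A := invmx (J 0).

Let near_id : exists2 r, 0 < r <= r0 &
  (forall x y, `|x| < r -> `|y| < r -> `|(F y - F x) *m A - (y - x)| <= 2^-1 * `|y - x|) /\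
  (forall x v, `|x| < r -> `|v *m (J x *m A - 1%:M)| <= 2^-1 * `|v : 'rV[R]_n|).
Proof.
have r00' : `|0 : 'rV[R]_n| < r0 by rewrite normr0.
have [_ cJ] := FJ r00'.
(* One factor [n] comes from [C1_ball_mean], the other from [mx_normM]; the [+ 1] keeps [C]
   positive. *)
pose C := n%:R * `|A| * n%:R + 1.
have C0 : 0 < C by rewrite ltr_wpDl// !mulr_ge0.
have e0 : 0 < 2^-1 / C by rewrite divr_gt0// invr_gt0.
have [d d0 dP] := cJ _ e0.
exists (Num.min d r0); first by rewrite lt_min d0 r00 ge_min lexx orbT.
have Jd z : `|z| < Num.min d r0 -> `|J z - J 0| <= 2^-1 / C.
  by rewrite lt_min => /andP[zd _]; apply: dP; rewrite subr0.
have FJ' : C1_ball F J (Num.min d r0).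
  by move=> z; rewrite lt_min => /andP[_ /FJ].
have HC (v : 'rV[R]_n) (w : R) : w <= n%:R * (2^-1 / C) * `|v| -> n%:R * w * `|A| <= 2^-1 * `|v|.
  move=> wv; apply: (@le_trans _ _ (n%:R * (n%:R * (2^-1 / C) * `|v|) * `|A|)).
    by rewrite ler_wpM2r// ler_wpM2l.
  rewrite (_ : _ * `|A| = 2^-1 * `|v| * ((n%:R * `|A| * n%:R) / C)); last by ring.
  by rewrite ler_piMr// ?mulr_ge0 ?invr_ge0// ler_pdivrMr// mul1r lerDl.
split=> [x y xr yr|x v xr].
  have H := C1_ball_mean FJ' Jd xr yr.
  have -> : (F y - F x) *m A - (y - x) = (F y - F x - (y - x) *m J 0) *m A.
    by rewrite [in RHS]mulmxBl -mulmxA mulmxV// mulmx1.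
  by rewrite (le_trans (mx_normM _ _))// HC.
have -> : v *m (J x *m A - 1%:M) = v *m (J x - J 0) *m A.
  by rewrite -mulmxA mulmxBl mulmxV.
rewrite (le_trans (mx_normM _ _))// HC// (le_trans (mx_normM _ _))//.
by rewrite mulrAC ler_wpM2r// ler_wpM2l// Jd.
Qed.

(** Newton iteration with the derivative frozen at 0: [T] below is a 1/2-contraction. The
    neighborhood [U] is cut down to the preimage of [V], so that [F] maps it bijectively onto
    [V]. *)
Lemma inverse_function : local_C1_diffeo F.
Proof.
have [r /andP[rp rr0] [Lip JA]] := near_id.
have uA : A \in unitmx by rewrite unitmx_inv.
(* The first step has length [a < r / 4] and the steps halve, so the iterates stay within
   [2 a < r / 2]. *)
have solve y : `|y *m A| < r / 4 -> exists2 x, `|x| < r & F x = y.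
  move=> yr; set a := `|y *m A| in yr.
  have a0 : 0 <= a by exact: normr_ge0.
  pose T x := x - (F x - y) *m A.
  have TL x x' : `|x| < r -> `|x'| < r -> `|T x' - T x| <= 2^-1 * `|x' - x|.
    move=> xr xr'; rewrite -normrN; apply: le_trans (Lip x x' xr xr').
    rewrite le_eqVlt; apply/orP; left; apply/eqP; congr (`|_|).
    rewrite /T !mulmxBl; move: (F x *m A) (F x' *m A) (y *m A) => c c' b.
    by apply/rowP => i; rewrite !mxE; ring.
  pose u k := iter k T 0.
  have uS k : u k.+1 = T (u k) by [].
  have up k : `|u k| <= 2 * (1 - 2^-1 ^+ k) * a /\ `|u k.+1 - u k| <= 2^-1 ^+ k * a.
    elim: k => [|k [IH1 IH2]].
      rewrite /= normr0 expr0 subrr mulr0 mul0r; split=> //.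
      by rewrite /T F0 sub0r !sub0r subr0 mulNmx opprK mul1r.
    have h k' : 0 < 2^-1 ^+ k' :> R by rewrite exprn_gt0// invr_gt0.
    have ur k' : `|u k'| <= 2 * (1 - 2^-1 ^+ k') * a -> `|u k'| < r.
      move=> /le_lt_trans; apply; have := h k'; have : 0 <= 2^-1 ^+ k' * a by rewrite mulr_ge0// ltW.
      rewrite mulrBr mulrBl; lra.
    have H1 : `|u k.+1| <= 2 * (1 - 2^-1 ^+ k.+1) * a.
      rewrite -(subrK (u k) (u k.+1)) (le_trans (ler_normD _ _))//.
      rewrite (le_trans (lerD IH2 IH1))// exprS; lra.
    split=> //; rewrite [u k.+2]uS [X in _ - X]uS (le_trans (TL _ _ (ur _ IH1) (ur _ H1)))//.
    by rewrite exprS -mulrA ler_wpM2l// invr_ge0.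
  have uc m k : `|u (k + m)%N - u k| <= 2 * (2^-1 ^+ k - 2^-1 ^+ (k + m)) * a.
    elim: m => [|m IH]; first by rewrite addn0 !subrr normr0 mulr0 mul0r.
    rewrite addnS -(subrKA (u (k + m)%N)) (le_trans (ler_normD _ _))//.
    rewrite (le_trans (lerD (up _).2 IH))// exprS; lra.
  pose b k := 2 * a * 2^-1 ^+ k.
  have b0 : tends0 b by apply: tends0Z; [rewrite mulr_ge0|apply: tends0_geometric; lra].
  have [|l lP] := @cauchy_rate_mx R 1 n u b b0.
    move=> k m km; rewrite -(subnKC km) (le_trans (uc _ _))// /b.
    have : 0 <= 2^-1 ^+ (k + (m - k)) * a by rewrite mulr_ge0// exprn_ge0// invr_ge0.
    by lra.
  have lr : `|l| < r.
    have := lP 0%N; rewrite sub0r normrN /b expr0 mulr1 => /le_lt_trans; apply; lra.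
  exists l => //.
  suff : T l = l.
    move=> Tl; have /(congr1 (mulmx^~ (J 0))) : (F l - y) *m A = 0.
      have -> : (F l - y) *m A = l - T l by rewrite /T subKr.
      by rewrite Tl subrr.
    by rewrite mul0mx -mulmxA mulVmx// mulmx1 => /eqP; rewrite subr_eq0 => /eqP.
  apply/eqP; rewrite -subr_eq0 -normr_le0.
  apply: (@le_tends0 _ _ (fun k => 2^-1 * b k + b k.+1) 0).
    apply: tends0D; first by apply: tends0Z; rewrite ?invr_ge0.
    by move=> e /b0[N NP]; exists N => k Nk; rewrite NP// (leq_trans Nk).
  move=> k _; rewrite (_ : T l - l = (T l - u k.+1) + (u k.+1 - l)); last by rewrite addrA subrK.
  apply: le_trans (ler_normD _ _) _; apply: lerD; last exact: (lP k.+1).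
  rewrite uS (le_trans (TL _ _ _ _))//.
    rewrite (le_lt_trans (up k).1)//.
    have : 0 <= 2^-1 ^+ k * a by rewrite mulr_ge0// exprn_ge0// invr_ge0.
    by rewrite mulrBr mulrBl; lra.
  by rewrite ler_wpM2l ?invr_ge0// distrC.
have Finj x y : `|x| < r -> `|y| < r -> `|y - x| <= 2 * `|(F y - F x) *m A|.
  by move=> xr yr; apply: norm_le_double; exact: Lip.
pose V := [set y : 'rV[R]_n | `|y *m A| < r / 4].
pose U := [set x : 'rV[R]_n | `|x| < r /\ V (F x)].
pose G y := xget 0 [set x | `|x| < r /\ F x = y].
have GP y : V y -> `|G y| < r /\ F (G y) = y.
  by rewrite /G; case: xgetP => // H /solve[x xr Fx]; have := H x; case; split.
have GF x : U x -> G (F x) = x.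
  move=> [xr VFx]; have [Gr GE] := GP _ VFx.
  by apply/eqP; rewrite -subr_eq0 -normr_le0 (le_trans (Finj _ _ xr Gr))// GE subrr mul0mx normr0 mulr0.
have oV : open V.
  apply: (open_normP _).2 => y Vy; rewrite /V /= in Vy.
  pose e := (r / 4 - `|y *m A|) / (n%:R * `|A| + 1).
  have c0 : 0 < n%:R * `|A| + 1 by rewrite ltr_wpDl// mulr_ge0.
  exists e => [|z zy]; first by rewrite divr_gt0// subr_gt0.
  rewrite /V/= -(subrK y z) mulmxDl (le_lt_trans (ler_normD _ _))// -ltrBrDr.
  rewrite (le_lt_trans (mx_normM _ _))//.
  move: zy; rewrite /e ltr_pdivlMr// => /(le_lt_trans _); apply.
  by rewrite mulrDr mulr1 mulrAC mulrC ler_wpDr.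
have oU : open U.
  apply: (open_normP _).2 => x [xr Vx].
  have [d d0 dP] : exists2 d, 0 < d & forall y, `|y - F x| < d -> V y.
    exact: ((open_normP _).1 oV).
  have FxJ := (FJ (lt_le_trans xr rr0)).1.
  have [d' d'0 d'P] := has_jac_cont FxJ (divr_gt0 d0 (ltr0n R 2)).
  exists (Num.min d' (r - `|x|)) => [|y]; first by rewrite lt_min d'0 subr_gt0.
  rewrite lt_min => /andP[yd' yr]; split.
    by rewrite -(subrK x y) (le_lt_trans (ler_normD _ _))// -ltrBrDr.
  by apply: dP; rewrite (le_lt_trans (d'P _ yd'))// ltr_pdivrMr// ltr_pMr// ltrDl.
have JU x : `|x| < r -> J x \in unitmx /\ forall v : 'rV_n, `|v| <= 2 * `|v *m J x *m A|.
  by move=> xr; apply: near_unit => // v; exact: JA.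
have V0 : V 0 by rewrite /V /= mul0mx normr0 divr_gt0.
have GL y z : V y -> V z -> `|G z - G y| <= (2 * n%:R * `|A|) * `|z - y|.
  move=> Vy Vz; have [yr Ey] := GP y Vy; have [zr Ez] := GP z Vz.
  rewrite (le_trans (Finj _ _ yr zr))// Ey Ez -!mulrA ler_wpM2l//.
  by rewrite (le_trans (mx_normM _ _))// mulrAC -mulrA.
pose K := 2 * n%:R * `|A|.
have K0 : 0 <= K by rewrite !mulr_ge0.
(* The lower bound in [JU], evaluated at the i-th row of the inverse, bounds that row. *)
have invB x : `|x| < r -> `|invmx (J x)| <= K.
  move=> xr; have [uJx Jx] := JU x xr; apply: mx_norm_le => // i j.
  have := le_trans (mx_norm_ge _ 0 j) (Jx (delta_mx 0 i *m invmx (J x))).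
  rewrite -rowE mxE => /le_trans; apply; rewrite rowE mulmxKV// /K -mulrA ler_wpM2l//.
  rewrite (le_trans (mx_normM _ _))// mulrAC ler_piMr ?mulr_ge0//.
  by apply: mx_norm_le => // k l; rewrite mxE; case: (_ && _); rewrite ?normr1 ?normr0.
split=> //; exists U, V, G; split.
- by split=> //; split; rewrite ?normr0 ?F0.
- by split.
- split.
  + by move=> x [].
  + move=> x y /set_mem Ux /set_mem Uy E.
    by rewrite -(GF _ Ux) -(GF _ Uy) E.
  + by move=> y Vy; have [yr Ey] := GP y Vy; exists (G y) => //; split=> //; rewrite Ey.
- exact: GF.
- split.
    apply: (@C1_on_open R n U F J oU) => [z [zr _]|z [zr _] e e0].
    - exact: (FJ (lt_le_trans zr rr0)).1.
    - have [d d0 dP] := (FJ (lt_le_trans zr rr0)).2 e e0.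
      by exists d => // y _; exact: dP.
  apply: (@C1_on_open R n V G (fun y => invmx (J (G y))) oV).
  + move=> y Vy e e0; have [yr Ey] := GP y Vy; have [uJx _] := JU _ yr.
    set x := G y in yr Ey uJx *.
    pose c := n%:R * K * `|invmx (J x)| + 1.
    have c0 : 0 < c by rewrite ltr_wpDl// !mulr_ge0.
    have [d d0 dP] := (FJ (lt_le_trans yr rr0)).1 _ (divr_gt0 e0 c0).
    have [d1 d10 d1P] : exists2 d, 0 < d & forall z, `|z - y| < d -> V z.
      exact: ((open_normP _).1 oV).
    have K1 : 0 < K + 1 by rewrite ltr_wpDl.
    exists (Num.min d1 (d / (K + 1))); first by rewrite lt_min d10 divr_gt0.
    move=> z; rewrite lt_min => /andP[zd1 zd]; have Vz := d1P z zd1.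
    have [zr Ez] := GP z Vz; have GzK := GL y z Vy Vz.
    have Gzd : `|G z - x| < d.
      rewrite (le_lt_trans GzK)//; move: zd; rewrite ltr_pdivlMr// => /(le_lt_trans _); apply.
      by rewrite mulrC ler_wpM2l// /K lerDl.
    have := dP (G z) Gzd; rewrite Ez Ey => H.
    have -> : G z - x - (z - y) *m invmx (J x) = - ((z - y - (G z - x) *m J x) *m invmx (J x)).
      by rewrite [in RHS]mulmxBl mulmxK// opprB.
    rewrite normrN (le_trans (mx_normM _ _))// mulrAC.
    apply: (@le_trans _ _ (n%:R * `|invmx (J x)| * (e / c * (K * `|z - y|)))).
      by rewrite ler_wpM2l ?mulr_ge0// (le_trans H)// ler_wpM2l ?divr_ge0// ltW.
    have E (a b I Z k : R) : a * I * (b / c * (k * Z)) = b * Z * ((a * k * I) / c) by ring.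
    rewrite E.
    by rewrite ler_piMr// ?mulr_ge0// ?ltW// ltr_pdivrMr// mul1r ltrDl.
  + move=> y Vy e e0; have [yr Ey] := GP y Vy; have [uJx _] := JU _ yr.
    pose c := n%:R * n%:R * K * K + 1.
    have c0 : 0 < c by rewrite ltr_wpDl// !mulr_ge0.
    have [d d0 dP] := (FJ (lt_le_trans yr rr0)).2 _ (divr_gt0 e0 c0).
    have K1 : 0 < K + 1 by rewrite ltr_wpDl.
    exists (d / (K + 1)); first by rewrite divr_gt0.
    move=> z Vz zd; have [zr Ez] := GP z Vz; have GzK := GL y z Vy Vz.
    have [uJz _] := JU _ zr.
    have Gzd : `|G z - G y| < d.
      rewrite (le_lt_trans GzK)//; move: zd; rewrite ltr_pdivlMr// => /(le_lt_trans _); apply.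
      by rewrite mulrC ler_wpM2l// /K lerDl.
    have -> : invmx (J (G z)) - invmx (J (G y)) =
        - (invmx (J (G z)) *m (J (G z) - J (G y)) *m invmx (J (G y))).
      by rewrite mulmxBr mulVmx// mulmxBl mul1mx mulmxK// opprB.
    rewrite normrN (le_trans (mx_normM _ _))//.
    apply: (@le_trans _ _ (n%:R * (n%:R * K * (e / c)) * K)).
      rewrite ler_pM ?mulr_ge0 ?invB// ler_wpM2l// (le_trans (mx_normM _ _))//.
      by rewrite ler_pM ?mulr_ge0// ?dP// ler_wpM2l// invB.
    have E (a b k : R) : a * (a * k * (b / c)) * k = b * ((a * a * k * k) / c) by ring.
    rewrite E.
    by rewrite ler_piMr// ?ltW// ltr_pdivrMr// mul1r ltrDl.
Qed.

End InverseFunction.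

(** * Limits of maps in the C1 sense *)

Section C1Limit.
Variable R : realType.

Lemma has_jacB n m (F G : 'rV[R]_n -> 'rV[R]_m) x A B :
  has_jac F x A -> has_jac G x B -> has_jac (fun z => F z - G z) x (A - B).
Proof.
move=> FA GB e e0; have e2 : 0 < e / 2 by rewrite divr_gt0.
have [d d0 dP] := FA _ e2; have [d' d'0 d'P] := GB _ e2.
exists (Num.min d d') => [|y]; first by rewrite lt_min d0.
rewrite lt_min => /andP[yd yd'].
have -> : F y - G y - (F x - G x) - (y - x) *m (A - B) =
    (F y - F x - (y - x) *m A) - (G y - G x - (y - x) *m B).
  rewrite mulmxBr; move: (_ *m A) (_ *m B) => a b.
  by apply/rowP => i; rewrite !mxE; ring.
rewrite (le_trans (ler_normB _ _))// (le_trans (lerD (dP y yd) (d'P y yd')))//.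
by rewrite -mulrDl -splitr.
Qed.

(** By the mean value inequality [Phi l - Phi k] has Lipschitz constant [n b k]. Since all maps fix
    0 this gives uniform convergence, and the Lipschitz bound passes to the limit [l -> oo], which
    yields differentiability of the limit. *)
Lemma C1_limit n m (Phi : nat -> 'rV[R]_n -> 'rV[R]_m) J b r : tends0 b ->
  (forall k, C1_ball (Phi k) (J k) r) -> (forall k, Phi k 0 = 0) ->
  (forall x k l, `|x| < r -> (k <= l)%N -> `|J l x - J k x| <= b k) ->
  exists Psi Jl, [/\ C1_ball Psi Jl r,
    forall x k, `|x| < r -> `|Phi k x - Psi x| <= n%:R * `|x| * b k &
    forall x k, `|x| < r -> `|J k x - Jl x| <= b k].
Proof.
move=> b0 PJ P0 Jb.
have Pb k l x y : `|x| < r -> `|y| < r -> (k <= l)%N ->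
    `|Phi l y - Phi k y - (Phi l x - Phi k x)| <= n%:R * b k * `|y - x|.
  move=> xr yr kl.
  pose D z := Phi l z - Phi k z; pose JD z := J l z - J k z.
  have DJ : C1_ball D JD r.
    move=> z zr; have [lz cl] := PJ l z zr; have [kz ck] := PJ k z zr.
    split; first exact: has_jacB.
    move=> e e0; have e2 : 0 < e / 2 by rewrite divr_gt0.
    have [d d0 dP] := cl _ e2; have [d' d'0 d'P] := ck _ e2.
    exists (Num.min d d') => [|w]; first by rewrite lt_min d0.
    rewrite lt_min => /andP[wd wd'].
    rewrite (_ : JD w - JD z = (J l w - J l z) - (J k w - J k z)).
      by rewrite (le_trans (ler_normB _ _))// [leRHS]splitr lerD ?dP ?d'P.
    by apply/matrixP => i j; rewrite !mxE; ring.
  have := @C1_ball_mean R n m D JD r 0 (b k) x y DJ _ xr yr.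
  by rewrite mulmx0 subr0; apply => z zr; rewrite subr0 Jb.
have /choice[Psi PsiP] : forall x, exists p : 'rV[R]_m, `|x| < r ->
    forall k, `|Phi k x - p| <= n%:R * `|x| * b k.
  move=> x; have [xr|_] := ltP `|x| r; last by exists 0.
  have [|k l kl|p pP] := @cauchy_rate_mx R 1 m (Phi ^~ x) (fun k => n%:R * `|x| * b k).
  - by apply: tends0Z => //; rewrite mulr_ge0.
  - have r00 : `|0 : 'rV[R]_n| < r by rewrite normr0 (le_lt_trans _ xr).
    by have := Pb k l 0 x r00 xr kl; rewrite !P0 subrr !subr0 mulrAC.
  - by exists p.
have /choice[Jl JlP] : forall x, exists p : 'M[R]_(n, m), `|x| < r ->
    forall k, `|J k x - p| <= b k.
  move=> x; have [xr|_] := ltP `|x| r; last by exists 0.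
  have [k l kl|p pP] := @cauchy_rate_mx R n m (J ^~ x) b b0; first exact: Jb.
  by exists p.
exists Psi, Jl; split; [|by move=> x k xr; exact: PsiP|by move=> x k xr; exact: JlP].
have small e : 0 < e -> exists k, b k <= e by move=> /b0[N bN]; exists N; exact: bN.
move=> x xr; split; last first.
  move=> e e0; have e3 : 0 < e / 3 by rewrite divr_gt0.
  have [k bk] := small _ e3; have [d d0 dP] := (PJ k x xr).2 _ e3.
  exists (Num.min d (r - `|x|)) => [|y]; first by rewrite lt_min d0 subr_gt0.
  rewrite lt_min => /andP[yd yx].
  have yr : `|y| < r by rewrite -(subrK x y) (le_lt_trans (ler_normD _ _))// -ltrBrDr.
  have -> : Jl y - Jl x = (J k y - J k x) - (J k y - Jl y) + (J k x - Jl x).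
    by apply/matrixP => i j; rewrite !mxE; ring.
  have := ler_normD (J k y - J k x - (J k y - Jl y)) (J k x - Jl x).
  have := ler_normB (J k y - J k x) (J k y - Jl y).
  have := dP y yd; have := JlP y yr k; have := JlP x xr k; lra.
(* Three errors: 1 for the remainder of [Phi k], [n] for replacing [Phi k] by [Psi], [n] for
   replacing [J k] by [Jl]. *)
move=> e e0; pose c := n%:R + n%:R + 1 : R.
have c0 : 0 < c by rewrite ltr_wpDl// addr_ge0.
have ec : 0 < e / c by rewrite divr_gt0.
have [k bk] := small _ ec; have [d d0 dP] := (PJ k x xr).1 _ ec.
exists (Num.min d (r - `|x|)) => [|y]; first by rewrite lt_min d0 subr_gt0.
rewrite lt_min => /andP[yd yx].
have yr : `|y| < r by rewrite -(subrK x y) (le_lt_trans (ler_normD _ _))// -ltrBrDr.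
have H1 : `|Psi y - Phi k y - (Psi x - Phi k x)| <= n%:R * b k * `|y - x|.
  rewrite -subr_le0; apply: (@le_tends0 _ _ (fun l => n%:R * `|y| * b l + n%:R * `|x| * b l) k).
    by apply: tends0D; apply: tends0Z; rewrite ?mulr_ge0.
  move=> l kl; rewrite lerBlDl.
  have -> : Psi y - Phi k y - (Psi x - Phi k x) =
     (Phi l y - Phi k y - (Phi l x - Phi k x)) - (Phi l y - Psi y) + (Phi l x - Psi x).
    by apply/rowP => i; rewrite !mxE; ring.
  have := ler_normD (Phi l y - Phi k y - (Phi l x - Phi k x) - (Phi l y - Psi y)) (Phi l x - Psi x).
  have := ler_normB (Phi l y - Phi k y - (Phi l x - Phi k x)) (Phi l y - Psi y).
  have := Pb k l x y xr yr kl; have := PsiP y yr l; have := PsiP x xr l; lra.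
have H2 : `|(y - x) *m (J k x - Jl x)| <= n%:R * `|y - x| * (e / c).
  by rewrite (le_trans (mx_normM _ _))// ler_wpM2l ?mulr_ge0// (le_trans (JlP _ xr _)).
have -> : Psi y - Psi x - (y - x) *m Jl x =
    (Phi k y - Phi k x - (y - x) *m J k x) + (Psi y - Phi k y - (Psi x - Phi k x)) +
    (y - x) *m (J k x - Jl x).
  rewrite mulmxBr; move: (_ *m J k x) (_ *m Jl x) => u v.
  by apply/rowP => i; rewrite !mxE; ring.
have H3 := dP y yd.
have H1' : n%:R * b k * `|y - x| <= n%:R * (e / c) * `|y - x|.
  by rewrite ler_wpM2r// ler_wpM2l.
have -> : e * `|y - x| = (e / c) * `|y - x| + n%:R * (e / c) * `|y - x| + n%:R * `|y - x| * (e / c).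
  have E : e = e / c * (n%:R + n%:R + 1) by rewrite -/c divfK// gt_eqF.
  by rewrite {1}E; move: (e / c) => a; ring.
rewrite (le_trans (ler_normD _ _))// lerD// (le_trans (ler_normD _ _))// lerD//.
exact: le_trans H1 H1'.
Qed.

End C1Limit.

(** * Summable sequences *)

Section Summability.
Variable R : realType.
Implicit Types e : nat -> R.

(** Bounded partial sums, which is convergence for the nonnegative sequences to which it is
    applied. *)
Definition summ e := exists S, forall n, \sum_(k < n) e k <= S.

Lemma summ_le e f : (forall k, e k <= f k) -> summ f -> summ e.
Proof.
move=> ef [S SP]; exists S => n; rewrite (le_trans _ (SP n))//.
by apply: ler_sum => k _.
Qed.

Lemma summZ e C : 0 <= C -> summ e -> summ (fun k => C * e k).
Proof.
by move=> C0 [S SP]; exists (C * S) => n; rewrite -mulr_sumr ler_wpM2l.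
Qed.

Lemma summD e f : summ e -> summ f -> summ (fun k => e k + f k).
Proof.
by move=> [S SP] [T TP]; exists (S + T) => n; rewrite big_split lerD ?SP ?TP.
Qed.

Lemma summ_tail e : (forall k, 0 <= e k) -> summ e ->
  exists2 b, tends0 b & forall n m, (n <= m)%N -> \sum_(n <= k < m) e k <= b n.
Proof.
move=> e0 [S SP]; pose P := [set \sum_(k < n) e k | n in setT].
have supP : has_sup P.
  by split; [exists (\sum_(k < 0) e k); exists 0%N|exists S => _ [n _ <-]].
have mono n m : (n <= m)%N -> \sum_(k < m) e k = \sum_(k < n) e k + \sum_(n <= k < m) e k.
  by move=> nm; rewrite -!(big_mkord xpredT e) -big_cat_nat.
exists (fun n => sup P - \sum_(k < n) e k).
  move=> d d0; have [_ [N _ <-] Nd] := sup_adherent d0 supP.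
  exists N => n Nn; rewrite (mono _ _ Nn).
  have : 0 <= \sum_(N <= k < n) e k by apply: sumr_ge0.
  by move: Nd; lra.
move=> n m nm; rewrite lerBrDl -mono//.
by apply: ub_le_sup; [exact: supP.2|exists m].
Qed.

Lemma summ_small e : (forall k, 0 <= e k) -> summ e -> tends0 e.
Proof.
move=> e0 /(summ_tail e0)[b b0 bP]; apply: tends0_le b0 => n.
by have := bP n n.+1 (leqnSn n); rewrite big_nat1.
Qed.

(** Discrete Gronwall inequality, from [1 + e <= exp e]. *)
Lemma prod_bound (X e : nat -> R) : (forall k, 0 <= X k) -> (forall k, 0 <= e k) ->
  (forall k, X k.+1 <= (1 + e k) * X k) ->
  forall n, X n <= X 0%N * expR (\sum_(k < n) e k).
Proof.
move=> X0 e0 XS; elim=> [|n IH]; first by rewrite big_ord0 expR0 mulr1.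
rewrite big_ord_recr/= expRD mulrA (le_trans (XS n))// mulrC.
by rewrite ler_pM// ?addr_ge0// expR_ge1Dx.
Qed.

End Summability.

(** * The plane *)

Section Plane.
Variable R : realType.

Lemma I2E (P : 'I_2 -> Prop) : P 0 -> P 1 -> forall i, P i.
Proof.
move=> P0 P1 i; have [->//|i0] := eqVneq i 0.
have -> // : i = 1; apply/val_inj => /=; case: i i0 => -[|[|//]]//.
Qed.

Lemma sum2E (F : 'I_2 -> R) : \sum_i F i = F 0 + F 1.
Proof. by rewrite !big_ord_recl big_ord0 addr0; congr (_ + F _); apply/val_inj. Qed.

Lemma mulmx2E m n (A : 'M[R]_(m, 2)) (B : 'M[R]_(2, n)) i j :
  (A *m B) i j = A i 0 * B 0 j + A i 1 * B 1 j.
Proof. by rewrite mxE sum2E. Qed.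

Definition row2 (a b : R) : 'rV[R]_2 := \row_j if j == 0 then a else b.
Definition mx2 (a b c d : R) : 'M[R]_2 :=
  \matrix_(i, j) if i == 0 then if j == 0 then a else b else if j == 0 then c else d.

Lemma row2_0 a b i : row2 a b i 0 = a. Proof. by rewrite mxE. Qed.
Lemma row2_1 a b i : row2 a b i 1 = b. Proof. by rewrite mxE. Qed.
Lemma mx2_00 a b c d : mx2 a b c d 0 0 = a. Proof. by rewrite mxE. Qed.
Lemma mx2_01 a b c d : mx2 a b c d 0 1 = b. Proof. by rewrite mxE. Qed.
Lemma mx2_10 a b c d : mx2 a b c d 1 0 = c. Proof. by rewrite mxE. Qed.
Lemma mx2_11 a b c d : mx2 a b c d 1 1 = d. Proof. by rewrite mxE. Qed.
Definition mx2E := (row2_0, row2_1, mx2_00, mx2_01, mx2_10, mx2_11).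

Lemma eq_row2 (x y : 'rV[R]_2) : x 0 0 = y 0 0 -> x 0 1 = y 0 1 -> x = y.
Proof. by move=> H0 H1; apply/rowP; apply: I2E. Qed.

Lemma eq_mx2 (A B : 'M[R]_2) : A 0 0 = B 0 0 -> A 0 1 = B 0 1 -> A 1 0 = B 1 0 ->
  A 1 1 = B 1 1 -> A = B.
Proof. by move=> *; apply/matrixP; apply: I2E; apply: I2E. Qed.

Lemma norm_row2_le (x : 'rV[R]_2) e : `|x 0 0| <= e -> `|x 0 1| <= e -> `|x| <= e.
Proof.
move=> x0 x1; apply: mx_norm_le => [|i]; first exact: le_trans x0.
by rewrite (ord1 i); apply: I2E.
Qed.

Lemma norm_mx2_le (A : 'M[R]_2) e : `|A 0 0| <= e -> `|A 0 1| <= e -> `|A 1 0| <= e ->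
  `|A 1 1| <= e -> `|A| <= e.
Proof.
move=> A00 *; apply: mx_norm_le; first exact: le_trans A00.
by apply: I2E; apply: I2E.
Qed.

Lemma diag2E (a b : R) : diag2 a b = mx2 a 0 0 b.
Proof.
by apply: eq_mx2; rewrite !mx2E /diag2 !mxE//= ?mulr1n ?mulr0n.
Qed.

Lemma iter_contract (V : normedModType R) (F : V -> V) (r mu : R) (x : V) k :
  0 < mu < 1 -> (forall x, `|x| < r -> `|F x| <= mu * `|x|) -> `|x| < r ->
  `|iter k F x| <= mu ^+ k * `|x| /\ `|iter k F x| < r.
Proof.
move=> /andP[mu0 mu1] Fmu xr.
have small : `|iter k F x| <= mu ^+ k * `|x| -> `|iter k F x| < r.
  move=> H; rewrite (le_lt_trans H)// (le_lt_trans _ xr)// ler_piMl//.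
  by rewrite exprn_ile1// ltW.
suff H : `|iter k F x| <= mu ^+ k * `|x| by split=> //; exact: small.
elim: k small => [|k IH] small; first by rewrite expr0 mul1r.
have xk : `|iter k F x| <= mu ^+ k * `|x|.
  apply: IH => H; rewrite (le_lt_trans H)// (le_lt_trans _ xr)// ler_piMl//.
  by rewrite exprn_ile1// ltW.
rewrite /= (le_trans (Fmu _ _)) ?exprS -?mulrA ?ler_wpM2l ?(ltW mu0)//.
rewrite (le_lt_trans xk)// (le_lt_trans _ xr)// ler_piMl//.
by rewrite exprn_ile1// ltW.
Qed.

Lemma is_derive_normP (h : R -> R) (s d : R) :
  is_derive s 1 h d <-> forall e, 0 < e -> exists2 c, 0 < c &
    forall t, `|t - s| < c -> `|h t - h s - (t - s) * d| <= e * `|t - s|.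
Proof.
pose Q (u : R) := u^-1 *: ((h \o shift s) (u *: (1 : R)) - h s).
have QE t : t != s -> h t - h s - (t - s) * d = (t - s) * (Q (t - s) - d).
  move=> ts; rewrite /Q mulrBr [_ *: 1]mulr1 /= subrK.
  by rewrite -[_^-1 *: _]/(_^-1 * _) mulrA divff ?mul1r// subr_eq0.
split=> [[dh Dh] e e0|H].
  have : Q u @[u --> 0^'] --> d by rewrite -Dh.
  move=> /cvgrPdist_le/(_ e e0)[c /= c0 cP].
  exists c => // t tc; have [->|ts] := eqVneq t s; first by rewrite !subrr mul0r subrr normr0 mulr0.
  rewrite QE// normrM mulrC ler_wpM2r// distrC cP ?subr_eq0//.
  by rewrite /ball_/= sub0r normrN.
suff HQ : Q u @[u --> 0^'] --> d.
  split; first by apply/cvg_ex; exists d.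
  exact: (cvg_lim _ HQ).
apply/cvgrPdist_le => e e0; have [c c0 cP] := H e e0.
exists c => // u; rewrite /ball_/= sub0r normrN => uc u0.
have us : u + s != s by rewrite -subr_eq0 addrK.
have := cP (u + s); rewrite QE// addrK => /(_ uc).
by rewrite normrM mulrC ler_pM2r ?normr_gt0// distrC.
Qed.

Lemma C1_ball_comp n m p (F : 'rV[R]_n -> 'rV[R]_m) (G : 'rV[R]_m -> 'rV[R]_p) J K r r' :
  C1_ball F J r -> C1_ball G K r' -> (forall x, `|x| < r -> `|F x| < r') ->
  C1_ball (G \o F) (fun x => J x *m K (F x)) r.
Proof.
move=> FJ GK FG x xr; have [Fx cJ] := FJ x xr; have [GFx cK] := GK _ (FG x xr).
split; first exact: has_jac_comp.
move=> e e0.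
pose c := m%:R * `|K (F x)| + m%:R * (`|J x| + 1) + 1.
have c0 : 0 < c by rewrite ltr_wpDl// addr_ge0// ?mulr_ge0// addr_ge0.
have ec0 : 0 < e / c by rewrite divr_gt0.
(* The 1 serves to bound [J y] by [|J x| + 1]. *)
have min0 : 0 < Num.min 1 (e / c) by rewrite lt_min ltr01.
have [d d0 dP] := cJ _ min0.
have [d1 d10 d1P] := cK _ ec0.
have [d2 d20 d2P] := has_jac_cont Fx (divr_gt0 d10 (ltr0n R 2)).
exists (Num.min d d2) => [|y]; first by rewrite lt_min d0.
rewrite lt_min => /andP[yd yd2].
have := dP y yd; rewrite le_min => /andP[Jy1 Jye].
have /d1P Ky : `|F y - F x| < d1.
  by rewrite (le_lt_trans (d2P y yd2))// ltr_pdivrMr// ltr_pMr// ltrDl.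
have -> : J y *m K (F y) - J x *m K (F x) =
    (J y - J x) *m K (F x) + J y *m (K (F y) - K (F x)).
  by rewrite mulmxBl mulmxBr [RHS]addrC addrA subrK.
have Jy : `|J y| <= `|J x| + 1.
  by rewrite -(subrK (J x) (J y)) (le_trans (ler_normD _ _))// addrC lerD.
rewrite (le_trans (ler_normD _ _))//.
rewrite (le_trans (lerD (mx_normM _ _) (mx_normM _ _)))//.
apply: (@le_trans _ _ (m%:R * (e / c) * `|K (F x)| + m%:R * (`|J x| + 1) * (e / c))).
  rewrite lerD//; first by rewrite ler_wpM2r// ler_wpM2l.
  by rewrite ler_pM ?mulr_ge0// ler_wpM2l.
have E : e = e / c * (m%:R * `|K (F x)| + m%:R * (`|J x| + 1) + 1).
  by rewrite -/c divfK// gt_eqF.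
rewrite [leRHS]E; move: ec0; move: (e / c) => a a0.
rewrite -subr_ge0 (_ : _ - _ = a); first exact: ltW.
by ring.
Qed.

Lemma has_jac_mul n m (A : 'M[R]_(n, m)) x : has_jac (fun y => y *m A) x A.
Proof.
move=> e e0; exists 1 => // y _.
by rewrite mulmxBl subrr normr0 mulr_ge0// ltW.
Qed.

Lemma C1_ball_mulr n m p (F : 'rV[R]_n -> 'rV[R]_m) J (A : 'M[R]_(m, p)) r :
  C1_ball F J r -> C1_ball (fun x => F x *m A) (fun x => J x *m A) r.
Proof.
move=> FJ x xr; have [Fx cJ] := FJ x xr; split; first exact: (has_jac_comp Fx (has_jac_mul A _)).
move=> e e0; pose c := m%:R * `|A| + 1.
have c0 : 0 < c by rewrite ltr_wpDl// mulr_ge0.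
have [d d0 dP] := cJ _ (divr_gt0 e0 c0); exists d => // y yd.
rewrite -mulmxBl (le_trans (mx_normM _ _))// mulrAC.
rewrite (le_trans (ler_wpM2l _ (dP y yd))) ?mulr_ge0// mulrCA ler_piMr// ?ltW//.
by rewrite ltr_pdivrMr// mul1r ltrDl.
Qed.

Lemma C1_ball_le n m (F : 'rV[R]_n -> 'rV[R]_m) J r r' : r' <= r ->
  C1_ball F J r -> C1_ball F J r'.
Proof. by move=> rr FJ x /lt_le_trans/(_ rr)/FJ. Qed.

End Plane.

(** The mean value inequality doubles the [(1 - |l2|) / 4], and adding the norm [|l2|] of the linear
    part gives [(1 + |l2|) / 2]. *)
Lemma C1_ball_contract (R : realType) (l1 l2 r : R) (F : 'rV[R]_2 -> 'rV[R]_2) J x :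
  `|l1| <= `|l2| -> F 0 = 0 -> C1_ball F J r ->
  (forall z, `|z| < r -> `|J z - diag2 l1 l2| <= (1 - `|l2|) / 4) ->
  `|x| < r -> `|F x| <= (1 + `|l2|) / 2 * `|x|.
Proof.
move=> hl12 F0 FJ JF xr; have r0 : 0 <= r by rewrite (le_trans _ (ltW xr)).
have z0 : `|0 : 'rV[R]_2| < r by rewrite normr0 (le_lt_trans _ xr).
have := C1_ball_mean FJ JF z0 xr; rewrite F0 !subr0 => H.
have D : `|x *m diag2 l1 l2| <= `|l2| * `|x|.
  rewrite diag2E; apply: norm_row2_le; rewrite mulmx2E !mx2E ?mulr0 ?addr0 ?add0r normrM mulrC.
    by rewrite ler_pM// mx_norm_ge.
  by rewrite ler_wpM2l// mx_norm_ge.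
rewrite -(subrK (x *m diag2 l1 l2) (F x)) (le_trans (ler_normD _ _))//.
by rewrite (le_trans (lerD H D))// -mulrDl ler_wpM2r//; move: (`|l2|) => p; lra.
Qed.

(** * Linearization along an invariant curve *)

Section Linearization.
Variables (R : realType) (l1 l2 : R).
Hypotheses (hl1 : 0 < `|l1|) (hl12 : `|l1| <= `|l2|) (hl2 : `|l2| < 1).
Variables (F : 'rV[R]_2 -> 'rV[R]_2) (JF : 'rV[R]_2 -> 'M[R]_2) (r : R).
Hypotheses (r0 : 0 < r) (r1 : r <= 1) (F0 : F 0 = 0) (FJ : C1_ball F JF r).
Variables (mu : R) (sg : R -> R) (C : R).
Hypotheses (mu0 : 0 < mu) (mu1 : mu < 1) (Fmu : forall x, `|x| < r -> `|F x| <= mu * `|x|).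
Hypotheses (sg00 : sg 0 = 0) (sg0 : forall t, 0 <= t -> 0 <= sg t)
  (sgle : forall s t, 0 <= s -> s <= t -> sg s <= sg t) (C0 : 0 <= C).
Hypothesis JFs : forall x, `|x| < r -> `|JF x - diag2 l1 l2| <= C * sg `|x|.
Hypothesis summ_mu : summ (fun k => sg (mu ^+ k)).
Hypothesis Cr : forall t, 0 <= t < r -> C * sg t <= 1.
Variables (h dh : R -> R).
Hypotheses (h0 : h 0 = 0) (Dh : forall s : R, `|s| < r -> is_derive s 1 h (dh s))
  (dhc : forall s : R, `|s| < r -> {for s, continuous dh})
  (dhs : forall s, `|s| < r -> `|dh s| <= C * sg `|s|).

Definition straight (x : 'rV[R]_2) := row2 (x 0 0 - h (x 0 1)) (x 0 1).
Definition Jstraight (x : 'rV[R]_2) := mx2 1 0 (- dh (x 0 1)) 1.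

(* The derivative of the straightened second-variable coupling: its vanishing on
   the curve expresses the invariance of the curve. *)
Definition coupling (x : 'rV[R]_2) := dh (x 0 1) * JF x 0 0 + JF x 1 0 -
  dh (F x 0 1) * (dh (x 0 1) * JF x 0 1 + JF x 1 1).

Variable beta : nat -> R.
Hypotheses (beta0 : forall k, 0 <= beta k)
  (summ_beta : summ (fun k => (`|l2| / `|l1|) ^+ k * beta k))
  (coupling_le : forall k x, `|x| < r -> `|coupling (iter k F x)| <= beta k).

Let l10 : l1 != 0. Proof. by rewrite -normr_gt0. Qed.
Let l20 : l2 != 0. Proof. by rewrite -normr_gt0 (lt_le_trans hl1). Qed.

Let iterF k x : `|x| < r -> `|iter k F x| <= mu ^+ k * `|x| /\ `|iter k F x| < r.
Proof.
by apply: iter_contract => //; rewrite mu0.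
Qed.

Let straightJ : C1_ball straight Jstraight r.
Proof.
move=> x xr; have x1r : `|x 0 1| < r by rewrite (le_lt_trans (mx_norm_ge _ _ _)).
split.
  move=> e e0; have [d d0 dP] := (is_derive_normP _ _ _).1 (Dh x1r) e e0.
  exists d => // y yx; have yx1 : `|y 0 1 - x 0 1| <= `|y - x|.
    by have := mx_norm_ge (y - x) 0 1; rewrite !mxE.
  have := dP _ (le_lt_trans yx1 yx) => H.
  apply: (@le_trans _ _ (e * `|y 0 1 - x 0 1|)); last by rewrite ler_wpM2l// ltW.
  apply: norm_row2_le; rewrite /straight !mxE !sum2E !mxE /=.
    apply: le_trans H; rewrite -normrN le_eqVlt; apply/orP; left; apply/eqP.
    by congr (`|_|); ring.
  rewrite (_ : _ - _ = 0); first by rewrite normr0 mulr_ge0// ltW.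
  by ring.
move=> e e0; have [d d0 dP] := (continuous_normP _ _).1 (dhc x1r) e e0.
exists d => // y yx; have yx1 : `|y 0 1 - x 0 1| <= `|y - x|.
  by have := mx_norm_ge (y - x) 0 1; rewrite !mxE.
have H := dP _ (le_lt_trans yx1 yx).
have e0' := ltW e0.
apply: norm_mx2_le; rewrite /Jstraight !mxE /= ?subrr ?normr0//.
by rewrite -opprD normrN.
Qed.

Let JFk k x := iteri k (fun i A => A *m JF (iter i F x)) (1%:M : 'M[R]_2).

Let iterJ k : C1_ball (iter k F) (JFk k) r.
Proof.
elim: k => [|k IH].
  move=> x xr; split; last by move=> e e0; exists 1 => // y _; rewrite subrr normr0 ltW.
  by move=> e e0; exists 1 => // y _; rewrite mulmx1 subrr normr0 mulr_ge0// ltW.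
exact: (C1_ball_comp IH FJ (fun x xr => (iterF k xr).2)).
Qed.

Let D k : 'M[R]_2 := mx2 (l1 ^- k) 0 0 (l2 ^- k).
(** The curve is straightened once, after the k-th iterate, so [F] itself is never conjugated.
    [Phi k (F x)] is [Phi k.+1 x] times the linear part, exactly, and this makes the limit a
    conjugacy. *)
Let Phi k x : 'rV[R]_2 := straight (iter k F x) *m D k.
Let J k x : 'M[R]_2 := JFk k x *m Jstraight (iter k F x) *m D k.

Let PhiJ k : C1_ball (Phi k) (J k) r.
Proof.
exact: C1_ball_mulr (C1_ball_comp (iterJ k) straightJ (fun x xr => (iterF k xr).2)).
Qed.

Let Di k : 'M[R]_2 := mx2 (l1 ^+ k) 0 0 (l2 ^+ k).
Let Is (x : 'rV[R]_2) := mx2 1 0 (dh (x 0 1)) 1 : 'M[R]_2.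
(** The relative increment of the cocycle. The bracket is the Jacobian of the straightened map at
    [y], whose entry (1, 0) is [coupling y]; the diagonal factors multiply that entry by
    [(l2 / l1)^k / l1] and the opposite one by the harmless [(l1 / l2)^k / l2]. *)
Let E k (x : 'rV[R]_2) : 'M[R]_2 :=
  let y := iter k F x in Di k *m (Is y *m JF y *m Jstraight (F y)) *m D k.+1 - 1%:M.

Let JS k x : J k.+1 x - J k x = J k x *m E k x.
Proof.
have DDi : D k *m Di k = 1%:M.
  by apply: eq_mx2; rewrite mulmx2E !mxE/= ?mul0r ?mulr0 ?addr0 ?add0r ?mulVf ?expf_neq0.
have SI (y : 'rV[R]_2) : Jstraight y *m Is y = 1%:M.
  by apply: eq_mx2; rewrite mulmx2E !mxE/=; ring.
rewrite /E mulmxBr mulmx1; congr (_ - _).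
have JDi : J k x *m Di k *m Is (iter k F x) = JFk k x.
  by rewrite /J -(mulmxA _ (D k)) DDi mulmx1 -mulmxA SI mulmx1.
by rewrite !mulmxA JDi.
Qed.

(** The first summand serves the three entries that are not amplified, the second the coupling. *)
Let K := 2 * C / `|l1| + `|l1|^-1.
Let ee k := K * (sg (mu ^+ k) + (`|l2| / `|l1|) ^+ k * beta k).

Let E_le k x : `|x| < r -> `|E k x| <= ee k.
Proof.
move=> xr; have [xk yr] := iterF k xr; rewrite /E; set y := iter k F x in xk yr *.
have k1 (k' : nat) : 0 < mu ^+ k' by rewrite exprn_gt0.
have yk : `|y| <= mu ^+ k.
  by rewrite (le_trans xk)// ler_piMr// ltW// (lt_le_trans xr).
have Fyr : `|F y| <= `|y| by rewrite (le_trans (Fmu yr))// ler_piMl// ltW.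
pose S := sg (mu ^+ k).
have S0 : 0 <= S by apply: sg0; exact: ltW.
have CSy : C * sg `|y| <= C * S by rewrite ler_wpM2l// sgle.
have CS1 (t : R) : `|t| <= `|y| -> `|dh t| <= C * S /\ `|dh t| <= 1.
  move=> ty; have tr : `|t| < r by exact: le_lt_trans yr.
  rewrite !(le_trans (dhs tr))//; last by rewrite ler_wpM2l// sgle// (le_trans ty).
  by rewrite Cr// normr_ge0.
have [d1 d2] : `|dh (y 0 1)| <= C * S /\ `|dh (y 0 1)| <= 1 by apply: CS1; exact: mx_norm_ge.
have [d3 d4] : `|dh (F y 0 1)| <= C * S /\ `|dh (F y 0 1)| <= 1.
  by apply: CS1; rewrite (le_trans (mx_norm_ge _ _ _)).
have fij i j : `|JF y i j - diag2 l1 l2 i j| <= C * S /\ `|JF y i j - diag2 l1 l2 i j| <= 1.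
  have := mx_norm_ge (JF y - diag2 l1 l2) i j; rewrite !mxE => H.
  have H' := le_trans H (JFs yr); split; first exact: le_trans H' _.
  by apply: (le_trans H'); rewrite Cr// normr_ge0.
have := coupling_le k xr; rewrite -/y /coupling => cb.
have := fij 0 0; have := fij 0 1; have := fij 1 1; rewrite diag2E !mx2E subr0.
move=> [f11 _] [f01 f01'] [f00 _].
have q0 := ltW hl1; have q1 : 0 <= `|l1|^-1 by rewrite invr_ge0.
have th0 : 0 <= (`|l2| / `|l1|) ^+ k by rewrite exprn_ge0// divr_ge0.
have bk := beta0 k.
have eeS : (C * S + C * S) / `|l1| <= ee k.
  rewrite /ee -/S (_ : _ / _ = 2 * C / `|l1| * S); last by ring.
  rewrite ler_pM ?mulr_ge0// ?addr_ge0// /K; last by rewrite lerDl mulr_ge0.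
  by rewrite lerDl.
have le_ee (z : R) : `|z| <= C * S + C * S -> `|z / l1| <= ee k /\ `|z / l2| <= ee k.
  move=> zS; split; apply: le_trans eeS; rewrite normrM normfV.
    by rewrite ler_wpM2r.
  by rewrite ler_pM// lef_pV2 ?posrE// normr_gt0.
have small (u v : R) : `|u| <= 1 -> `|v| <= C * S -> `|u * v| <= C * S.
  by move=> u1 vS; rewrite normrM (le_trans _ vS)// ler_piMl.
have CS0 : 0 <= C * S by rewrite mulr_ge0.
have l1k : l1 ^+ k != 0 by rewrite expf_neq0.
have l2k : l2 ^+ k != 0 by rewrite expf_neq0.
apply: norm_mx2_le; rewrite !(mxE, sum2E) /= ?mulr0n ?mulr1n ?(mul0r, mul1r, mulr0, mulr1, addr0, add0r, subr0).
- rewrite (_ : _ - 1 = (JF y 0 0 - l1 - dh (F y 0 1) * JF y 0 1) / l1).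
    by apply: (le_ee _ _).1; rewrite (le_trans (ler_normB _ _))// lerD ?small.
  by rewrite exprS; field; rewrite l10 l1k.
- rewrite (_ : _ / _ = (l1 / l2) ^+ k * (JF y 0 1 / l2)).
    rewrite normrM; apply: (@le_trans _ _ `|JF y 0 1 / l2|).
      rewrite ler_piMl// normrX exprn_ile1// normrM normfV ler_pdivrMr ?mul1r//.
      by rewrite normr_gt0.
    by apply: (le_ee _ _).2; rewrite (le_trans f01)// lerDl.
  by rewrite exprS expr_div_n; field; rewrite l20 l2k.
- rewrite (_ : _ / _ = (l2 / l1) ^+ k * (coupling y / l1)).
    rewrite normrM normrX !normrM !normfV /coupling.
    apply: (@le_trans _ _ (`|l1|^-1 * ((`|l2| / `|l1|) ^+ k * beta k))).
      by rewrite mulrA mulrC ler_wpM2l// ler_wpM2l.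
    have H : 0 <= 2 * C / `|l1| by rewrite !mulr_ge0.
    by rewrite /ee ler_pM// ?mulr_ge0// /K ?lerDr// lerDr.
  by rewrite exprS expr_div_n /coupling; field; rewrite l10 l1k.
- rewrite (_ : _ - 1 = (JF y 1 1 - l2 + dh (y 0 1) * JF y 0 1) / l2).
    by apply: (le_ee _ _).2; rewrite (le_trans (ler_normD _ _))// lerD ?small.
  by rewrite exprS; field; rewrite l20 l2k.
Qed.

Let ee0 k : 0 <= ee k.
Proof. by rewrite (le_trans _ (@E_le k 0 _)) ?normr0. Qed.

Let summ_ee : summ ee.
Proof.
apply: summZ; last exact: summD.
by rewrite /K addr_ge0 ?mulr_ge0 ?invr_ge0.
Qed.

(** The increments are [J k *m E k], so a uniform bound has to precede the Cauchy property. *)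
Let J_bound : exists M, forall k x, `|x| < r -> `|J k x| <= M.
Proof.
have [S SP] := summ_ee.
pose e2 k := 2 * ee k.
have J0 x : `|x| < r -> `|J 0 x| <= 1.
  move=> xr; have x1r : `|x 0 1| < r by rewrite (le_lt_trans (mx_norm_ge _ _ _)).
  rewrite /J mul1mx (_ : D 0 = 1%:M); last first.
    by apply: eq_mx2; rewrite !mxE /= ?expr0 ?invr1.
  rewrite mulmx1; apply: norm_mx2_le; rewrite /Jstraight !mxE/= ?normr1 ?normr0// normrN.
  by rewrite (le_trans (dhs x1r))// Cr// normr_ge0.
exists (expR (2 * S)) => k x xr.
rewrite (le_trans (@prod_bound R (fun k => `|J k x|) e2 _ _ _ k))//.
- by move=> i; rewrite mulr_ge0.
- move=> i; rewrite -(subrK (J i x) (J i.+1 x)) (le_trans (ler_normD _ _))// JS.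
  rewrite mulrDl mul1r addrC lerD2l (le_trans (mx_normM _ _))// /e2.
  by rewrite mulrAC ler_wpM2r// ler_wpM2l// E_le.
- rewrite -[leRHS]mul1r ler_pM ?expR_ge0 ?J0// ler_expR -mulr_sumr.
  by rewrite ler_wpM2l.
Qed.

Let J_cauchy : exists2 b, tends0 b &
  forall x k l, `|x| < r -> (k <= l)%N -> `|J l x - J k x| <= b k.
Proof.
have [M MP] := J_bound.
have M0 : 0 <= M by rewrite (le_trans _ (MP 0%N 0 _)) ?normr0.
have M20 : 0 <= 2 * M by rewrite mulr_ge0.
have [|b b0 bP] := summ_tail _ (summZ M20 summ_ee); first by move=> k; rewrite mulr_ge0.
exists b => // x k l xr kl; apply: le_trans (bP _ _ kl).
rewrite -(subnKC kl); elim: (l - k)%N => [|m IH].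
  by rewrite addn0 subrr normr0 big_geq.
rewrite addnS big_nat_recr ?leq_addr//= -(subrKA (J (k + m)%N x)).
rewrite (le_trans (ler_normD _ _))// addrC lerD// JS.
by rewrite (le_trans (mx_normM _ _))// ler_pM ?mulr_ge0// ?E_le// ler_wpM2l// MP.
Qed.

Let r00 : `|0 : 'rV[R]_2| < r. Proof. by rewrite normr0. Qed.

Let iter0 k : iter k F 0 = 0. Proof. by elim: k => //= k ->. Qed.

Let JF0 : JF 0 = diag2 l1 l2.
Proof.
apply/eqP; rewrite -subr_eq0 -normr_le0 (le_trans (JFs r00))//.
by rewrite normr0 sg00 mulr0.
Qed.

Let J_at0 k : J k 0 = 1%:M.
Proof.
have dh0 : dh 0 = 0.
  by apply/eqP; rewrite -normr_le0 (le_trans (dhs _)) ?normr0// sg00 mulr0.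
elim: k => [|k IH].
  rewrite /J mul1mx /Jstraight /= mxE dh0.
  by apply: eq_mx2; rewrite mulmx2E !mxE /=; rewrite ?expr0 ?invr1; ring.
apply/eqP; rewrite -subr_eq0 -[X in _ - X]IH JS IH mul1mx /E iter0 F0 /Is /Jstraight !mxE dh0 JF0 diag2E.
apply/eqP; have l1k : l1 ^+ k != 0 by rewrite expf_neq0.
have l2k : l2 ^+ k != 0 by rewrite expf_neq0.
apply: eq_mx2; rewrite !(mxE, sum2E) /= ?mulr0n ?mulr1n ?exprS; field; rewrite ?l10 ?l20 ?l1k ?l2k //.
Qed.

Lemma linearizable_of_coupling : locally_C1_linearizable F.
Proof.
have [b b0 bP] := J_cauchy.
have Phi0 k : Phi k 0 = 0.
  rewrite /Phi iter0 (_ : straight 0 = 0) ?mul0mx//.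
  by apply: eq_row2; rewrite !mxE ?h0 ?subrr.
have [Psi [Jl [PsiJ PsiP JlP]]] := C1_limit b0 PhiJ Phi0 bP.
have Psi0 : Psi 0 = 0.
  have := PsiP 0 0%N r00; rewrite normr0 mulr0 mul0r Phi0 sub0r normrN normr_le0.
  by move/eqP.
have Jl0 : Jl 0 = 1%:M.
  apply/eqP; rewrite -subr_eq0 -normr_le0 distrC.
  by apply: (le_tends0 b0 (N := 0%N)) => k _; rewrite -(J_at0 k) JlP.
exists Psi; split.
- by apply: (inverse_function r0 Psi0 PsiJ); rewrite Jl0 unitmx1.
- by have /has_jacP[_ ->] := (PsiJ 0 r00).1.
have -> : 'J F 0 = diag2 l1 l2 by have /has_jacP[_ ->] := (FJ r00).1.
apply/near_normP; exists r => // x; rewrite subr0 => xr.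
have Fr := (iterF 1 xr).2; rewrite /= in Fr.
have PhiS k : Phi k (F x) = Phi k.+1 x *m diag2 l1 l2.
  rewrite /Phi -iterSr -mulmxA; congr (_ *m _); rewrite diag2E.
  apply: eq_mx2; rewrite mulmx2E !mxE /= ?mulr0 ?mul0r ?addr0 ?add0r// exprS invfM;
    by rewrite mulrAC mulVf// mul1r.
apply/eqP; rewrite -subr_eq0 -normr_le0.
pose L := 2 * `|diag2 l1 l2|.
have L0 : 0 <= L by rewrite mulr_ge0.
apply: (@le_tends0 _ _ (fun k => 2 * `|F x| * b k + L * (2 * `|x|) * b k.+1) 0).
  apply: tends0D; first by apply: tends0Z => //; rewrite mulr_ge0.
  apply: tends0Z => //; first by rewrite !mulr_ge0.
  by move=> e /b0[N NP]; exists N => k Nk; rewrite NP// (leq_trans Nk).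
move=> k _.
rewrite (_ : _ - _ = - (Phi k (F x) - Psi (F x)) + (Phi k.+1 x - Psi x) *m diag2 l1 l2); last first.
  by rewrite PhiS mulmxBl opprB addrA subrK.
rewrite (le_trans (ler_normD _ _))// normrN lerD ?PsiP//.
by rewrite (le_trans (mx_normM _ _))// mulrAC -[leRHS]mulrA ler_wpM2l// PsiP.
Qed.

End Linearization.

(** * Gauges and the Dini condition *)

Section Gauge.
Variable R : realType.

(** What the estimates use of a modulus of continuity. It survives the supremum and the truncation
    in [supgauge], which concavity and strict monotonicity need not do. *)
Definition gauge (sg : R -> R) :=
  [/\ sg 0 = 0, forall t, 0 <= t -> 0 <= sg t,
      forall s t, 0 <= s -> s <= t -> sg s <= sg t &
      forall C t, 1 <= C -> 0 <= t -> sg (C * t) <= C * sg t].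

(** The scaling law is concavity between 0 and [C t], where [t] has weight [1 / C]. *)
Lemma modulus_gauge (w : R -> R) : modulus_of_continuity w -> gauge w.
Proof.
move=> [w0 wp _ wlt wc]; split=> //.
  by move=> s t s0; rewrite le_eqVlt => /orP[/eqP->//|st]; exact/ltW/wlt.
move=> C t C1 t0; have C0 : 0 < C by exact: lt_le_trans C1.
have Ct0 : 0 <= C * t by rewrite mulr_ge0// ltW.
have := wc 0 (C * t) (1 - C^-1) (lexx 0) Ct0.
rewrite w0 !mulr0 !add0r subKr mulKf ?gt_eqF// subr_ge0 invf_le1// gerBl invr_ge0.
by move=> /(_ C1 (ltW C0)); rewrite ler_pdivrMl.
Qed.

Lemma modulus_small (w : R -> R) e : modulus_of_continuity w -> 0 < e ->
  exists2 t, 0 < t & w t <= e.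
Proof.
move=> [w0 _ cw _ _] e0; have [_ w0r] := (continuous_within_itvcyP _ _).1 cw.
move/cvgrPdist_le : w0r => /(_ e e0); rewrite w0 => w0r; near (0 : R)^'+ => t.
exists t => //; apply: le_trans (ler_norm _) _; rewrite -normrN -sub0r.
by near: t.
Unshelve. all: by end_near. Qed.

(** Without weights the ratio is immaterial: if [mu^(m+1) <= q], then [m + 1] consecutive terms at
    ratio [mu] are each at most one term at ratio [q]. This is needed because orbits are only known
    to contract at a rate [mu > |l2|]. *)
Lemma summ_geometric_scale (sg : R -> R) (q mu : R) : gauge sg ->
  0 < q < 1 -> 0 < mu < 1 ->
  summ (fun k => sg (q ^+ k)) -> summ (fun k => sg (mu ^+ k)).
Proof.
move=> [_ sg0 sgle _] /andP[q0 q1] /andP[m0 m1] [S SP].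
have [|m mP] := @tends0_geometric R mu _ q q0; first by rewrite ltW.
have {}mP : mu ^+ m.+1 <= q by apply: mP.
have mk n : 0 <= mu ^+ n by rewrite exprn_ge0// ltW.
have block N : \sum_(n < N * m.+1) sg (mu ^+ n) <= m.+1%:R * \sum_(k < N) sg (q ^+ k).
  elim: N => [|N IH]; first by rewrite mul0n !big_ord0 mulr0.
  rewrite mulSn addnC big_split_ord/= [X in _ <= _ * X]big_ord_recr/= mulrDr lerD//.
  apply: (@le_trans _ _ (\sum_(i < m.+1) sg (q ^+ N))); last first.
    by rewrite sumr_const card_ord mulr_natl.
  apply: ler_sum => i _; apply: sgle => //.
  apply: (@le_trans _ _ ((mu ^+ m.+1) ^+ N)).
    rewrite exprD mulnC exprM -[leRHS]mulr1 ler_wpM2l//; first by rewrite exprn_ge0.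
    by apply: exprn_ile1; exact: ltW.
  by rewrite lerXn2r ?nnegrE// ltW.
exists (m.+1%:R * S) => n; apply: le_trans (_ : \sum_(i < n * m.+1) sg (mu ^+ i) <= _).
  rewrite mulnS big_split_ord/= lerDl sumr_ge0// => i _.
  exact: sg0.
by rewrite (le_trans (block n))// ler_wpM2l.
Qed.

(** * A majorant with a prescribed growth exponent *)

Section SupGauge.
Variables (w : R -> R) (g : R).
Hypotheses (gw : gauge w) (g0 : 0 < g).

(** The truncation bounds the supremum in [supgauge] by [w 1]. *)
Let cw t : R := w (Num.min t 1).

(* The least majorant [sg] of the truncated [w] with [sg (L t) <= L^g sg t]: it
   keeps the summability of [w] as soon as [g > alpha0], and unlike [w] it comes
   with a quantitative growth exponent. *)
Definition supgauge t := sup [set L `^ (- g) * cw (L * t) | L in [set L | 1 <= L]].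

Let min0 t : 0 <= t -> 0 <= Num.min t (1 : R).
Proof. by move=> t0; rewrite le_min t0 ler01. Qed.

Let cw0 t : 0 <= t -> 0 <= cw t.
Proof. by case: gw => _ w0 _ _ t0; rewrite /cw w0// min0. Qed.

Let cw1 t : 0 <= t -> cw t <= w 1.
Proof. by case: gw => _ _ wle _ t0; rewrite /cw wle ?min0// ge_min lexx orbT. Qed.

Let cwle s t : 0 <= s -> s <= t -> cw s <= cw t.
Proof.
case: gw => _ _ wle _ s0 st; rewrite /cw wle ?min0//.
by rewrite le_min !ge_min st lexx orbT.
Qed.

Let cwC C t : 1 <= C -> 0 <= t -> cw (C * t) <= C * cw t.
Proof.
case: gw => _ _ wle wC C1 t0; have C0 : 0 <= C by rewrite (le_trans _ C1).
rewrite /cw; apply: le_trans (wC C (Num.min t 1) C1 (min0 t0)).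
apply: wle; first by rewrite min0// mulr_ge0.
by rewrite minr_pMr// mulr1 le_min !ge_min lexx C1 orbT.
Qed.

Let powR_le01 (L : R) : 1 <= L -> 0 <= L `^ (- g) <= 1.
Proof.
move=> L1; rewrite powR_ge0/= -(powRr0 L) ler_powR// oppr_le0 ltW//.
Qed.

Let Lt0 (L t : R) : 1 <= L -> 0 <= t -> 0 <= L * t.
Proof. by move=> L1 t0; rewrite mulr_ge0// (le_trans _ L1). Qed.

Lemma supgauge_ub L t : 1 <= L -> 0 <= t -> L `^ (- g) * cw (L * t) <= supgauge t.
Proof.
move=> L1 t0; apply: ub_le_sup; last by exists L.
exists (w 1) => _ [M /= M1 <-]; have /andP[M0 M2] := powR_le01 M1.
by rewrite (le_trans _ (cw1 (Lt0 M1 t0)))// ler_piMl// cw0// Lt0.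
Qed.

Lemma supgauge_le t M : 0 <= t ->
  (forall L, 1 <= L -> L `^ (- g) * cw (L * t) <= M) -> supgauge t <= M.
Proof.
move=> t0 H; apply: ge_sup; last by move=> _ [L /= L1 <-]; exact: H.
by exists (1 `^ (- g) * cw (1 * t)); exists 1 => //=.
Qed.

Lemma supgauge_ge t : 0 <= t <= 1 -> w t <= supgauge t.
Proof.
move=> /andP[t0 t1]; have := supgauge_ub (lexx 1) t0.
by rewrite powR1 mul1r mul1r /cw min_l.
Qed.

Lemma supgauge_gauge : gauge supgauge.
Proof.
have [w0 wp wle wC] := gw.
split.
- apply/eqP; rewrite eq_le (le_trans _ (supgauge_ge (t := 0) _)) ?w0 ?lexx ?ler01// andbT.
  by apply: supgauge_le => // L L1; rewrite mulr0 /cw min_l ?ler01// w0 mulr0.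
- move=> t t0; rewrite (le_trans _ (supgauge_ub (lexx 1) t0))// mulr_ge0 ?powR_ge0//.
  by rewrite cw0// mul1r.
- move=> s t s0 st; apply: supgauge_le => // L L1.
  rewrite (le_trans _ (supgauge_ub L1 (le_trans s0 st)))// ler_wpM2l ?powR_ge0//.
  by rewrite cwle ?Lt0// ler_wpM2l// (le_trans _ L1).
- move=> C t C1 t0; apply: supgauge_le => [|L L1]; first exact: Lt0.
  have C0 : 0 <= C by rewrite (le_trans _ C1).
  apply: (@le_trans _ _ (C * (L `^ (- g) * cw (L * t)))); last by rewrite ler_wpM2l// supgauge_ub.
  by rewrite [leRHS]mulrCA ler_wpM2l ?powR_ge0// [L * _]mulrCA cwC// Lt0.
Qed.

Lemma supgauge_scale nu t : 1 <= nu -> 0 <= t -> supgauge (nu * t) <= nu `^ g * supgauge t.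
Proof.
move=> n1 t0; apply: supgauge_le => [|L L1]; first exact: Lt0.
have n0 : 0 < nu by exact: lt_le_trans n1.
have L0 : 0 < L by exact: lt_le_trans L1.
apply: (@le_trans _ _ (nu `^ g * ((L * nu) `^ (- g) * cw ((L * nu) * t)))); last first.
  by rewrite ler_wpM2l ?powR_ge0// supgauge_ub// -[leLHS]mulr1 ler_pM.
have nn : nu `^ g * nu `^ (- g) = 1 by rewrite powRN divff// gt_eqF// powR_gt0.
rewrite powRM ?(ltW L0) ?(ltW n0)// (_ : nu `^ g * _ = (nu `^ g * nu `^ (- g)) * (L `^ (- g) * cw (L * nu * t))).
  by rewrite nn mul1r mulrA.
by ring.
Qed.

(** This allows bounded Lipschitz terms, such as those of the cutoff, to be absorbed in the
    gauge. *)
Lemma supgauge_linear t : 0 <= t -> w 1 * Num.min t 1 <= supgauge t.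
Proof.
move=> t0; have [w0 wp wle wC] := gw; have := supgauge_ub (lexx 1) t0.
rewrite powR1 mul1r mul1r; apply: le_trans; rewrite /cw.
have [->|tn0] := eqVneq (Num.min t 1) 0; first by rewrite mulr0 w0.
have m0 : 0 < Num.min t 1 by rewrite lt_neqAle eq_sym tn0 min0.
have := wC (Num.min t 1)^-1 (Num.min t 1) _ (ltW m0).
rewrite mulVf// invf_ge1// ge_min lexx orbT => /(_ isT).
by rewrite mulrC ler_pdivlMr.
Qed.

Lemma supgauge_summ (q th : R) : 0 < q < 1 -> 1 <= th -> th * q `^ g < 1 ->
  summ (fun k => th ^+ k * w (q ^+ k)) -> summ (fun k => th ^+ k * supgauge (q ^+ k)).
Proof.
move=> /andP[q0 q1] th1 thq [S SP]; have [w0 wp wle wC] := gw.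
have th0 : 0 < th by exact: lt_le_trans th1.
(* [T k = w(q^k) + q^g w(q^(k-1)) + ... + q^(g k) w 1] discretizes the supremum over [L] along
   powers of [1 / q]. *)
pose T := fix T k := if k is k'.+1 then w (q ^+ k) + q `^ g * T k' else w 1.
have qk k : 0 <= q ^+ k by rewrite exprn_ge0// ltW.
have qi1 : 1 <= q^-1 by rewrite invf_ge1// ltW.
have qi0 : 0 <= q^-1 by rewrite invr_ge0 ltW.
have T0 k : 0 <= T k.
  elim: k => [|k IH]; first exact: wp.
  by rewrite /= addr_ge0 ?wp ?mulr_ge0 ?powR_ge0.
have TP k L : 1 <= L -> L `^ (- g) * cw (L * q ^+ k) <= q^-1 * T k.
  elim: k L => [|k IH] L L1.
    have /andP[a0 a1] := powR_le01 L1.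
    have L0 : 0 <= L by rewrite (le_trans _ L1).
    rewrite expr0 mulr1; apply: (@le_trans _ _ (1 * w 1)).
      exact: (ler_pM a0 (cw0 L0) a1 (cw1 L0)).
    by rewrite ler_wpM2r// wp.
  have L0 : 0 < L by exact: lt_le_trans L1.
  (* For [L <= 1 / q] the scaling law of [w] suffices; a larger [L] is replaced by [L q], which
     trades [q^(k+1)] for [q^k] at the price [q^g]. *)
  have [Lq|Lq] := leP L q^-1.
    have /andP[a0 a1] := powR_le01 L1.
    apply: (@le_trans _ _ (1 * (q^-1 * w (q ^+ k.+1)))).
      apply: ler_pM => //; first by rewrite cw0// Lt0.
      rewrite /cw; apply: le_trans (wC _ _ qi1 (qk k.+1)); apply: wle; first by rewrite min0// Lt0.
      by rewrite ge_min ler_wpM2r.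
    by rewrite mul1r ler_wpM2l//= lerDl mulr_ge0// powR_ge0.
  have Lq1 : 1 <= L * q by rewrite -ler_pdivrMr// mul1r ltW.
  have := IH _ Lq1; rewrite -mulrA -exprS powRM ?(ltW L0) ?(ltW q0)// => H.
  apply: (@le_trans _ _ (q^-1 * (q `^ g * T k))); last by rewrite ler_wpM2l//= lerDr wp.
  rewrite mulrCA -ler_pdivrMl ?powR_gt0//; apply: le_trans H.
  by rewrite -powRN mulrA [q `^ _ * _]mulrC.
apply: (@summ_le _ _ (fun k => q^-1 * (th ^+ k * T k))).
  move=> k; rewrite mulrCA ler_wpM2l ?exprn_ge0 ?(ltW th0)//.
  by apply: supgauge_le => // L; exact: TP.
(* With the weights [th^k], [T] is a convolution with a geometric sequence of ratio [rho < 1], so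
   its sum is at most [S / (1 - rho)]. *)
apply: summZ => //; pose rho := th * q `^ g.
have r1 : 0 < 1 - rho by rewrite subr_gt0.
exists (S / (1 - rho)) => n.
suff [] : \sum_(k < n) th ^+ k * T k <= S / (1 - rho) /\
    \sum_(k < n.+1) th ^+ k * T k <=
    \sum_(k < n.+1) th ^+ k * w (q ^+ k) + rho * \sum_(k < n) th ^+ k * T k by [].
have step m : \sum_(k < m.+1) th ^+ k * T k =
    \sum_(k < m.+1) th ^+ k * w (q ^+ k) + rho * \sum_(k < m) th ^+ k * T k.
  rewrite !big_ord_recl/= !expr0 -addrA; congr (_ + _).
  rewrite mulr_sumr -big_split/=; apply: eq_bigr => i _.
  by rewrite /bump/= !add1n mulrDr; congr (_ + _); rewrite exprS /rho; ring.
split; last by rewrite step.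
have S0 : 0 <= S by have := SP 0%N; rewrite big_ord0.
have rho0 : 0 <= rho by rewrite mulr_ge0 ?powR_ge0// ltW.
elim: n => [|n IH]; first by rewrite big_ord0 divr_ge0// ltW.
rewrite step (le_trans (lerD (SP _) (ler_wpM2l rho0 IH)))//.
by rewrite le_eqVlt; apply/orP; left; apply/eqP; field; rewrite gt_eqF.
Qed.

End SupGauge.
End Gauge.

(** * Comparison of the Dini integral with a weighted geometric sum *)

Section Dini.
Variables (R : realType) (w : R -> R) (q a th : R).
Hypotheses (hw : modulus_of_continuity w) (q01 : 0 < q < 1) (th0 : 0 < th)
  (qa : q `^ a = th^-1) (a0 : 0 <= a).

Let mu := (@lebesgue_measure R).
Let f (t : R) : R := w t / t `^ (a + 1).
Let q0 : 0 < q. Proof. by case/andP: q01. Qed.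
Let q1 : q < 1. Proof. by case/andP: q01. Qed.
Let qn n : 0 < q ^+ n. Proof. exact: exprn_gt0. Qed.
Let qn1 n : q ^+ n <= 1. Proof. by rewrite exprn_ile1// ltW. Qed.
Let gw : gauge w. Proof. exact: modulus_gauge. Qed.

Let mf : measurable_fun (`]0%R, 1%R] : set R) f.
Proof.
apply: measurable_funM.
  have [_ _ cw _ _] := hw.
  have mw : measurable_fun (`[0%R, +oo[ : set R) w by exact: subspace_continuous_measurable_fun.
  apply: measurable_funS mw => //.
  by move=> t /=; rewrite !in_itv/= andbT => /andP[/ltW].
rewrite (_ : (fun _ => _) = (@powR R ^~ (- (a + 1)))); last first.
  by apply/funext => t; rewrite powRN.
apply: measurable_funTS; exact: measurable_powR.
Qed.

Let f0 t : 0 <= t -> 0 <= f t.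
Proof. by case: gw => _ w0 _ _ t0; rewrite divr_ge0 ?powR_ge0 ?w0. Qed.

Let powq n : (q ^+ n) `^ (a + 1) = q ^+ n / th ^+ n.
Proof.
rewrite powRD; last by rewrite (gt_eqF (qn n)) implybT.
rewrite powRr1 ?(ltW (qn n))// mulrC; congr (_ * _).
rewrite -powR_mulrn ?ltW// -powRrM mulrC powRrM qa powR_mulrn ?invr_ge0 ?ltW//.
by rewrite exprVn.
Qed.

Let piece n : set R := `]q ^+ n.+1, q ^+ n].

Let mpiece n : measurable (piece n). Proof. exact: measurable_itv. Qed.

Let piece_sub n : piece n `<=` `]0%R, 1%R].
Proof.
move=> t; rewrite /piece/= !in_itv/= => /andP[t1 t2].
by rewrite (lt_trans (qn n.+1) t1) (le_trans t2 (qn1 n)).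
Qed.

Let mu_piece n : mu (piece n) = (q ^+ n * (1 - q))%:E.
Proof.
rewrite /mu /piece lebesgue_measure_itv/= lte_fin exprS gtr_pMl// q1.
by rewrite -EFinB; congr EFin; ring.
Qed.

(** [w] increases and [t^-(a+1)] decreases, with value [th^n / q^n] at [q^n] because [q^a = 1 / th].
    Times the length [q^n (1 - q)] this compares the integral over the piece with [th^n w(q^n)], up
    to a shift of the index in the lower bound. *)
Let fpiece n t : piece n t ->
  w (q ^+ n.+1) * (th ^+ n / q ^+ n) <= f t <= w (q ^+ n) * (th ^+ n.+1 / q ^+ n.+1).
Proof.
have [_ w0 wle _] := gw.
rewrite /piece/= in_itv/= => /andP[t1 t2].
have t0 : 0 < t by exact: lt_trans t1.
have a1 : 0 <= a + 1 by rewrite addr_ge0.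
have inv k : th ^+ k / q ^+ k = ((q ^+ k) `^ (a + 1))^-1 by rewrite powq invf_div.
rewrite !inv /f; apply/andP; split; rewrite ler_pM ?w0 ?invr_ge0 ?powR_ge0 ?wle ?(ltW t0) ?(ltW (qn _)) ?(ltW t1)//.
  by rewrite lef_pV2 ?posrE ?powR_gt0// ge0_ler_powR// ?nnegrE ltW.
by rewrite lef_pV2 ?posrE ?powR_gt0// ge0_ler_powR// ?nnegrE ltW.
Qed.

Lemma summ_of_dini : (dini_integral w a < +oo)%E ->
  summ (fun k => th ^+ k * w (q ^+ k)).
Proof.
move=> Dfin; have [_ w0 wle _] := gw.
pose K n : set R := [set` `](q ^+ n)%R, 1%R]].
pose I n := (\int[mu]_(t in K n) (f t)%:E)%E.
have mK n : measurable (K n) by exact: measurable_itv.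
have sub1 n : K n `<=` `]0%R, 1%R].
  by move=> t; rewrite /K/= !in_itv/= => /andP[t1 ->]; rewrite (lt_trans (qn n) t1).
have ID n : (I n <= dini_integral w a)%E.
  apply: ge0_subset_integral => //.
  - exact: mK.
  - exact/measurable_EFinP.
  by move=> t /=; rewrite in_itv/= => /andP[t0 _]; rewrite lee_fin f0// ltW.
(* The lower bound on piece [n] involves [w(q^(n+1))] with weight [th^n]; the missing factor [th]
   goes into [c], and the term of index 0 is added separately at the end. *)
pose c := (1 - q) / th.
have c0 : 0 < c by rewrite divr_gt0// subr_gt0.
have IS n : (I n + (c * (th ^+ n.+1 * w (q ^+ n.+1)))%:E <= I n.+1)%E.
  have E : K n.+1 = K n `|` piece n :> set R.
    apply/seteqP; split=> t; rewrite /K /piece/= !in_itv/=.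
      move=> /andP[t1 t2]; rewrite t1 t2 andbT /=.
      by have [H|H] := leP t (q ^+ n); [right|left].
    move=> [/andP[t1 t2]|/andP[t1 t2]].
      by rewrite t2 andbT (le_lt_trans _ t1)// exprS ger_pMl// ltW.
    by rewrite t1 (le_trans t2).
  rewrite [in leRHS]/I E ge0_integral_setU; first last.
  - apply/disj_setPS => t [] /=; rewrite /K /piece/= !in_itv/= => /andP[t1 _] /andP[_ t2].
    by move: (lt_le_trans t1 t2); rewrite ltxx.
  - move=> t [/sub1|/piece_sub] /=; rewrite in_itv/= => /andP[t0 _]; by rewrite lee_fin f0// ltW.
  - apply/measurable_EFinP; apply: measurable_funS mf => // t [/sub1|/piece_sub]//.
  - exact: mpiece.
  - exact: mK.
  rewrite leeD2l//.
  apply: (@le_trans _ _ (\int[mu]_(t in piece n) (w (q ^+ n.+1) * (th ^+ n / q ^+ n))%:E)%E).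
    rewrite integral_cst; last exact: mpiece.
    rewrite [X in (_ * X)%E](mu_piece n) -EFinM lee_fin le_eqVlt; apply/orP; left; apply/eqP.
    by rewrite /c exprS; field; rewrite !gt_eqF// exprn_gt0.
  apply: ge0_le_integral.
  - exact: mpiece.
  - by move=> t _; rewrite lee_fin mulr_ge0 ?w0 ?divr_ge0 ?exprn_ge0// ltW.
  - exact: measurable_cst.
  - by apply/measurable_EFinP; apply: measurable_funS mf => //; exact: piece_sub.
  - by move=> t /fpiece/andP[H _]; rewrite lee_fin.
have IP n : (((\sum_(1 <= k < n.+1) c * (th ^+ k * w (q ^+ k)))%:E) <= I n)%E.
  elim: n => [|n IH].
    rewrite big_geq//; apply: integral_ge0 => t /sub1 /=; rewrite in_itv/= => /andP[t0 _].
    by rewrite lee_fin f0// ltW.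
  rewrite big_nat_recr//= EFinD (le_trans _ (IS n))// leeD2r//.
have Dge : dini_integral w a \is a fin_num.
  by rewrite ge0_fin_numE// (le_trans _ (ID 0%N))// (le_trans _ (IP 0%N))// big_geq.
exists (w 1 + c^-1 * fine (dini_integral w a)) => n.
apply: (@le_trans _ _ (\sum_(0 <= k < n.+1) th ^+ k * w (q ^+ k))).
  rewrite big_nat_recr//= big_mkord lerDl mulr_ge0 ?w0 ?exprn_ge0 ?ltW//.
rewrite big_ltn// !expr0 mul1r lerD2l ler_pdivlMl// mulr_sumr.
by rewrite -lee_fin fineK// (le_trans (IP n)).
Qed.

Lemma dini_of_summ : summ (fun k => th ^+ k * w (q ^+ k)) ->
  (dini_integral w a < +oo)%E.
Proof.
move=> [S SP]; have [_ w0 wle _] := gw.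
have E : [set` `]0%R, 1%R]] = \bigcup_n piece n :> set R.
  apply/seteqP; split=> [t /=|t [n _ /piece_sub]//].
  rewrite in_itv/= => /andP[t0 t1].
  have [N NP] : exists n, q ^+ n.+1 < t.
    have [| |N NP] := @tends0_geometric R q _ (t / 2); [by rewrite ltW|by rewrite divr_gt0|].
    exists N; rewrite (le_lt_trans (NP N.+1 _))//.
    by rewrite ltr_pdivrMr// ltr_pMr// ltrDl.
  have exN : exists n, q ^+ n.+1 < t by exists N.
  case: (ex_minnP exN) => m mt mmin; exists m => //; rewrite /piece /= in_itv/= mt /=.
  case: m mt mmin => [|m] mt mmin; first by rewrite expr0.
  by rewrite leNgt; apply/negP => /mmin; rewrite ltnn.
rewrite /dini_integral E ge0_integral_bigcup; first last.
- apply/trivIsetP => i j _ _; wlog: i j / (i < j)%N.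
    move=> H ij; have [/H/(_ ij)//|ji|e] := ltngtP i j; last by rewrite e eqxx in ij.
    by rewrite setIC; apply: H => //; rewrite eq_sym.
  move=> ij _; apply/seteqP; split=> // t [] /=; rewrite /piece/= !in_itv/= => /andP[t1 _] /andP[_ t2].
  have := lt_le_trans t1 t2; rewrite ltNge ler_wiXn2l// ?ltW//.
- by move=> t [n _ /piece_sub]/=; rewrite in_itv/= => /andP[t0 _]; rewrite lee_fin f0// ltW.
- by rewrite -E; exact/measurable_EFinP.
- exact: mpiece.
pose c := th * (1 - q) / q.
have c0 : 0 < c by rewrite divr_gt0// mulr_gt0// subr_gt0.
have H n : (\int[mu]_(t in piece n) (f t)%:E <= (c * (th ^+ n * w (q ^+ n)))%:E)%E.
  apply: (@le_trans _ _ (\int[mu]_(t in piece n) (w (q ^+ n) * (th ^+ n.+1 / q ^+ n.+1))%:E)%E).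
    apply: ge0_le_integral.
    - exact: mpiece.
    - by move=> t /piece_sub/=; rewrite in_itv/= => /andP[t0 _]; rewrite lee_fin f0// ltW.
    - by apply/measurable_EFinP; apply: measurable_funS mf => //; exact: piece_sub.
    - exact: measurable_cst.
    - by move=> t /fpiece/andP[_ H]; rewrite lee_fin.
  rewrite integral_cst; last exact: mpiece.
  rewrite [X in (_ * X)%E](mu_piece n) -EFinM lee_fin le_eqVlt; apply/orP; left; apply/eqP.
  by rewrite /c !exprS; field; rewrite !gt_eqF// exprn_gt0.
apply: (@le_lt_trans _ _ (c * S)%:E); last exact: ltry.
apply: lime_le.
  apply: is_cvg_nneseries => n _ _; apply: integral_ge0 => t /piece_sub/=.
  by rewrite in_itv/= => /andP[t0 _]; rewrite lee_fin f0// ltW.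
apply: nearW => n.
apply: (@le_trans _ _ (\sum_(0 <= i < n) (c * (th ^+ i * w (q ^+ i)))%:E)%E).
  by apply: lee_sum => i _; exact: H.
by rewrite sumEFin lee_fin -mulr_sumr ler_wpM2l ?(ltW c0)// big_mkord.
Qed.

End Dini.

(** * The graph transform *)

Section CurveTools.
Variable R : realType.

(** For the slopes of the curves, whose Cauchy property comes without an explicit rate. *)
Lemma cauchy_lim (u : nat -> R) :
  (forall e, 0 < e -> exists N, forall n m, (N <= n)%N -> (N <= m)%N -> `|u m - u n| <= e) ->
  exists l, tends0 (fun n => `|u n - l|).
Proof.
move=> uc.
have /cauchy_cvgP/cvg_ex[/= l ul] : cauchy (u @ \oo).
  apply: cauchy_exP => e e0; have [|N NP] := uc (e / 2); first by rewrite divr_gt0.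
  exists (u N); exists N => // n /= Nn.
  rewrite /ball/= distrC (le_lt_trans (NP _ _ _ _))//.
  by rewrite ltr_pdivrMr// ltr_pMr// ltrDl.
exists l => e e0; move/cvgrPdist_le : ul => /(_ e e0)[N _ NP]; exists N => m Nm.
by rewrite distrC; exact: NP.
Qed.

Lemma MVT_bound (f df : R -> R) (s t M c : R) :
  (forall x, Num.min s t <= x <= Num.max s t -> is_derive x 1 f (df x)) ->
  (forall x, Num.min s t <= x <= Num.max s t -> `|df x - c| <= M) ->
  `|f t - f s - (t - s) * c| <= M * `|t - s|.
Proof.
wlog st : s t / s <= t => [H|].
  case/orP: (le_total s t) => [st|ts]; first exact: H.
  move=> Df Mf.
  rewrite -normrN [X in _ <= _ * X]distrC.
  rewrite (_ : - (f t - f s - (t - s) * c) = f s - f t - (s - t) * c); last by ring.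
  by apply: (H t s ts) => x; rewrite minC maxC => Hx; [exact: Df|exact: Mf].
rewrite min_l// max_r// => Df Mf.
have [x| |d /=] := @MVT_segment R f df s t st.
- by rewrite in_itv/= => /andP[sx xt]; apply: Df; rewrite !ltW.
- apply: derivable_within_continuous => y; rewrite in_itv/= => yst.
  by have [] := Df y yst.
rewrite in_itv/= => dst ->; rewrite [(t - s) * c]mulrC -mulrBl normrM.
by rewrite ler_wpM2r// Mf.
Qed.

Lemma MVT_lip (f df : R -> R) (M : R) : (forall x : R, is_derive x 1 f (df x)) ->
  (forall x, `|df x| <= M) -> forall s t, `|f t - f s| <= M * `|t - s|.
Proof.
move=> Df Mf s t; have := @MVT_bound f df s t M 0 (fun x _ => Df x).
by rewrite mulr0 subr0; apply => x _; rewrite subr0.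
Qed.

Lemma is_derive_curve m (F : 'rV[R]_2 -> 'rV[R]_m) (A : 'M[R]_(2, m)) (a b : R -> R)
    (s a' b' : R) (j : 'I_m) :
  is_derive s 1 a a' -> is_derive s 1 b b' -> has_jac F (row2 (a s) (b s)) A ->
  is_derive s 1 (fun t : R => F (row2 (a t) (b t)) 0 j) ((row2 a' b' *m A) 0 j).
Proof.
move=> /is_derive_normP Da /is_derive_normP Db FA.
(* The curve is viewed as a map on row vectors of length 1, so that [has_jac_comp] applies. *)
pose c (x : 'rV[R]_1) := row2 (a (x 0 0)) (b (x 0 0)).
pose s1 : 'rV[R]_1 := const_mx s.
have c1 : has_jac c s1 (row2 a' b').
  move=> e e0; have [d d0 dP] := Da e e0; have [d' d'0 d'P] := Db e e0.
  exists (Num.min d d') => [|y]; first by rewrite lt_min d0.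
  rewrite lt_min => /andP[yd yd'].
  have ys : `|y 0 0 - s| <= `|y - s1| by have := mx_norm_ge (y - s1) 0 0; rewrite !mxE.
  have H := dP _ (le_lt_trans ys yd); have H' := d'P _ (le_lt_trans ys yd').
  have eys : e * `|y 0 0 - s| <= e * `|y - s1| by rewrite ler_wpM2l// ltW.
  have E : (y - s1) *m row2 a' b' = row2 ((y 0 0 - s) * a') ((y 0 0 - s) * b').
    by apply: eq_row2; rewrite !mxE big_ord1 !mxE.
  by apply: norm_row2_le; rewrite E !mxE/=; exact: le_trans eys.
have cs1 : c s1 = row2 (a s) (b s) by rewrite /c /s1 mxE.
have Fc : has_jac (F \o c) s1 (row2 a' b' *m A) by apply: has_jac_comp c1 _; rewrite cs1.
apply/is_derive_normP => e e0; have [d d0 dP] := Fc e e0.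
exists d => // t ts; pose t1 : 'rV[R]_1 := const_mx t.
have ts1 : `|t1 - s1| = `|t - s|.
  apply/eqP; rewrite eq_le; apply/andP; split.
    by apply: mx_norm_le => // i k; rewrite !mxE.
  by have := mx_norm_ge (t1 - s1) 0 0; rewrite !mxE.
have := dP t1; rewrite ts1 => /(_ ts)/(le_trans (mx_norm_ge _ 0 j)).
rewrite /= /c /t1 /s1 !mxE big_ord1 !mxE.
exact.
Qed.

Let m0 (t : R) := Num.max 0 t.

Let m0_lip s t : `|m0 t - m0 s| <= `|t - s|.
Proof.
rewrite /m0; case: (leP 0 t) => ht; case: (leP 0 s) => hs; rewrite ?subrr ?normr0//.
- by rewrite subr0 ger0_norm// ger0_norm; lra.
- rewrite sub0r normrN ger0_norm// ler0_norm; lra.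
Qed.

Let m0_sqr s t : `|m0 t ^+ 2 - m0 s ^+ 2 - (t - s) * (2 * m0 s)| <= `|t - s| ^+ 2.
Proof.
rewrite /m0 real_normK ?num_real//; case: (leP 0 t) => ht; case: (leP 0 s) => hs.
- rewrite (_ : _ - _ = (t - s) ^+ 2); last by ring.
  by rewrite ger0_norm ?sqr_ge0.
- have h := mulr_ge0_le0 ht (ltW hs); have := sqr_ge0 s; have := sqr_ge0 t.
  by rewrite ler_norml !expr2 => *; apply/andP; split; lra.
- have h := mulr_ge0_le0 hs (ltW ht); have := sqr_ge0 s; have := sqr_ge0 t.
  by rewrite ler_norml !expr2 => *; apply/andP; split; lra.
- have := sqr_ge0 (t - s).
  by rewrite ler_norml !expr2 => *; apply/andP; split; lra.
Qed.

Lemma is_derive_posqr (z : R) :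
  is_derive z 1 (fun t => Num.max 0 t ^+ 2) (2 * Num.max 0 z).
Proof.
apply/is_derive_normP => e e0; exists e => // t tz.
by rewrite (le_trans (m0_sqr _ _))// expr2 ler_wpM2r// ltW.
Qed.

(** The odd primitive of the trapezoid [dtau1], which is 1 on [-1, 1], vanishes outside [-2, 2] and
    is affine in between. *)
Let tau1 t : R := t - 2^-1 * (m0 (t - 1) ^+ 2 - m0 (t - 2) ^+ 2)
  + 2^-1 * (m0 (- t - 1) ^+ 2 - m0 (- t - 2) ^+ 2).
Let dtau1 t : R := 1 - (m0 (t - 1) - m0 (t - 2)) - (m0 (- t - 1) - m0 (- t - 2)).

Let tau1_rem s t : `|tau1 t - tau1 s - (t - s) * dtau1 s| <= 2 * `|t - s| ^+ 2.
Proof.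
have Ht (c : R) : `|m0 (t - c) ^+ 2 - m0 (s - c) ^+ 2 - (t - s) * (2 * m0 (s - c))| <= `|t - s| ^+ 2.
  have := m0_sqr (s - c) (t - c); rewrite (_ : t - c - (s - c) = t - s)//; ring.
have Hm (c : R) : `|m0 (- t - c) ^+ 2 - m0 (- s - c) ^+ 2 - (s - t) * (2 * m0 (- s - c))| <= `|t - s| ^+ 2.
  have := m0_sqr (- s - c) (- t - c).
  by rewrite (_ : - t - c - (- s - c) = s - t) ?[`|s - t|]distrC//; ring.
have := Ht 1; have := Ht 2; have := Hm 1; have := Hm 2.
rewrite /tau1 /dtau1 !ler_norml; move: (m0 _ ^+ 2) (m0 _ ^+ 2) (m0 _ ^+ 2) (m0 _ ^+ 2)
  (m0 _ ^+ 2) (m0 _ ^+ 2) (m0 _ ^+ 2) (m0 _ ^+ 2) (`|_| ^+ 2) => *.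
by apply/andP; split; lra.
Qed.

(** A clipping of the coordinates, to be composed with the nonlinearity. Multiplying by a bump would
    add a product-rule term; here [dtau <= 1] leaves the derivative bound of the nonlinearity
    intact. *)
Lemma cutoff (d : R) : 0 < d -> exists tau dtau : R -> R,
  [/\ forall t : R, is_derive t 1 tau (dtau t),
      forall t, 0 <= dtau t <= 1,
      forall t, `|tau t| <= 2 * d,
      forall t, `|t| <= d -> tau t = t /\ dtau t = 1 &
      forall s t, `|dtau t - dtau s| <= 4 / d * `|t - s|].
Proof.
move=> d0; exists (fun t => d * tau1 (t / d)), (fun t => dtau1 (t / d)).
have dn0 : d != 0 by rewrite gt_eqF.
split.
- move=> s; apply/is_derive_normP => e e0; exists (e * d / 2); first by rewrite divr_gt0// mulr_gt0.
  move=> t ts; have := tau1_rem (s / d) (t / d).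
  rewrite (_ : t / d - s / d = (t - s) / d); last by ring.
  have -> : d * tau1 (t / d) - d * tau1 (s / d) - (t - s) * dtau1 (s / d) =
      d * (tau1 (t / d) - tau1 (s / d) - (t - s) / d * dtau1 (s / d)) by field.
  move=> /(ler_wpM2l (ltW d0)) H; rewrite normrM (gtr0_norm d0); apply: (le_trans H).
  rewrite normrM normfV (gtr0_norm d0).
  rewrite (_ : d * _ = `|t - s| * (2 * `|t - s| / d)); last by field.
  by rewrite mulrC ler_wpM2r// ler_pdivrMr// mulrC -ler_pdivlMr// ltW.
- move=> t; move: (t / d) => x; rewrite /dtau1 /m0.
  case: (leP 0 (x - 1)); case: (leP 0 (x - 2)); case: (leP 0 (- x - 1)); case: (leP 0 (- x - 2)) => *;
    apply/andP; split; lra.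
- move=> t; rewrite normrM (gtr0_norm d0) mulrC ler_wpM2r ?(ltW d0)//.
  move: (t / d) => x; rewrite /tau1 /m0 ler_norml.
  case: (leP 0 (x - 1)); case: (leP 0 (x - 2)); case: (leP 0 (- x - 1)); case: (leP 0 (- x - 2)) => *;
    apply/andP; split; first [lra | nra].
- move=> t td; have [x1 x2] : t / d <= 1 /\ - (t / d) <= 1.
    by move: td; rewrite ler_norml => /andP[? ?]; rewrite -mulNr !ler_pdivrMr// !mul1r; split; lra.
  have E : m0 (t / d - 1) = 0 /\ m0 (t / d - 2) = 0 by rewrite /m0; split; apply: max_l; lra.
  have E' : m0 (- (t / d) - 1) = 0 /\ m0 (- (t / d) - 2) = 0 by rewrite /m0; split; apply: max_l; lra.
  rewrite /tau1 /dtau1 !E.1 !E.2 !E'.1 !E'.2; split; last by ring.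
  by field.
- move=> s t; have H (a : R) : `|m0 (t / d - a) - m0 (s / d - a)| <= `|t - s| / d.
    rewrite (le_trans (m0_lip _ _))// (_ : _ - _ = (t - s) / d); last by ring.
    by rewrite normrM normfV (gtr0_norm d0).
  have H' (a : R) : `|m0 (- (t / d) - a) - m0 (- (s / d) - a)| <= `|t - s| / d.
    rewrite (le_trans (m0_lip _ _))// (_ : - (t / d) - a - (- (s / d) - a) = (s - t) / d); last by ring.
    by rewrite normrM normfV (gtr0_norm d0) distrC.
  have := H 1; have := H 2; have := H' 1; have := H' 2; rewrite /dtau1 !ler_norml.
  have -> : 4 / d * `|t - s| = 4 * (`|t - s| / d) by ring.
  by move=> *; apply/andP; split; lra.
Qed.

End CurveTools.

(** * Fixed point of the graph transform *)

Section GraphTransform.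
Variables (R : realType) (l1 l2 : R).
Hypotheses (hl1 : 0 < `|l1|) (hl2 : 0 < `|l2|).
Variables (G : 'rV[R]_2 -> 'rV[R]_2) (JG : 'rV[R]_2 -> 'M[R]_2) (r C : R).
Hypotheses (r0 : 0 < r) (G0 : G 0 = 0) (GJ : C1_ball G JG r)
  (JG0 : JG 0 = mx2 l1^-1 0 0 l2^-1) (C0 : 0 <= C).
Variables (sg : R -> R) (c0 : R).
Hypotheses (sgg : gauge sg) (sgs : forall e, 0 < e -> exists2 t, 0 < t & sg t <= e)
  (c00 : 0 < c0) (sgc : forall t, 0 <= t -> c0 * Num.min t 1 <= sg t).
Hypothesis JGs : forall x y, `|x| < r -> `|y| < r -> `|JG x - JG y| <= C * sg `|x - y|.

(* The cutoff half-width [d], the bound [eps] on the cut-off nonlinearity, the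
   expansion bound [nu], and the amplification factor [k] of the modulus. *)
Variables (d eps nu k eta : R).
Hypotheses (d0 : 0 < d) (dr : 2 * d < r) (eps0 : 0 <= eps) (epsC : C * sg r <= eps)
  (nu1 : 1 <= nu) (nul : `|l2|^-1 + 2 * eps <= nu) (k1 : nu <= k)
  (sgnu : forall t, 0 <= t -> nu * sg (nu * t) <= k * sg t)
  (eta0 : 0 < eta) (kq : `|l1| * (k + 4 * eps) <= 1 - eta).

Let sg0 : sg 0 = 0. Proof. by case: sgg. Qed.
Let sgp t : 0 <= t -> 0 <= sg t. Proof. by case: sgg => _ H _ _; exact: H. Qed.
Let sgle s t : 0 <= s -> s <= t -> sg s <= sg t. Proof. by case: sgg => _ _ H _; exact: H. Qed.

Let l10 : l1 != 0. Proof. by rewrite -normr_gt0. Qed.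
Let l20 : l2 != 0. Proof. by rewrite -normr_gt0. Qed.

Variables (tau dtau : R -> R).
Hypotheses (Dtau : forall t : R, is_derive t 1 tau (dtau t))
  (dtau01 : forall t, 0 <= dtau t <= 1)
  (tau_le : forall t, `|tau t| <= 2 * d)
  (tau_id : forall t, `|t| <= d -> tau t = t /\ dtau t = 1)
  (dtau_lip : forall s t, `|dtau t - dtau s| <= 4 / d * `|t - s|).

Let dtau1 t : `|dtau t| <= 1.
Proof. by have /andP[a b] := dtau01 t; rewrite ger0_norm. Qed.

Let tau_lip s t : `|tau t - tau s| <= `|t - s|.
Proof. by rewrite -[leRHS]mul1r; apply: MVT_lip Dtau dtau1 _ _. Qed.

Let L := (1 + 4 / d) / c0.
Let L0 : 0 <= L. Proof. by rewrite divr_ge0 ?addr_ge0 ?divr_ge0 ?ltW. Qed.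

(** [dtau] oscillates by at most 1 and is Lipschitz, so its variation is a multiple of [min u 1],
    which [sg] dominates. *)
Let dtau_sg s t u : `|s - t| <= u -> `|dtau s - dtau t| <= L * sg u.
Proof.
move=> stu; have u0 : 0 <= u by rewrite (le_trans _ stu).
apply: (@le_trans _ _ ((1 + 4 / d) * Num.min u 1)); last first.
  by rewrite /L -mulrA ler_wpM2l ?addr_ge0 ?divr_ge0 ?(ltW d0)// ler_pdivlMl// sgc.
have d4 : 0 <= 4 / d by rewrite divr_ge0 ?(ltW d0).
have H := dtau_lip t s.
have H2 : `|dtau s - dtau t| <= 1.
  have /andP[? ?] := dtau01 s; have /andP[? ?] := dtau01 t.
  by rewrite ler_norml; apply/andP; split; lra.
have H3 : `|dtau s - dtau t| <= 4 / d * u by rewrite (le_trans H)// ler_wpM2l.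
by have [u1|u1] := leP u 1; nra.
Qed.

Let D := 2 * eps * L + 2 * C.
Let D0 : 0 <= D. Proof. by apply: addr_ge0; apply: mulr_ge0 => //; exact: mulr_ge0. Qed.
(** The solution of [K (1 - eta) + 2 |l1| D = K], which makes [curve_class] stable under the
    transform. *)
Let K := 2 * `|l1| * D / eta.
Let K0 : 0 <= K. Proof. by apply: divr_ge0; [apply: mulr_ge0 => //; exact: mulr_ge0|exact: ltW]. Qed.

(** The common modulus of the slopes is what upgrades uniform convergence of the curves to
    convergence of their slopes. *)
Definition curve_class (h h' : R -> R) :=
  [/\ forall s : R, is_derive s 1 h (h' s), forall s, `|h' s| <= 1,
      forall s t, `|h' s - h' t| <= K * sg `|s - t|, h 0 = 0 & h' 0 = 0].

Let pt (h : R -> R) s := row2 (tau (h s)) (tau s).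
Let dpt (h h' : R -> R) s := row2 (dtau (h s) * h' s) (dtau s).
Let g j x := (G x - x *m JG 0) 0 j.
(** With its nonlinearity cut off, [G] sends the point of the curve over [s] to
    [(h s / l1 + g 0 (pt h s), u h s)]. Requiring the image to lie on the curve and solving for
    [h s] gives [graph_tr]. *)
Let u h s := s / l2 + g 1 (pt h s).
Let du h h' s := l2^-1 + (dpt h h' s *m (JG (pt h s) - JG 0)) 0 1.
Let dv h h' s := (dpt h h' s *m (JG (pt h s) - JG 0)) 0 0.
(* Transform of the curve [x1 = h x2] under the inverse [G] of the map, cut off
   outside of a neighborhood of the origin. *)
Definition graph_tr h s := l1 * (h (u h s) - g 0 (pt h s)).
Definition dgraph_tr h h' s := l1 * (h' (u h s) * du h h' s - dv h h' s).

Let pt_r h s : `|pt h s| <= 2 * d.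
Proof. by apply: norm_row2_le; rewrite !mxE/=. Qed.

Let pt_r' h s : `|pt h s| < r. Proof. exact: le_lt_trans (pt_r h s) dr. Qed.

Let r00 : `|0 : 'rV[R]_2| < r. Proof. by rewrite normr0. Qed.

Let Jball x : `|x| < r -> `|JG x - JG 0| <= eps.
Proof.
move=> xr; apply: le_trans epsC; rewrite (le_trans (JGs xr r00))// ler_wpM2l// subr0.
by rewrite sgle// ltW.
Qed.

Let Jg_eps h s : `|JG (pt h s) - JG 0| <= eps.
Proof. exact: Jball. Qed.

Let class_lip h h' s t : curve_class h h' -> `|h t - h s| <= `|t - s|.
Proof. by move=> [Dh h1 _ _ _]; rewrite -[leRHS]mul1r; exact: MVT_lip Dh h1 _ _. Qed.

Let pt_lip h h' s t : curve_class h h' -> `|pt h t - pt h s| <= `|t - s|.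
Proof.
move=> hc; apply: norm_row2_le; rewrite !mxE/=; last exact: tau_lip.
by rewrite (le_trans (tau_lip _ _))//; exact: class_lip hc.
Qed.

Let dpt1 h h' s : curve_class h h' -> `|dpt h h' s| <= 1.
Proof.
move=> [_ h1 _ _ _]; apply: norm_row2_le; rewrite !mxE/=; last exact: dtau1.
by rewrite normrM mulr_ile1.
Qed.

Let dpt_sg h h' s t : curve_class h h' ->
  `|dpt h h' s - dpt h h' t| <= (K + L) * sg `|s - t|.
Proof.
move=> hc; have [_ h1 hK _ _] := hc.
have S0 : 0 <= sg `|s - t| by exact: sgp.
apply: norm_row2_le; rewrite !mxE/=; last first.
  rewrite (le_trans (dtau_sg (lexx _)))// ler_wpM2r// lerDr//.
rewrite (_ : _ - _ = dtau (h s) * (h' s - h' t) + (dtau (h s) - dtau (h t)) * h' t); last by ring.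
rewrite [leRHS]mulrDl (le_trans (ler_normD _ _))// lerD// normrM.
  by rewrite -[leRHS]mul1r ler_pM.
by rewrite -[leRHS]mulr1 ler_pM// dtau_sg//; exact: class_lip hc.
Qed.

Let A h h' s := dpt h h' s *m (JG (pt h s) - JG 0).

Let A_eps h h' s j : curve_class h h' -> `|A h h' s 0 j| <= 2 * eps.
Proof.
move=> hc; rewrite (le_trans (mx_norm_ge _ _ _))// (le_trans (mx_normM _ _))//.
by rewrite ler_pM ?mulr_ge0 ?Jg_eps// -[leRHS]mulr1 ler_wpM2l// (dpt1 _ hc).
Qed.

Let A_sg h h' s t j : curve_class h h' ->
  `|A h h' s 0 j - A h h' t 0 j| <= (2 * eps * K + D) * sg `|s - t|.
Proof.
move=> hc; have S0 : 0 <= sg `|s - t| by exact: sgp.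
have -> : A h h' s 0 j - A h h' t 0 j = (A h h' s - A h h' t) 0 j by rewrite !mxE.
rewrite (le_trans (mx_norm_ge _ _ _))//.
have -> : A h h' s - A h h' t = (dpt h h' s - dpt h h' t) *m (JG (pt h s) - JG 0) +
    dpt h h' t *m (JG (pt h s) - JG (pt h t)).
  rewrite /A mulmxBl; have -> : JG (pt h t) - JG 0 = (JG (pt h s) - JG 0) - (JG (pt h s) - JG (pt h t)).
    by apply/matrixP => i i'; rewrite !mxE; ring.
  by rewrite [dpt h h' t *m (_ - _ - _)]mulmxBr opprB addrA addrAC.
apply: (@le_trans _ _ (2 * ((K + L) * sg `|s - t|) * eps + 2 * 1 * (C * sg `|s - t|))).
  rewrite (le_trans (ler_normD _ _))// lerD// (le_trans (mx_normM _ _))//.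
    by rewrite ler_pM ?mulr_ge0 ?Jg_eps// ler_wpM2l// dpt_sg.
  rewrite ler_pM ?mulr_ge0 ?ler_wpM2l ?(dpt1 _ hc)//.
  rewrite (le_trans (JGs (pt_r' _ _) (pt_r' _ _)))// ler_wpM2l// sgle//.
  exact: pt_lip hc.
by rewrite /D le_eqVlt; apply/orP; left; apply/eqP; ring.
Qed.

Let Dg h h' (s : R) j : curve_class h h' -> is_derive s 1 (fun t => g j (pt h t)) (A h h' s 0 j).
Proof.
move=> [Dh _ _ _ _].
have Dth : is_derive s 1 (tau \o h) (dtau (h s) * h' s).
  exact: is_derive1_comp (Dtau (h s)) (Dh s).
have JgE : has_jac (fun x => G x - x *m JG 0) (pt h s) (JG (pt h s) - JG 0).
  by apply: has_jacB; [exact: (GJ (pt_r' h s)).1|exact: has_jac_mul].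
exact: (is_derive_curve j Dth (Dtau s) JgE).
Qed.

Let duE h h' s : du h h' s = l2^-1 + A h h' s 0 1. Proof. by []. Qed.

Let du_nu h h' s : curve_class h h' -> `|du h h' s| <= nu.
Proof.
move=> hc; apply: le_trans nul; rewrite duE (le_trans (ler_normD _ _))// normfV lerD2l.
exact: A_eps hc.
Qed.

Let Du h h' (s : R) : curve_class h h' -> is_derive s 1 (u h) (du h h' s).
Proof.
move=> hc; have H : is_derive s 1 (fun t : R => t / l2) l2^-1.
  have -> : (fun t : R => t / l2) = l2^-1 \*: id by apply/funext => t /=; rewrite mulrC.
  by apply: is_derive_eq; rewrite [_ *: _]mulr1.
exact: (is_deriveD H (Dg s 1 hc)).
Qed.

Let u_lip h h' s t : curve_class h h' -> `|u h t - u h s| <= nu * `|t - s|.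
Proof.
by move=> hc; apply: (MVT_lip (fun s => Du s hc)) => x; exact: du_nu hc.
Qed.

Let pt0 h : h 0 = 0 -> pt h 0 = 0.
Proof.
move=> h0; have t0 : tau 0 = 0 by apply: (tau_id _).1; rewrite normr0 ltW.
by apply: eq_row2; rewrite !mxE/= ?h0 t0.
Qed.

Let g0 j : g j 0 = 0. Proof. by rewrite /g G0 mul0mx subr0 mxE. Qed.

Lemma graph_tr_class h h' : curve_class h h' -> curve_class (graph_tr h) (dgraph_tr h h').
Proof.
move=> hc; have [Dh h1 hK h0 h'0] := hc.
have q0 : 0 <= `|l1| by [].
have q1 := ltW hl1.
have knu : `|l1| * (nu + 2 * eps) <= 1.
  apply: (@le_trans _ _ (`|l1| * (k + 4 * eps))).
    by rewrite ler_wpM2l//; have := k1; have := eps0; lra.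
  by apply: (le_trans kq); have := eta0; lra.
have u00 : u h 0 = 0 by rewrite /u pt0// g0 mul0r addr0.
split.
- move=> s.
  have H := is_derive1_comp (Dh (u h s)) (Du s hc).
  exact: (is_deriveZ l1 (is_deriveB H (Dg s 0 hc))).
- move=> s; rewrite normrM (le_trans _ knu)// ler_wpM2l//.
  rewrite (le_trans (ler_normB _ _))// lerD ?A_eps//.
  by rewrite normrM -[leRHS]mul1r ler_pM ?(du_nu _ hc).
- move=> s t; have S0 : 0 <= sg `|s - t| by exact: sgp.
  rewrite (_ : _ - _ = l1 * ((h' (u h s) - h' (u h t)) * du h h' s +
      h' (u h t) * (du h h' s - du h h' t) - (dv h h' s - dv h h' t))); last by rewrite /dgraph_tr; ring.
  rewrite normrM.
  (* The critical term: one [nu] comes from the factor [du], the other from the Lipschitz constant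
     of [u] inside [sg], and [sgnu] bounds both together by [k]. *)
  have H1 : `|(h' (u h s) - h' (u h t)) * du h h' s| <= K * k * sg `|s - t|.
    rewrite normrM -mulrA; apply: (@le_trans _ _ (K * (nu * sg (nu * `|s - t|)))); last first.
      by rewrite ler_wpM2l// sgnu.
    rewrite mulrCA mulrC ler_pM ?(du_nu _ hc)// (le_trans (hK _ _))// ler_wpM2l// sgle//.
    exact: u_lip hc.
  have H2 : `|h' (u h t) * (du h h' s - du h h' t)| <= (2 * eps * K + D) * sg `|s - t|.
    rewrite normrM -[leRHS]mul1r ler_pM//.
    by rewrite !duE (_ : _ - _ = A h h' s 0 1 - A h h' t 0 1) ?A_sg//; ring.
  have H3 : `|dv h h' s - dv h h' t| <= (2 * eps * K + D) * sg `|s - t| by exact: A_sg.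
  apply: (@le_trans _ _ (`|l1| * ((K * (k + 4 * eps) + 2 * D) * sg `|s - t|))).
    rewrite ler_wpM2l// (le_trans (ler_normB _ _))//.
    rewrite (le_trans (lerD (ler_normD _ _) (lexx _)))//.
    by rewrite (le_trans (lerD (lerD H1 H2) H3))//; lra.
  rewrite mulrA ler_wpM2r// mulrDr mulrCA.
  have : K * (`|l1| * (k + 4 * eps)) <= K * (1 - eta) by rewrite ler_wpM2l.
  have : K * eta = 2 * `|l1| * D by rewrite /K divfK// gt_eqF.
  lra.
- by rewrite /graph_tr u00 h0 pt0// g0 subrr mulr0.
- rewrite /dgraph_tr u00 h'0 mul0r /dv pt0// subrr mulmx0 mxE subrr mulr0//.
Qed.

Let g_lip j x y : `|x| < r -> `|y| < r -> `|g j y - g j x| <= 2 * eps * `|y - x|.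
Proof.
move=> xr yr; apply: le_trans (C1_ball_mean GJ Jball xr yr).
rewrite (_ : g j y - g j x = (G y - G x - (y - x) *m JG 0) 0 j) ?mx_norm_ge//.
by rewrite mulmxBl /g; move: (_ *m _) (_ *m _) => a b; rewrite !mxE; ring.
Qed.

Let rho := `|l1| * (1 + 4 * eps).
Let rho0 : 0 <= rho. Proof. by apply: mulr_ge0 => //; apply: addr_ge0 => //; exact: mulr_ge0. Qed.
Let rho1 : rho < 1.
Proof.
have q0 : 0 <= `|l1| by [].
have : rho <= `|l1| * (k + 4 * eps) by rewrite ler_wpM2l// lerD2r (le_trans nu1).
by have := kq; have := eta0; lra.
Qed.

(** In [rho], the 1 comes from the distance of the curves at a common point; [2 eps] comes from the
    displacement of [u], along a 1-Lipschitz curve, and [2 eps] from [g 0]. *)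
Let graph_tr_contr h h' k' k'' M : curve_class h h' -> curve_class k' k'' ->
  (forall s, `|h s - k' s| <= M) -> forall s, `|graph_tr h s - graph_tr k' s| <= rho * M.
Proof.
move=> hc kc hk s; have M0 : 0 <= M by rewrite (le_trans _ (hk 0)).
rewrite /graph_tr -mulrBr normrM /rho -mulrA ler_wpM2l//.
have pp : `|pt h s - pt k' s| <= M.
  apply: norm_row2_le; rewrite !mxE/= ?subrr ?normr0//.
  by rewrite (le_trans (tau_lip _ _)).
have gg j : `|g j (pt h s) - g j (pt k' s)| <= 2 * eps * M.
  by rewrite (le_trans (g_lip _ (pt_r' _ _) (pt_r' _ _)))// ler_wpM2l// mulr_ge0.
have hu : `|h (u h s) - h (u k' s)| <= 2 * eps * M.
  by rewrite (le_trans (class_lip _ _ hc))// /u opprD addrACA subrr add0r gg.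
rewrite (_ : _ - _ = (h (u h s) - h (u k' s)) + (h (u k' s) - k' (u k' s)) -
  (g 0 (pt h s) - g 0 (pt k' s))); last by ring.
rewrite (le_trans (ler_normB _ _))// (le_trans (lerD (ler_normD _ _) (lexx _)))//.
by rewrite (le_trans (lerD (lerD hu (hk _)) (gg 0)))//; lra.
Qed.

Let hh n := iter n (fun p => (graph_tr p.1, dgraph_tr p.1 p.2)) (cst 0 : R -> R, cst 0 : R -> R).

Let hh_class n : curve_class (hh n).1 (hh n).2.
Proof.
elim: n => [|n IH]; last exact: graph_tr_class.
split=> //=.
- by move=> s; exact: is_derive_cst.
- by move=> _; rewrite normr0 ler01.
- by move=> s t; rewrite subrr normr0; apply: mulr_ge0 => //; exact: sgp.
Qed.

Let hh_step : exists2 M, 0 <= M & forall n s, `|(hh n.+1).1 s - (hh n).1 s| <= rho ^+ n * M.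
Proof.
exists (`|l1| * (2 * eps * r)) => [|n]; first by rewrite mulr_ge0// mulr_ge0 ?(ltW r0)// mulr_ge0.
elim: n => [s|n IH s].
  rewrite /= /graph_tr /= subr0 sub0r mul1r normrM normrN ler_wpM2l//.
  have := g_lip 0 r00 (pt_r' (cst 0) s); rewrite g0 !subr0 => /le_trans; apply.
  by rewrite ler_wpM2l ?mulr_ge0// ltW// pt_r'.
rewrite exprS -mulrA; exact: graph_tr_contr (hh_class n.+1) (hh_class n) IH s.
Qed.

Let hh_cauchy : exists2 b, tends0 b &
  forall s n m, (n <= m)%N -> `|(hh m).1 s - (hh n).1 s| <= b n.
Proof.
have [M M0 MP] := hh_step; have r1 : 0 < 1 - rho by rewrite subr_gt0.
exists (fun n => M / (1 - rho) * rho ^+ n).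
  by apply: tends0Z; [rewrite divr_ge0// ltW|apply: tends0_geometric; rewrite rho0].
move=> s n m nm; rewrite -(subnKC nm).
suff H i : `|(hh (n + i)).1 s - (hh n).1 s| <= M / (1 - rho) * (rho ^+ n - rho ^+ (n + i)).
  rewrite (le_trans (H _))// ler_wpM2l ?divr_ge0 ?(ltW r1)// gerBl exprn_ge0//.
elim: i => [|i IH]; first by rewrite addn0 !subrr normr0 mulr0.
rewrite addnS -(subrKA ((hh (n + i)).1 s)) (le_trans (ler_normD _ _))//.
rewrite (le_trans (lerD (MP _ _) IH))// exprS.
rewrite le_eqVlt; apply/orP; left; apply/eqP; field.
by rewrite gt_eqF.
Qed.

Let rem h h' s t : curve_class h h' -> `|h t - h s - (t - s) * h' s| <= K * sg `|t - s| * `|t - s|.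
Proof.
move=> [Dh _ hK _ _]; apply: (@MVT_bound R h h') => x.
move=> /andP[x1 x2]; rewrite (le_trans (hK _ _))// ler_wpM2l// sgle//.
move: x1 x2; case: (leP s t) => st x1 x2; rewrite ler_norml.
  by rewrite [`|t - s|]ger0_norm ?subr_ge0//; apply/andP; split; lra.
by rewrite [`|t - s|]ltr0_norm ?subr_lt0//; apply/andP; split; lra.
Qed.

Let sg_small e : 0 < e -> exists2 t, 0 < t & K * sg t <= e.
Proof.
move=> e0; have K1 : 0 < K + 1 by rewrite ltr_wpDl.
have [t t0 te] := sgs (divr_gt0 e0 K1); exists t => //.
apply: (@le_trans _ _ ((K + 1) * sg t)); last by rewrite mulrC -ler_pdivlMr.
by rewrite ler_wpM2r ?lerDl// sgp// ltW.
Qed.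

(** The iterates from the zero curve converge uniformly by contraction. A slope differs from the
    difference quotient over a step [t] by at most [K sg t], uniformly along the sequence, so the
    slopes converge pointwise too. Uniqueness of the derivative then gives the fixed point equation
    for the slope. *)
Lemma graph_tr_fixpoint : exists h h', curve_class h h' /\
  forall s, graph_tr h s = h s /\ dgraph_tr h h' s = h' s.
Proof.
have [b b0 bP] := hh_cauchy.
have /choice[h hP] : forall s, exists l, forall n, `|(hh n).1 s - l| <= b n.
  by move=> s; apply: cauchy_rate => // n m nm; exact: bP.
have /choice[h' h'P] : forall s, exists l, tends0 (fun n => `|(hh n).2 s - l|).
  move=> s; apply: cauchy_lim => e e0.
  have [t t0 tP] := sg_small (divr_gt0 e0 (ltr0n R 4)).
  (* Any two later curves differ by at most [e t / 4] at both [s] and [s + t], and the two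
     remainders are at most [e t / 4] each: [e t] in total. *)
  have et : 0 < e * t / 8 by rewrite divr_gt0// mulr_gt0.
  have [N NP] := b0 _ et; exists N => n m Nn Nm.
  have Rn := rem s (s + t) (hh_class n); have Rm := rem s (s + t) (hh_class m).
  have nm x : `|(hh n).1 x - (hh m).1 x| <= e * t / 4.
    have := bP x N n Nn; have := bP x N m Nm; have := NP N (leqnn N).
    have := ler_normB ((hh n).1 x - (hh N).1 x) ((hh m).1 x - (hh N).1 x).
    rewrite (_ : _ - _ - _ = (hh n).1 x - (hh m).1 x); last by ring.
    lra.
  have t0' := ltW t0.
  move: Rn Rm; rewrite (_ : s + t - s = t); last by ring.
  rewrite [`|t|]gtr0_norm// => Rn Rm.
  have Kt : K * sg t * t <= e / 4 * t by rewrite ler_wpM2r.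
  rewrite -(ler_pM2l t0) -{1}(gtr0_norm t0) -normrM.
  have := nm (s + t); have := nm s; move: Rn Rm; rewrite !ler_norml.
  by move=> /andP[? ?] /andP[? ?] /andP[? ?] /andP[? ?]; apply/andP; split; lra.
have hlim s : tends0 (fun n => `|(hh n).1 s - h s|) by apply: tends0_le b0 => n; exact: hP.
have cl : curve_class h h'.
  split.
  - move=> s; apply/is_derive_normP => e e0; have [t t0 te] := sg_small e0.
    exists t => // x xt.
    apply: (@le_trans _ _ (K * sg `|x - s| * `|x - s|)); last first.
      by rewrite ler_wpM2r// (le_trans _ te)// ler_wpM2l// sgle// ltW.
    rewrite -subr_le0; apply: (@le_tends0 _ _ (fun n =>
      (`|(hh n).1 x - h x| + `|(hh n).1 s - h s|) + `|x - s| * `|(hh n).2 s - h' s|) 0).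
      by apply: tends0D; [apply: tends0D; exact: hlim|apply: tends0Z => //; exact: h'P].
    move=> n _; rewrite lerBlDl -normrM; have Rn := rem s x (hh_class n).
    have := ler_normB ((hh n).1 x - (hh n).1 s - (x - s) * (hh n).2 s) ((hh n).1 x - h x).
    have := ler_normD ((hh n).1 s - h s) ((x - s) * ((hh n).2 s - h' s)).
    have := ler_normD ((hh n).1 x - (hh n).1 s - (x - s) * (hh n).2 s - ((hh n).1 x - h x))
      ((hh n).1 s - h s + (x - s) * ((hh n).2 s - h' s)).
    rewrite (_ : (hh n).1 x - (hh n).1 s - (x - s) * (hh n).2 s - ((hh n).1 x - h x) +
      ((hh n).1 s - h s + (x - s) * ((hh n).2 s - h' s)) = h x - h s - (x - s) * h' s); last by ring.
    lra.
  - move=> s; rewrite -subr_le0; apply: (@le_tends0 _ _ _ 0 (h'P s)) => n _.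
    have [_ h1 _ _ _] := hh_class n; have := h1 s.
    have := ler_normB ((hh n).2 s) ((hh n).2 s - h' s); rewrite subKr; lra.
  - move=> s t; rewrite -subr_le0; apply: (@le_tends0 _ _ (fun n =>
      `|(hh n).2 s - h' s| + `|(hh n).2 t - h' t|) 0); first by apply: tends0D; exact: h'P.
    move=> n _; have [_ _ hK _ _] := hh_class n; have := hK s t.
    have := ler_normB ((hh n).2 s - (hh n).2 t) ((hh n).2 s - h' s).
    have := ler_normD ((hh n).2 s - (hh n).2 t - ((hh n).2 s - h' s)) ((hh n).2 t - h' t).
    rewrite (_ : (hh n).2 s - (hh n).2 t - ((hh n).2 s - h' s) + ((hh n).2 t - h' t) = h' s - h' t).
      lra.
    by ring.
  - apply/eqP; rewrite -normr_le0; apply: (@le_tends0 _ _ _ 0 (hlim 0)) => n _.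
    by have [_ _ _ -> _] := hh_class n; rewrite sub0r normrN.
  - apply/eqP; rewrite -normr_le0; apply: (@le_tends0 _ _ _ 0 (h'P 0)) => n _.
    by have [_ _ _ _ ->] := hh_class n; rewrite sub0r normrN.
have fix1 s : graph_tr h s = h s.
  apply/eqP; rewrite -subr_eq0 -normr_le0.
  apply: (@le_tends0 _ _ (fun n => rho * b n + b n.+1) 0).
    apply: tends0D; first exact: tends0Z.
    by move=> e /b0[N NP]; exists N => n Nn; rewrite NP// (leq_trans Nn).
  move=> n _; have H := graph_tr_contr (hh_class n) cl (fun s => hP s n) s.
  have := hP s n.+1; rewrite [(hh n.+1).1]/(graph_tr (hh n).1) => H'.
  have := ler_normB (graph_tr (hh n).1 s - h s) (graph_tr (hh n).1 s - graph_tr h s).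
  rewrite (_ : graph_tr (hh n).1 s - h s - (graph_tr (hh n).1 s - graph_tr h s) = graph_tr h s - h s).
    lra.
  by ring.
exists h, h'; split=> // s; split=> //.
have [D1 _ _ _ _] := cl; have [D2 _ _ _ _] := graph_tr_class cl.
have E : graph_tr h = h by apply/funext.
by have [_ <-] := D1 s; have [_ <-] := D2 s; rewrite E.
Qed.

(** Since [|h s| <= |s| <= d], the cutoff is the identity at both coordinates and the fixed point
    equations concern [G] itself. The second conclusion says that the derivative of [G] maps
    tangents of the curve to tangents. *)
Lemma graph_tr_invariant h h' s : curve_class h h' ->
  graph_tr h s = h s -> dgraph_tr h h' s = h' s -> `|s| <= d ->
  let y := row2 (h s) s in let x := G y in let v := row2 (h' s) 1 *m JG y in
  x 0 0 = h (x 0 1) /\ v 0 0 = h' (x 0 1) * v 0 1.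
Proof.
move=> hc E1 E2 sd y x v; have [_ _ _ h0 _] := hc.
have hs : `|h s| <= d.
  by have := class_lip 0 s hc; rewrite h0 !subr0 => /le_trans; apply.
have [ts ds] := tau_id sd; have [th dh] := tau_id hs.
have py : pt h s = y by rewrite /pt ts th.
have pdy : dpt h h' s = row2 (h' s) 1 by rewrite /dpt ds dh mul1r.
have gE j : g j y = x 0 j - (y *m JG 0) 0 j by rewrite /g !mxE.
have ue : u h s = x 0 1.
  by rewrite /u py gE JG0 mulmx2E !mx2E; ring.
have AE j : (dpt h h' s *m (JG (pt h s) - JG 0)) 0 j = v 0 j - (row2 (h' s) 1 *m JG 0) 0 j.
  by rewrite pdy py mulmxBr [LHS]mxE [X in _ + X]mxE.
move: E1 E2; rewrite /graph_tr /dgraph_tr ue py gE /du /dv !AE JG0 !mulmx2E !mx2E => E1 E2.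
have lE (a b : R) : l1 * a = b -> a = b / l1 by move=> <-; rewrite mulrC mulKf.
by split; [have := lE _ _ E1|have := lE _ _ E2]; lra.
Qed.

End GraphTransform.

(** * Sufficiency of the Dini condition *)

Section WeakCurve.
Variable R : realType.

Lemma weak_curve (l1 l2 : R) (G : 'rV[R]_2 -> 'rV[R]_2) JG r C sg c0 nu k :
  0 < `|l1| -> 0 < `|l2| -> 0 < r -> G 0 = 0 -> C1_ball G JG r ->
  JG 0 = mx2 l1^-1 0 0 l2^-1 -> 0 <= C -> gauge sg ->
  (forall e, 0 < e -> exists2 t, 0 < t & sg t <= e) ->
  0 < c0 -> (forall t, 0 <= t -> c0 * Num.min t 1 <= sg t) ->
  (forall x y, `|x| < r -> `|y| < r -> `|JG x - JG y| <= C * sg `|x - y|) ->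
  1 <= nu -> `|l2|^-1 < nu -> nu <= k -> `|l1| * k < 1 ->
  (forall t, 0 <= t -> nu * sg (nu * t) <= k * sg t) ->
  exists h h' d K, [/\ 0 < d, 0 <= K,
    [/\ forall s : R, is_derive s 1 h (h' s), forall s, `|h' s| <= 1,
      forall s t, `|h' s - h' t| <= K * sg `|s - t|, h 0 = 0 & h' 0 = 0] &
    forall s, `|s| <= d ->
      let y := row2 (h s) s in let x := G y in let v := row2 (h' s) 1 *m JG y in
      x 0 0 = h (x 0 1) /\ v 0 0 = h' (x 0 1) * v 0 1].
Proof.
move=> q0 p0 r0 G0 GJ JG0 C0 sgg sgs c00 sgc JGs nu1 nul nuk qk sgnu.
pose eta := (1 - `|l1| * k) / 2.
have eta0 : 0 < eta by rewrite divr_gt0// subr_gt0.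
(* As [|l1| k = 1 - 2 eta], the first bound gives [|l1| (k + 4 eps) <= 1 - eta]; the second keeps
   the expansion of the second coordinate below [nu]. *)
pose eps := Num.min (eta / (4 * `|l1|)) ((nu - `|l2|^-1) / 2).
have eps0 : 0 < eps by rewrite lt_min !divr_gt0 ?mulr_gt0 ?subr_gt0.
have C1 : 0 < C + 1 by rewrite ltr_wpDl.
have [t t0 te] := sgs _ (divr_gt0 eps0 C1).
have [sg0 sgp sgle _] := sgg.
pose r1 := Num.min r t; have r10 : 0 < r1 by rewrite lt_min r0.
have GJ1 : C1_ball G JG r1 by apply: C1_ball_le GJ; rewrite ge_min lexx.
have r1r (x : 'rV[R]_2) : `|x| < r1 -> `|x| < r by rewrite lt_min => /andP[].
have JGs1 x y : `|x| < r1 -> `|y| < r1 -> `|JG x - JG y| <= C * sg `|x - y|.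
  by move=> /r1r xr /r1r; exact: JGs.
have epsC : C * sg r1 <= eps.
  apply: (@le_trans _ _ ((C + 1) * sg t)); last by rewrite mulrC -ler_pdivlMr.
  by rewrite ler_pM ?lerDl ?sgp ?sgle ?(ltW r10)// ge_min lexx orbT.
pose d := r1 / 4; have d0 : 0 < d by rewrite divr_gt0.
have dr : 2 * d < r1 by rewrite /d; move: r10; lra.
have nul' : `|l2|^-1 + 2 * eps <= nu.
  have : eps <= (nu - `|l2|^-1) / 2 by rewrite ge_min lexx orbT.
  by lra.
have kq : `|l1| * (k + 4 * eps) <= 1 - eta.
  have : eps <= eta / (4 * `|l1|) by rewrite ge_min lexx.
  rewrite ler_pdivlMr ?mulr_gt0// mulrDr /eta; lra.
have [tau [dtau [Dtau dtau01 tau_le tau_id dtau_lip]]] := cutoff d0.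
have [h [h' [hc hfix]]] := @graph_tr_fixpoint R l1 l2 q0 G JG r1 C r10 G0 GJ1 C0 sg c0
  sgg sgs c00 sgc JGs1 d eps nu k eta d0 dr (ltW eps0) epsC nu1 nul' nuk sgnu eta0 kq
  tau dtau Dtau dtau01 tau_le tau_id dtau_lip.
exists h, h', d, (2 * `|l1| * (2 * eps * ((1 + 4 / d) / c0) + 2 * C) / eta); split=> //.
  apply: divr_ge0; last exact: ltW.
  by repeat first [done | exact: ltW | rewrite invr_ge0 | apply: mulr_ge0 | apply: addr_ge0].
move=> s sd.
exact: (@graph_tr_invariant R l1 l2 q0 G JG C JG0 sg c0 d eps eta tau dtau tau_id
  h h' s hc (hfix s).1 (hfix s).2 sd).
Qed.

End WeakCurve.

(** * Local estimates for the map and its inverse *)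

Section LocalData.
Variable R : realType.

Lemma opnorm_entry n (A : 'M[R]_n) i j : `|A i j| <= opnorm A.
Proof.
pose v : 'rV[R]_n := delta_mx 0 i.
have v1 : `|v| <= 1.
  by apply: mx_norm_le => // k l; rewrite mxE; case: (_ && _); rewrite ?normr1 ?normr0.
have H : `|v *m A| <= opnorm A.
  apply: (@ub_le_sup R [set `|v *m A| | v in [set v : 'rV[R]_n | `|v| <= 1]]).
    exists (n%:R * `|A|) => _ [u /= u1 <-]; rewrite (le_trans (mx_normM _ _))//.
    by rewrite mulrAC ler_piMr// mulr_ge0.
  by exists v.
by apply: le_trans H; rewrite -rowE; apply: le_trans (mx_norm_ge _ 0 j); rewrite mxE.
Qed.

Lemma opnorm_le n (A : 'M[R]_n) : opnorm A <= n%:R * `|A|.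
Proof.
rewrite /opnorm; apply: ge_sup.
  by exists `|(0 : 'rV[R]_n) *m A|; exists 0; rewrite //= normr0 ler01.
move=> _ [v /= v1 <-]; rewrite (le_trans (mx_normM _ _))//.
by rewrite mulrAC ler_piMr// mulr_ge0.
Qed.

Lemma sg_dist sg (C : R) (x y : R) : gauge sg -> 0 <= C -> 0 <= x -> x <= C * y -> 0 <= y ->
  sg x <= (C + 1) * sg y.
Proof.
move=> [_ sgp sgle sgC] C0 x0 xy y0; apply: (@le_trans _ _ (sg ((C + 1) * y))).
  by apply: sgle => //; rewrite mulrDl mul1r (le_trans xy)// lerDl.
by apply: sgC => //; rewrite lerDr.
Qed.

Lemma inv_mxB n (P Q P' Q' : 'M[R]_n) : P *m P' = 1%:M -> Q *m Q' = 1%:M ->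
  P - Q = P *m (Q' - P') *m Q.
Proof.
move=> PP QQ; rewrite mulmxBr PP mulmxBl mul1mx -mulmxA.
by rewrite (mulmx1C QQ) mulmx1.
Qed.

(** The inverse inherits the modulus: [DG x - DG y = DG x (DF (G y) - DF (G x)) DG y], and [G] is
    Lipschitz. *)
Lemma C1w_extract (w sg : R -> R) (F : 'rV[R]_2 -> 'rV[R]_2) : gauge sg ->
  (forall t, 0 <= t <= 1 -> w t <= sg t) -> C1w_diffeo w F ->
  exists G r r' C, [/\ [/\ 0 < r, r <= 2^-1, 0 < r' & 0 <= C],
    [/\ F 0 = 0, G 0 = 0, C1_ball F (jacobian F) r & C1_ball G (jacobian G) r'],
    [/\ forall x, `|x| < r -> G (F x) = x, forall y, `|y| < r' -> `|G y| < r,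
      forall y, `|y| < r' -> 'J G y *m 'J F (G y) = 1%:M &
      forall y, `|y| < r' -> `|'J G y| <= C],
    forall x y, `|x| < r -> `|y| < r -> `|'J F x - 'J F y| <= C * sg `|x - y| &
    forall x y, `|x| < r' -> `|y| < r' -> `|'J G x - 'J G y| <= C * sg `|x - y|].
Proof.
move=> sgg wsg [[F0 [U [V [G [oU oV bij GF [FU GV]]]]]] [W [L [W0 L0 Lw]]]].
have [sg0 sgp sgle _] := sgg.
have [rF rF0 [FJ FUr]] := C1_onP oU FU.
have [rG rG0 [GJ GVr]] := C1_onP oV GV.
have [rW rW0 rWP] := (near_normP _ _).1 W0.
(* The radius 1/2 keeps all distances at most 1, where [sg] dominates [w]. *)
pose r := Num.min (2^-1) (Num.min rF rW).
have r0 : 0 < r by rewrite !lt_min rF0 rW0 invr_gt0 ltr0n.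
have [r1 [r2 r3]] : r <= 2^-1 /\ r <= rF /\ r <= rW.
  by rewrite /r !ge_min !lexx !orbT.
have G0 : G 0 = 0 by rewrite -{1}F0 GF//; case: oU.
have FJr := C1_ball_le r2 FJ.
have Fsg x y : `|x| < r -> `|y| < r -> `|'J F x - 'J F y| <= L * sg `|x - y|.
  move=> xr yr; have xy1 : 0 <= `|x - y| <= 1.
    by rewrite normr_ge0 /= (le_trans (ler_normB _ _))//; move: xr yr r1; lra.
  have xW : W x by apply: rWP; rewrite subr0 (lt_le_trans xr).
  have yW : W y by apply: rWP; rewrite subr0 (lt_le_trans yr).
  apply: mx_norm_le => [|i j]; first by rewrite mulr_ge0 ?sgp// ltW.
  rewrite (le_trans (opnorm_entry _ _ _))// (le_trans (Lw _ _ xW yW))//.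
  by rewrite ler_wpM2l ?wsg// ltW.
have rG00 : `|0 : 'rV[R]_2| < rG by rewrite normr0.
have [dG dG0 dGP] := has_jac_cont (GJ 0 rG00).1 (divr_gt0 r0 (ltr0n R 2)).
have [dJ dJ0 dJP] := (GJ 0 rG00).2 1 ltr01.
pose r' := Num.min rG (Num.min dG dJ).
have r'0 : 0 < r' by rewrite !lt_min rG0 dG0 dJ0.
have r'P y : `|y| < r' -> [/\ `|y| < rG, `|G y| < r & `|'J G y| <= `|'J G 0| + 1].
  move=> yr'; have /and3P[yG yd yJ] : [&& `|y| < rG, `|y| < dG & `|y| < dJ].
    by move: yr'; rewrite !lt_min.
  split=> //.
    have Gd : `|G y - G 0| <= r / 2 by apply: dGP; rewrite subr0.
    rewrite G0 subr0 in Gd; apply: (le_lt_trans Gd).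
    by rewrite ltr_pdivrMr// ltr_pMr// ltrDl.
  rewrite -(subrK ('J G 0) ('J G y)) (le_trans (ler_normD _ _))// addrC lerD2l.
  by apply: dJP; rewrite subr0.
have FG y : `|y| < rG -> F (G y) = y.
  move=> /GVr Vy; have [_ _ /(_ y Vy)[x Ux <-]] := bij.
  by rewrite GF.
have JGF y : `|y| < r' -> 'J G y *m 'J F (G y) = 1%:M.
  move=> yr; have [yG Gyr _] := r'P y yr.
  have H := has_jac_comp (GJ y yG).1 (FJr _ Gyr).1.
  have H' : has_jac id y (1%:M : 'M[R]_2).
    by have := has_jac_mul (1%:M : 'M[R]_2) y; under eq_fun do rewrite mulmx1.
  apply: (has_jac_unique H); apply: (has_jac_near (d := rG - `|y|) _ _ H').
    by rewrite subr_gt0.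
  move=> z zy; rewrite /= FG//.
  by rewrite -(subrK y z) (le_lt_trans (ler_normD _ _))// -ltrBrDr.
pose M := `|'J G 0| + 1.
have M0 : 0 <= M by rewrite addr_ge0.
have GL x y : `|x| < r' -> `|y| < r' -> `|G y - G x| <= 2 * M * `|y - x|.
  move=> xr yr; have GJr' : C1_ball G (jacobian G) r' by apply: C1_ball_le GJ; rewrite ge_min lexx.
  have := @C1_ball_mean R 2 2 G (jacobian G) r' 0 M x y GJr' _ xr yr.
  rewrite mulmx0 subr0; apply => z zr; rewrite subr0.
  by have [] := r'P z zr.
pose C := L + M + 2 * (2 * M * (L * (2 * M + 1))) * M.
have Cp : 0 <= 2 * (2 * M * (L * (2 * M + 1))) * M.
  by repeat first [done | exact: ltW | apply: mulr_ge0 | apply: addr_ge0].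
exists G, r, r', C; split=> //.
- by split=> //; rewrite /C !addr_ge0// ltW.
- by split=> //; apply: C1_ball_le GJ; rewrite ge_min lexx.
- split=> //.
  + by move=> x xr; apply: GF; apply: FUr; exact: lt_le_trans r2.
  + by move=> y /r'P[].
  + move=> y /r'P[_ _ H]; apply: (le_trans H); rewrite -/M /C.
    by rewrite addrAC lerDr addr_ge0// ltW.
- move=> x y xr yr; rewrite (le_trans (Fsg x y xr yr))// ler_wpM2r ?sgp//.
  by rewrite /C -addrA lerDl addr_ge0.
move=> x y xr yr; have [_ xG xJ] := r'P x xr; have [_ yG yJ] := r'P y yr.
rewrite (inv_mxB (JGF x xr) (JGF y yr)).
apply: (@le_trans _ _ (2 * (2 * M * (L * (2 * M + 1))) * M * sg `|x - y|)); last first.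
  rewrite ler_wpM2r ?sgp// /C lerDr addr_ge0// ltW//.
have Gd : sg `|G y - G x| <= (2 * M + 1) * sg `|x - y|.
  by apply: sg_dist => //; [rewrite mulr_ge0|rewrite [`|x - y|]distrC GL].
have M20 : 0 <= 2 * M by rewrite mulr_ge0.
move: xJ yJ (Fsg _ _ yG xG); rewrite -/M.
move: ('J G x) ('J G y) ('J F (G y) - 'J F (G x)) => P Q T PM QM TL.
have {}TL : `|T| <= L * ((2 * M + 1) * sg `|x - y|).
  by rewrite (le_trans TL)// ler_wpM2l// ltW.
have PT : `|P *m T| <= 2 * M * (L * ((2 * M + 1) * sg `|x - y|)).
  apply: le_trans (mx_normM _ _) _; apply: ler_pM => //; by [apply: mulr_ge0|rewrite ler_wpM2l].
have PTQ : `|P *m T *m Q| <= 2 * (2 * M * (L * ((2 * M + 1) * sg `|x - y|))) * M.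
  apply: le_trans (mx_normM _ _) _; apply: ler_pM => //; by [apply: mulr_ge0|rewrite ler_wpM2l].
apply: (le_trans PTQ); rewrite le_eqVlt; apply/orP; left; apply/eqP.
by ring.
Qed.

End LocalData.

(** * Contraction towards the invariant curve *)

Section CurveCoupling.
Variables (R : realType) (l1 l2 : R).
Hypotheses (hl1 : 0 < `|l1|).
Variables (F G : 'rV[R]_2 -> 'rV[R]_2) (JF JG : 'rV[R]_2 -> 'M[R]_2).
Variables (rF rG C : R) (sg : R -> R).
Hypotheses (C0 : 0 <= C) (sgg : gauge sg).
Hypotheses (FJ : C1_ball F JF rF) (GJ : C1_ball G JG rG)
  (GF : forall x, `|x| < rF -> G (F x) = x) (GrF : forall y, `|y| < rG -> `|G y| < rF)
  (JGF : forall y, `|y| < rG -> JG y *m JF (G y) = 1%:M)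
  (JGC : forall y, `|y| < rG -> `|JG y| <= C)
  (JFs : forall x y, `|x| < rF -> `|y| < rF -> `|JF x - JF y| <= C * sg `|x - y|)
  (JGs : forall x y, `|x| < rG -> `|y| < rG -> `|JG x - JG y| <= C * sg `|x - y|)
  (JG0 : JG 0 = mx2 l1^-1 0 0 l2^-1).
Variables (h h' : R -> R) (d K : R).
Hypotheses (d0 : 0 < d) (K0 : 0 <= K).
Hypotheses (Dh : forall s : R, is_derive s 1 h (h' s)) (h1 : forall s, `|h' s| <= 1)
  (hK : forall s t, `|h' s - h' t| <= K * sg `|s - t|) (h0 : h 0 = 0).
Hypothesis inv : forall s, `|s| <= d ->
  let y := row2 (h s) s in let x := G y in let v := row2 (h' s) 1 *m JG y in
  x 0 0 = h (x 0 1) /\ v 0 0 = h' (x 0 1) * v 0 1.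
Variable r : R.
Hypotheses (r0 : 0 < r) (rrF : r <= rF) (rrG : r <= rG) (rd : r <= d)
  (rs : 4 * C * `|l1| * sg r <= 1) (Fr : forall x, `|x| < r -> `|F x| <= `|x|).

(* The contraction rate of the height is [|l1|] rather than [|l2|]; this is what
   makes the coupling along an orbit summable against [(|l2| / |l1|)^k]. *)
Definition height (x : 'rV[R]_2) := x 0 0 - h (x 0 1).
Let sgp t : 0 <= t -> 0 <= sg t. Proof. by case: sgg => _ H _ _; exact: H. Qed.
Let sgle s t : 0 <= s -> s <= t -> sg s <= sg t. Proof. by case: sgg => _ _ H _; exact: H. Qed.
Let l10 : l1 != 0. Proof. by rewrite -normr_gt0. Qed.

Let h_le s : `|h s| <= `|s|.
Proof. by have := MVT_lip Dh h1 0 s; rewrite h0 !subr0 mul1r. Qed.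

(* The coupling vanishes on the curve, so it is compared with its value at the
   preimage of the point of the curve below [F x]. *)
Let foot (x : 'rV[R]_2) : 'rV[R]_2 := row2 (h (F x 0 1)) (F x 0 1).

Let foot_r x : `|x| < r -> [/\ `|F x| <= `|x|, `|F x 0 1| <= `|x|,
  `|foot x| <= `|x| & `|F x - foot x| = `|height (F x)|].
Proof.
move=> xr; have Fx := Fr xr; have F1 : `|F x 0 1| <= `|x| by rewrite (le_trans (mx_norm_ge _ _ _)).
split=> //; first by apply: norm_row2_le; rewrite !mxE//= (le_trans (h_le _)).
apply/eqP; rewrite eq_le; apply/andP; split.
  by apply: norm_row2_le; rewrite !mxE/= ?subrr ?normr0.
by have := mx_norm_ge (F x - foot x) 0 0; rewrite !mxE.
Qed.

(** On the horizontal segment from the curve to [F x], the function [phi] (the height of the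
    preimage) vanishes at the first end by invariance, equals [height x] at the second, and has
    slope within [2 C sg |x|] of [1 / l1]. *)
Lemma height_contract x : `|x| < r ->
  `|height (F x)| <= `|l1| * (1 + 4 * C * `|l1| * sg `|x|) * `|height x|.
Proof.
move=> xr; have [Fx F1 fx Ff] := foot_r xr; set s := F x 0 1 in F1.
set e := height (F x).
have xF : `|x| < rF by rewrite (lt_le_trans xr).
pose q := `|l1|; have q0 : 0 < q by [].
have S0 : 0 <= sg `|x| by exact: sgp.
have CS0 : 0 <= C * sg `|x| by exact: mulr_ge0.
pose phi z := G (row2 z s) 0 0 - h (G (row2 z s) 0 1).
pose dphi z := JG (row2 z s) 0 0 - h' (G (row2 z s) 0 1) * JG (row2 z s) 0 1.
have seg z : Num.min (h s) (F x 0 0) <= z <= Num.max (h s) (F x 0 0) -> `|row2 z s| <= `|x|.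
  move=> zs; apply: norm_row2_le; rewrite !mxE//=.
  have a1 : `|h s| <= `|x| by rewrite (le_trans (h_le _)).
  have a2 : `|F x 0 0| <= `|x| by rewrite (le_trans (mx_norm_ge _ _ _)).
  move: zs a1 a2; rewrite !ler_norml ge_min le_max.
  by move=> /andP[/orP[] ? /orP[] ?] /andP[? ?] /andP[? ?]; apply/andP; split; lra.
have Dphi z : Num.min (h s) (F x 0 0) <= z <= Num.max (h s) (F x 0 0) -> is_derive z 1 phi (dphi z).
  move=> /seg zx; have zr : `|row2 z s| < rG by rewrite (le_lt_trans zx)// (lt_le_trans xr).
  have Dj j : is_derive z 1 (fun t : R => G (row2 t s) 0 j) (JG (row2 z s) 0 j).
    have H := is_derive_curve j (is_derive_id z 1) (is_derive_cst s z 1) (GJ zr).1.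
    by apply: (is_derive_eq H); rewrite mulmx2E !mx2E mul1r mul0r addr0.
  exact: (is_deriveB (Dj 0) (is_derive1_comp (Dh _) (Dj 1))).
have phib z : Num.min (h s) (F x 0 0) <= z <= Num.max (h s) (F x 0 0) ->
    `|dphi z - l1^-1| <= 2 * (C * sg `|x|).
  move=> /seg zx; have zr : `|row2 z s| < rG by rewrite (le_lt_trans zx)// (lt_le_trans xr).
  have z0 : `|0 : 'rV[R]_2| < rG by rewrite normr0 (le_lt_trans _ zr).
  have Jz : `|JG (row2 z s) - JG 0| <= C * sg `|x|.
    by rewrite (le_trans (JGs zr z0))// ler_wpM2l// subr0 sgle.
  have J0 := le_trans (mx_norm_ge _ 0 0) Jz; have J1 := le_trans (mx_norm_ge _ 0 1) Jz.
  move: J0 J1; rewrite JG0 ![(_ - mx2 _ _ _ _) 0 _]mxE ![(- mx2 _ _ _ _) 0 _]mxE !mx2E subr0 => J0 J1.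
  rewrite /dphi (_ : _ - _ = (JG (row2 z s) 0 0 - l1^-1) - h' (G (row2 z s) 0 1) * JG (row2 z s) 0 1); last by ring.
  rewrite (le_trans (ler_normB _ _))// mulr_natl mulr2n lerD// normrM.
  by rewrite -[leRHS]mul1r ler_pM.
have := MVT_bound Dphi phib.
have -> : phi (F x 0 0) = height x.
  by rewrite /phi (_ : row2 _ _ = F x) ?GF//; apply: eq_row2; rewrite !mxE.
have -> : phi (h s) = 0.
  have [|E _] := inv (s := s); first by rewrite (le_trans F1)// (le_trans (ltW xr)).
  by rewrite /phi E subrr.
rewrite subr0 -/(height (F x)) -/e => H.
have He : `|e| <= q * `|height x| + 2 * C * q * sg `|x| * `|e|.
  have : `|e / l1| <= `|height x| + 2 * (C * sg `|x|) * `|e|.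
    have := ler_normB (height x) (height x - e / l1); rewrite subKr.
    by move: H; lra.
  rewrite normrM normfV ler_pdivrMr// => /le_trans; apply.
  by rewrite -/q le_eqVlt; apply/orP; left; apply/eqP; ring.
have p4 : 0 <= 4 * C * q by apply: mulr_ge0; [exact: mulr_ge0|exact: ltW].
have small : 4 * C * q * sg `|x| <= 1.
  by apply: le_trans rs; rewrite ler_wpM2l ?sgle ?(ltW xr).
have h00 : 0 <= `|height x| by [].
have e00 : 0 <= `|e| by [].
rewrite -/q; set a := 4 * C * q * sg `|x| in small *.
have a0 : 0 <= a by exact: mulr_ge0.
have {}He : `|e| <= q * `|height x| + a / 2 * `|e|.
  by rewrite (_ : a / 2 = 2 * C * q * sg `|x|)// /a; field.
(* As [a <= 1], the term [a / 2 |e|] can be absorbed; reinserting the resulting crude bound gives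
   the factor [1 + a]. *)
have e2 : `|e| <= 2 * (q * `|height x|) by move: He e00 small; nra.
have : a / 2 * `|e| <= a / 2 * (2 * (q * `|height x|)) by rewrite ler_wpM2l// divr_ge0.
by move: He; lra.
Qed.

(** The coupling vanishes at [xs = G (foot x)], whose distance to [x] is at most
    [2 C |height (F x)|], hence of order [|height x|]; the moduli of [JF] and [h'] do the rest. *)
Lemma coupling_bound M x : (forall z, `|z| < rF -> `|JF z| <= M) -> `|x| < r ->
  `|coupling F JF h' x| <= (2 * M * K + 4 * C) * ((4 * C * `|l1| + 1) * sg `|height x|).
Proof.
move=> JM xr; have [Fx F1 fx Ff] := foot_r xr.
have xF : `|x| < rF by rewrite (lt_le_trans xr).
have M0 : 0 <= M by rewrite (le_trans _ (JM x xF)).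
have fG : `|foot x| < rG by rewrite (le_lt_trans fx)// (lt_le_trans xr).
have FG : `|F x| < rG by rewrite (le_lt_trans Fx)// (lt_le_trans xr).
pose xs := G (foot x); have xsF : `|xs| < rF by exact: GrF.
have dist : `|x - xs| <= 4 * C * `|l1| * `|height x|.
  have GC z : `|z| < rG -> `|JG z - 0| <= C by move=> zr; rewrite subr0 JGC.
  have := C1_ball_mean GJ GC fG FG; rewrite mulmx0 subr0 GF// Ff => /le_trans; apply.
  have := height_contract xr; set b := 4 * C * _ * _ => H.
  have b1 : b <= 1 by apply: le_trans rs; rewrite ler_wpM2l ?sgle ?(ltW xr)// !mulr_ge0.
  have H2 : `|height (F x)| <= `|l1| * 2 * `|height x|.
    by apply: (le_trans H); rewrite ler_wpM2r// ler_wpM2l//; lra.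
  apply: (@le_trans _ _ (2 * C * (`|l1| * 2 * `|height x|))); first by rewrite ler_wpM2l// mulr_ge0.
  by rewrite le_eqVlt; apply/orP; left; apply/eqP; ring.
have Sd : sg `|x - xs| <= (4 * C * `|l1| + 1) * sg `|height x|.
  by apply: sg_dist => //; rewrite !mulr_ge0.
have [|E1 E2] := inv (s := F x 0 1).
  by rewrite (le_trans F1)// (le_trans (ltW xr)).
move: E1 E2; rewrite -/(foot x) -/xs; set v := _ *m _ => E1 E2.
have vJ : v *m JF xs = row2 (h' (F x 0 1)) 1 by rewrite /v -mulmxA JGF// mulmx1.
have v0 : v 0 0 * JF xs 0 0 + v 0 1 * JF xs 1 0 = h' (F x 0 1) by rewrite -mulmx2E vJ mx2E.
have v1 : v 0 0 * JF xs 0 1 + v 0 1 * JF xs 1 1 = 1 by rewrite -mulmx2E vJ mx2E.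
have dJ i j : `|JF x i j - JF xs i j| <= C * sg `|x - xs|.
  have := mx_norm_ge (JF x - JF xs) i j; rewrite !mxE => /le_trans; apply.
  exact: JFs.
have JMx i j : `|JF x i j| <= M by rewrite (le_trans (mx_norm_ge _ _ _))// JM.
have xx1 : `|x 0 1 - xs 0 1| <= `|x - xs|.
  by have := mx_norm_ge (x - xs) 0 1; rewrite !mxE.
have da : `|h' (x 0 1) - h' (xs 0 1)| <= K * sg `|x - xs|.
  by rewrite (le_trans (hK _ _))// ler_wpM2l// sgle.
have S0 : 0 <= sg `|x - xs| by exact: sgp.
apply: (@le_trans _ _ ((2 * M * K + 4 * C) * sg `|x - xs|)); last first.
  rewrite ler_wpM2l//.
  by repeat first [done | apply: mulr_ge0 | apply: addr_ge0].
rewrite /coupling; move: v0 v1; rewrite E2.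
have a1 := h1 (xs 0 1); have b1 := h1 (F x 0 1).
move: (h' (x 0 1)) (h' (xs 0 1)) (h' (F x 0 1)) da a1 b1 => a as_ b da a1 b1.
move: (dJ 0 0) (dJ 0 1) (dJ 1 0) (dJ 1 1) (JMx 0 0) (JMx 0 1).
move: (JF x 0 0) (JF x 0 1) (JF x 1 0) (JF x 1 1) (JF xs 0 0) (JF xs 0 1) (JF xs 1 0) (JF xs 1 1) (v 0 1) (sg `|x - xs|) S0 da.
move=> f00 f01 f10 f11 g00 g01 g10 g11 m S S0 da d00 d01 d10 d11 M00 M01 v0 v1.
have m0 : m != 0.
  by apply/eqP => m0; move: v1; rewrite m0 !(mulr0, mul0r) addr0 => /eqP; rewrite eq_sym oner_eq0.
(* At [xs] the tangent [m (as_, 1)] is mapped by [JF xs] to the tangent [(b, 1)]; eliminating [m]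
   leaves the vanishing of the coupling. *)
have z0 : as_ * g00 + g10 - b * (as_ * g01 + g11) = 0.
  have z1 : m * (as_ * g00 + g10) = b by rewrite -[RHS]v0; ring.
  have z2 : m * (as_ * g01 + g11) = 1 by rewrite -[RHS]v1; ring.
  by apply: (mulfI m0); rewrite mulr0 mulrBr mulrCA z1 z2 mulr1 subrr.
rewrite -[X in `|X|]subr0 -z0 (_ : _ - _ = (a - as_) * (f00 - b * f01) +
  (as_ * ((f00 - g00) - b * (f01 - g01)) + ((f10 - g10) - b * (f11 - g11)))); last by ring.
have bb (u w : R) (B : R) : `|u| <= B -> `|w| <= B -> `|u - b * w| <= 2 * B.
  move=> uB wB; rewrite (le_trans (ler_normB _ _))// mulr_natl mulr2n lerD// normrM.
  by rewrite (le_trans _ wB)// ler_piMl.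
rewrite (le_trans (ler_normD _ _))// [leRHS]mulrDl lerD//.
  rewrite normrM (_ : _ * S = K * S * (2 * M)); last by ring.
  by rewrite ler_pM// bb.
rewrite (_ : 4 * C * S = 2 * (C * S) + 2 * (C * S)); last by ring.
rewrite (le_trans (ler_normD _ _))// lerD ?bb// normrM.
by rewrite (le_trans _ (bb _ _ _ d00 d01))// ler_piMl.
Qed.

End CurveCoupling.

(** * Linearizability under the summability condition *)

Section Sufficiency.
Variables (R : realType) (w sg : R -> R) (l1 l2 c0 : R) (F : 'rV[R]_2 -> 'rV[R]_2).
Hypotheses (hl1 : 0 < `|l1|) (hl12 : `|l1| <= `|l2|) (hl2 : `|l2| < 1).
Hypotheses (sgg : gauge sg) (wsg : forall t, 0 <= t <= 1 -> w t <= sg t)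
  (c00 : 0 < c0) (sgc : forall t, 0 <= t -> c0 * Num.min t 1 <= sg t)
  (summ_q : summ (fun k => (`|l2| / `|l1|) ^+ k * sg (`|l1| ^+ k)))
  (expansion : `|l1| < `|l2| -> exists nu k, [/\ 1 <= nu, `|l2|^-1 < nu, nu <= k,
     `|l1| * k < 1 & forall t, 0 <= t -> nu * sg (nu * t) <= k * sg t])
  (Fw : C1w_diffeo w F) (JF0 : 'J F 0 = diag2 l1 l2).

Let q := `|l1|.
Let p := `|l2|.
Let mu := (1 + p) / 2.
Let p0 : 0 < p. Proof. exact: lt_le_trans hl12. Qed.
Let q1 : q < 1. Proof. exact: le_lt_trans hl12 hl2. Qed.
Let mu0 : 0 < mu. Proof. by rewrite divr_gt0// ltr_pwDl// ltW. Qed.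
Let mu1 : mu < 1. Proof. by rewrite /mu ltr_pdivrMr//; have := hl2; rewrite -/p; lra. Qed.
Let sg0 : sg 0 = 0. Proof. by case: sgg. Qed.
Let sgp t : 0 <= t -> 0 <= sg t. Proof. by case: sgg => _ H _ _; exact: H. Qed.
Let sgle s t : 0 <= s -> s <= t -> sg s <= sg t. Proof. by case: sgg => _ _ H _; exact: H. Qed.

Let th1 : 1 <= p / q. Proof. by rewrite ler_pdivlMr// mul1r. Qed.
Let qk k : 0 <= q ^+ k. Proof. by apply: exprn_ge0; exact: normr_ge0. Qed.
Let sg_th k : sg (q ^+ k) <= (p / q) ^+ k * sg (q ^+ k).
Proof. by rewrite ler_peMl ?sgp// exprn_ege1. Qed.

Let summ_mu : summ (fun k => sg (mu ^+ k)).
Proof.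
apply: (@summ_geometric_scale R sg q mu sgg); [by rewrite hl1|by rewrite mu0|].
exact: summ_le sg_th summ_q.
Qed.

(** Smallness of [sg] near 0 is not part of [gauge]; it follows from the summability. *)
Let sgs e : 0 < e -> exists2 t, 0 < t & sg t <= e.
Proof.
move=> e0; have [|N NP] := summ_small _ summ_q e0.
  by move=> k; rewrite mulr_ge0 ?sgp// exprn_ge0// divr_ge0.
by exists (q ^+ N); [rewrite exprn_gt0|rewrite (le_trans (sg_th N))// NP].
Qed.

Let sgs' B : 0 <= B -> exists2 t, 0 < t & B * sg t <= 1.
Proof.
move=> B0; have B1 : 0 < (B + 1)^-1 by rewrite invr_gt0 ltr_wpDl.
have [t t0 te] := sgs B1; exists t => //.
apply: (@le_trans _ _ ((B + 1) * sg t)); first by rewrite ler_wpM2r ?lerDl ?sgp ?(ltW t0).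
by rewrite mulrC -ler_pdivlMr ?div1r// ltr_wpDl.
Qed.

Lemma contraction_radius (r C : R) x : F 0 = 0 -> C1_ball F (jacobian F) r -> 0 <= C ->
  (forall x y, `|x| < r -> `|y| < r -> `|'J F x - 'J F y| <= C * sg `|x - y|) ->
  4 * C * sg r <= 1 - p -> `|x| < r -> `|F x| <= mu * `|x|.
Proof.
move=> F0 FJ C0 Fs Cr xr; have r0 : 0 <= r by rewrite (le_trans _ (ltW xr)).
have z0 : `|0 : 'rV[R]_2| < r by rewrite normr0 (le_lt_trans _ xr).
apply: (C1_ball_contract hl12 F0 FJ _ xr) => z zr.
rewrite -JF0 (le_trans (Fs _ _ zr z0))// subr0.
rewrite (@le_trans _ _ (C * sg r))//; first by rewrite ler_wpM2l// sgle// ltW.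
by rewrite ler_pdivlMr//; rewrite mulrC mulrA.
Qed.

Theorem linearizable_of_summ : locally_C1_linearizable F.
Proof.
have [G [rF [rG [C [[rF0 rF2 rG0 C0] [F0 G0 FJ GJ] [GF GrF JGF JGC] Fs Gs]]]]] :=
  C1w_extract sgg wsg Fw.
have p1 : 0 < 1 - p by rewrite subr_gt0.
have z0 : `|0 : 'rV[R]_2| < rF by rewrite normr0.
have JFL x : `|x| < rF -> `|'J F x - diag2 l1 l2| <= C * sg `|x|.
  by move=> xr; have := Fs _ _ xr z0; rewrite subr0 JF0.
have pk k : 0 < mu ^+ k by rewrite exprn_gt0.
have q0 : 0 < q by [].
(* When [|l1| = |l2|] the weight [(p / q)^k] is 1, so the bound [C sg (mu^k)] on the coupling for
   the zero curve is already summable. *)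
move: hl12; rewrite le_eqVlt => /orP[/eqP qp|qp].
  have B0 : 0 <= C + 4 * C / (1 - p) by rewrite addr_ge0// divr_ge0 ?mulr_ge0// ltW.
  have [t t0 te] := sgs' B0.
  pose r := Num.min rF t; have r0 : 0 < r by rewrite lt_min rF0.
  have rrF : r <= rF by rewrite ge_min lexx.
  have Br : (C + 4 * C / (1 - p)) * sg r <= 1.
    by rewrite (le_trans _ te)// ler_wpM2l// sgle ?(ltW r0)// ge_min lexx orbT.
  have Cq0 : 0 <= 4 * C / (1 - p) * sg r by rewrite mulr_ge0 ?divr_ge0 ?mulr_ge0 ?sgp ?(ltW p1) ?(ltW r0).
  have CS0 : 0 <= C * sg r by rewrite mulr_ge0 ?sgp ?(ltW r0).
  have FJr := C1_ball_le rrF FJ.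
  have Fsr x y : `|x| < r -> `|y| < r -> `|'J F x - 'J F y| <= C * sg `|x - y|.
    by move=> xr yr; apply: Fs; exact: lt_le_trans rrF.
  have C4 : 4 * C * sg r <= 1 - p.
    have : 4 * C / (1 - p) * sg r <= 1 by move: Br CS0; rewrite mulrDl; lra.
    by rewrite mulrAC ler_pdivrMr// mul1r.
  have Fmu x : `|x| < r -> `|F x| <= mu * `|x| by exact: contraction_radius F0 FJr C0 Fsr C4.
  have r1 : r <= 1 by rewrite (le_trans rrF)// (le_trans rF2)// invf_le1// ler1n.
  apply: (@linearizable_of_coupling R l1 l2 hl1 hl12 F (jacobian F) r r0 r1 F0 FJr
    mu sg C mu0 mu1 Fmu sg0 sgp sgle C0 _ summ_mu _ (cst 0) (cst 0) _ _ _ _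
    (fun k => C * sg (mu ^+ k))) => //.
  - by move=> x xr; apply: JFL; exact: lt_le_trans rrF.
  - move=> s /andP[s0 sr]; move: Br Cq0; rewrite mulrDl.
    have : C * sg s <= C * sg r by rewrite ler_wpM2l// sgle// ltW.
    lra.
  - by move=> s _; exact: cst_continuous.
  - by move=> s _ /=; rewrite normr0 mulr_ge0 ?sgp.
  - by move=> k; rewrite mulr_ge0 ?sgp// ltW.
  - rewrite qp divff ?gt_eqF//; apply: summ_le (summZ C0 summ_mu) => k.
    by rewrite expr1n mul1r.
  - move=> k x xr; have [xk xkr] := iter_contract k (introT andP (conj mu0 mu1)) Fmu xr.
    rewrite /coupling /= mul0r add0r mul0r subr0.
    have := mx_norm_ge ('J F (iter k F x) - diag2 l1 l2) 1 0.
    rewrite diag2E !mxE /= subr0 -diag2E => /le_trans; apply.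
    rewrite (le_trans (JFL _ (lt_le_trans xkr rrF)))// ler_wpM2l// sgle//.
    by rewrite (le_trans xk)// ler_piMr ?(ltW (pk k))// (le_trans (ltW xr)).
have [nu [k [nu1 nul nuk qk1 sgnu]]] := expansion qp.
have l10 : l1 != 0 by rewrite -normr_gt0.
have l20 : l2 != 0 by rewrite -normr_gt0.
have JG0 : 'J G 0 = mx2 l1^-1 0 0 l2^-1.
  have z0' : `|0 : 'rV[R]_2| < rG by rewrite normr0.
  have := JGF _ z0'; rewrite G0 JF0 diag2E => E.
  have LI : mx2 l1 0 0 l2 *m mx2 l1^-1 0 0 l2^-1 = 1%:M.
    by apply: eq_mx2; rewrite mulmx2E !mxE /= ?mulfV ?mulr0 ?mul0r ?addr0 ?add0r.
  by rewrite -['J G 0]mulmx1 -LI mulmxA E mul1mx.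
have [h [h' [d [K [d0 K0 [Dh h1 hK h0 h'0] inv]]]]] :=
  @weak_curve R l1 l2 G (jacobian G) rG C sg c0 nu k hl1 p0 rG0 G0 GJ JG0 C0 sgg sgs
    c00 sgc Gs nu1 nul nuk qk1 sgnu.
(* One smallness condition on [r] covers three: [C + K] for [linearizable_of_coupling], [4 C q] for
   [height_contract], and the last summand for the contraction by [mu]. *)
pose B := C + K + 4 * C * q + 4 * C / (1 - p).
have Bq0 : 0 <= 4 * C * q by rewrite !mulr_ge0// ltW.
have Bp0 : 0 <= 4 * C / (1 - p) by rewrite divr_ge0 ?mulr_ge0// ltW.
have B0 : 0 <= B by rewrite /B !addr_ge0.
have [t t0 te] := sgs' B0.
pose r := Num.min (Num.min rF rG) (Num.min d t).
have r0 : 0 < r by rewrite !lt_min rF0 rG0 d0.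
have [rrF [rrG [rd rt]]] : r <= rF /\ r <= rG /\ r <= d /\ r <= t.
  by rewrite /r !ge_min !lexx !orbT.
have S0 : 0 <= sg r by rewrite sgp// ltW.
have Br : B * sg r <= 1.
  by rewrite (le_trans _ te)// ler_wpM2l// sgle// ltW.
have [Br1 [Br2 Br3]] : (C + K) * sg r <= 1 /\ 4 * C * q * sg r <= 1 /\ 4 * C / (1 - p) * sg r <= 1.
  have a1 := mulr_ge0 C0 S0; have a2 := mulr_ge0 K0 S0; have a3 := mulr_ge0 Bq0 S0.
  have a4 := mulr_ge0 Bp0 S0; move: Br; rewrite /B !mulrDl. split; [|split]; lra.
have FJr := C1_ball_le rrF FJ.
have Fsr x y : `|x| < r -> `|y| < r -> `|'J F x - 'J F y| <= C * sg `|x - y|.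
  by move=> xr yr; apply: Fs; exact: lt_le_trans rrF.
have C4 : 4 * C * sg r <= 1 - p by move: Br3; rewrite mulrAC ler_pdivrMr// mul1r.
have Fmu x : `|x| < r -> `|F x| <= mu * `|x| by exact: contraction_radius F0 FJr C0 Fsr C4.
have F1 x : `|x| < r -> `|F x| <= `|x|.
  by move=> xr; rewrite (le_trans (Fmu _ xr))// ler_piMl// ltW.
have r2 : r <= 2^-1 by rewrite (le_trans rrF).
have r1 : r <= 1 by rewrite (le_trans r2)// invf_le1// ler1n.
pose M := `|'J F 0| + C * sg rF.
have JM z : `|z| < rF -> `|'J F z| <= M.
  move=> zr; rewrite -(subrK ('J F 0) ('J F z)) (le_trans (ler_normD _ _))// addrC lerD2l.
  by rewrite (le_trans (Fs _ _ zr z0))// subr0 ler_wpM2l// sgle// ltW.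
have M0 : 0 <= M by rewrite (le_trans _ (JM 0 z0)).
have [S SP] := summ_mu.
pose M4 := expR (4 * C * q * S).
have M40 : 0 <= M4 by exact: expR_ge0.
have iterF i x (xr : `|x| < r) := @iter_contract R _ F r mu x i (introT andP (conj mu0 mu1)) Fmu xr.
(* The corrections to the rate [q] are summable along an orbit, so the normalized heights stay
   bounded by [prod_bound]. *)
have hgt i x : `|x| < r -> `|height h (iter i F x)| <= M4 * q ^+ i.
  move=> xr; pose X j := `|height h (iter j F x)| / q ^+ j.
  suff : X i <= M4 by rewrite /X ler_pdivrMr// exprn_gt0.
  have e0 j : 0 <= 4 * C * q * sg (mu ^+ j) by rewrite mulr_ge0// sgp// ltW.
  have X0 j : 0 <= X j by rewrite divr_ge0.
  have XS j : X j.+1 <= (1 + 4 * C * q * sg (mu ^+ j)) * X j.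
    have [xj xjr] := iterF j x xr.
    have H := @height_contract R l1 l2 hl1 F G (jacobian G) rF rG C sg C0 sgg GJ GF Gs JG0
      h h' d Dh h1 h0 inv r rrF rrG rd Br2 F1 (iter j F x) xjr.
    rewrite /X exprS ler_pdivrMr ?mulr_gt0 ?exprn_gt0// (le_trans H)//.
    rewrite (_ : _ * (q * q ^+ j) = q * (1 + 4 * C * q * sg (mu ^+ j)) * `|height h (iter j F x)|); last first.
      by field; rewrite expf_neq0// gt_eqF.
    rewrite ler_wpM2r// ler_wpM2l ?(ltW q0)// lerD2l ler_wpM2l// sgle//.
    by rewrite (le_trans xj)// ler_piMr ?(ltW (pk j))// (le_trans (ltW xr)).
  apply: (le_trans (prod_bound X0 e0 XS i)); rewrite -[leRHS]mul1r.
  apply: ler_pM; [exact: X0|exact: expR_ge0| |].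
    rewrite /X expr0 divr1 /= /height.
    have a1 := mx_norm_ge x 0 0; have a2 := mx_norm_ge x 0 1.
    have a3 := MVT_lip Dh h1 0 (x 0 1); rewrite h0 !subr0 mul1r in a3.
    rewrite (le_trans (ler_normB _ _))//; move: xr r2; lra.
  by rewrite ler_expR -mulr_sumr ler_wpM2l.
pose A := (2 * M * K + 4 * C) * ((4 * C * q + 1) * (M4 + 1)).
have A1 : 0 <= 2 * M * K + 4 * C by rewrite addr_ge0 ?mulr_ge0.
have A2 : 0 <= 4 * C * q + 1 by rewrite addr_ge0.
have A0 : 0 <= A by rewrite !mulr_ge0// addr_ge0.
have CK0 : 0 <= C + K by rewrite addr_ge0.
apply: (@linearizable_of_coupling R l1 l2 hl1 hl12 F (jacobian F) r r0 r1 F0 FJr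
    mu sg (C + K) mu0 mu1 Fmu sg0 sgp sgle CK0 _ summ_mu _ h h' h0 _ _ _
    (fun k => A * sg (q ^+ k))) => //.
- by move=> x xr; rewrite (le_trans (JFL _ (lt_le_trans xr rrF)))// ler_wpM2r ?sgp// lerDl//.
- by move=> s /andP[s0 sr]; rewrite (le_trans _ Br1)// ler_wpM2l// sgle// ltW.
- move=> s _; apply: (continuous_normP _ _).2 => e e0.
  have K1 : 0 < K + 1 by rewrite ltr_wpDl.
  have [x x0 xe] := sgs (divr_gt0 e0 K1); exists x => // y yx.
  rewrite (le_trans (hK _ _))//; apply: (@le_trans _ _ ((K + 1) * sg x)).
    by rewrite ler_pM ?sgp ?lerDl// sgle// ltW.
  by rewrite mulrC -ler_pdivlMr.
- move=> s _; have := hK s 0; rewrite h'0 !subr0 => /le_trans; apply.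
  by rewrite ler_wpM2r ?sgp// lerDr.
- by move=> i; rewrite mulr_ge0// sgp.
- apply: summ_le (summZ A0 summ_q) => i; by rewrite mulrCA.
move=> i x xr; have [xi xir] := iterF i x xr.
have H := @coupling_bound R l1 l2 hl1 F G (jacobian F) (jacobian G) rF rG C sg C0 sgg GJ GF GrF
  JGF JGC Fs Gs JG0 h h' d K K0 Dh h1 hK h0 inv r rrF rrG rd Br2 F1 M (iter i F x) JM xir.
apply: (le_trans H); rewrite /A -[leRHS]mulrA ler_wpM2l// -[leRHS]mulrA ler_wpM2l//.
by apply: sg_dist => //; exact: hgt.
Qed.

End Sufficiency.

(** * The non-linearizable map *)

Section Bump.
Variable R : realType.

Definition C11 (f f' : R -> R) (B : R) :=
  [/\ forall x : R, is_derive x 1 f (f' x), forall x, `|f x| <= B, forall x, `|f' x| <= B &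
      forall x y, `|f' x - f' y| <= B * `|x - y|].

(** The factor [min 1 |y - x|] is the one that becomes [w] after rescaling by [q^k], see [w_min]. *)
Lemma C11_rem f f' B x y : C11 f f' B ->
  `|f y - f x - f' x * (y - x)| <= 2 * B * Num.min 1 `|y - x| * `|y - x|.
Proof.
move=> [Df fB f'B f'L]; rewrite [f' x * _]mulrC.
have B0 : 0 <= B by rewrite (le_trans _ (fB 0)).
apply: (MVT_bound (fun z _ => Df z)) => z zxy.
have zx : `|z - x| <= `|y - x|.
  move: zxy; case: (leP x y) => xy /andP[? ?]; rewrite ler_norml.
    by rewrite [`|y - x|]ger0_norm ?subr_ge0//; apply/andP; split; lra.
  by rewrite [`|y - x|]ltr0_norm ?subr_lt0//; apply/andP; split; lra.
have H1 : `|f' z - f' x| <= 2 * B.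
  by rewrite (le_trans (ler_normB _ _))// mulr_natl mulr2n lerD.
have H2 : `|f' z - f' x| <= B * `|y - x| by rewrite (le_trans (f'L _ _))// ler_wpM2l.
have yx : 0 <= `|y - x| by [].
have [_|_] := leP 1 `|y - x|; first by rewrite mulr1.
by rewrite (le_trans H2)// ler_wpM2r// mulr_natl mulr2n lerDl.
Qed.

Lemma C11_lip f f' B x y : C11 f f' B -> `|f y - f x| <= 2 * B * Num.min 1 `|y - x|.
Proof.
move=> [Df fB f'B f'L].
have B0 : 0 <= B by rewrite (le_trans _ (fB 0)).
have H1 : `|f y - f x| <= 2 * B.
  by rewrite (le_trans (ler_normB _ _))// mulr_natl mulr2n lerD.
have H2 := MVT_lip Df f'B x y.
have [_|_] := leP 1 `|y - x|; first by rewrite mulr1.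
by rewrite (le_trans H2)// ler_wpM2r// mulr_natl mulr2n lerDl.
Qed.

Lemma C11_dlip f f' B x y : C11 f f' B -> `|f' y - f' x| <= 2 * B * Num.min 1 `|y - x|.
Proof.
move=> [Df fB f'B f'L].
have B0 : 0 <= B by rewrite (le_trans _ (fB 0)).
have H1 : `|f' y - f' x| <= 2 * B.
  by rewrite (le_trans (ler_normB _ _))// mulr_natl mulr2n lerD.
have [_|_] := leP 1 `|y - x|; first by rewrite mulr1.
by rewrite (le_trans (f'L _ _))// ler_wpM2r// mulr_natl mulr2n lerDl.
Qed.

Let m (v : R) := Num.max 0 (1 - v ^+ 2).

Let m01 v : 0 <= m v <= 1.
Proof.
rewrite /m; have := sqr_ge0 v; case: (leP 0 (1 - v ^+ 2)) => *; apply/andP; split; lra.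
Qed.

Let m_out v : 1 <= `|v| -> m v = 0.
Proof.
move=> v1; apply: max_l; rewrite -real_normK ?num_real// subr_le0.
by rewrite -[leLHS](expr1n _ 2) lerXn2r// nnegrE.
Qed.

Let m_lip x y : `|m x - m y| <= 2 * `|x - y|.
Proof.
wlog xy : x y / `|x| <= `|y| => [H|].
  case/orP: (le_total `|x| `|y|) => [/H//|/H]; by rewrite distrC [`|y - x|]distrC.
have [y1|/ltW y1] := leP 1 `|y|.
  rewrite (m_out y1) subr0; have /andP[m0 _] := m01 x; rewrite ger0_norm//.
  have [x1|/ltW x1] := leP 1 `|x|; first by rewrite m_out// mulr_ge0.
  have xx : m x <= 2 * (1 - `|x|).
    rewrite /m -real_normK ?num_real//; have x0 : 0 <= `|x| by [].
    by case: (leP 0 (1 - `|x| ^+ 2)) => _; rewrite ?expr2; nra.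
  have := lerB_dist y x; rewrite distrC => H.
  by apply: (le_trans xx); rewrite ler_wpM2l//; lra.
have x1 : `|x| <= 1 by exact: le_trans y1.
have sq (z : R) : `|z| <= 1 -> z ^+ 2 <= 1.
  by move=> z1; rewrite -real_normK ?num_real// -[leRHS](expr1n _ 2) lerXn2r// nnegrE.
rewrite /m !max_r ?subr_ge0 ?sq//.
rewrite (_ : _ - _ = (y + x) * (y - x)); last by ring.
rewrite normrM [`|y - x|]distrC ler_wpM2r// (le_trans (ler_normD _ _))//; lra.
Qed.

Let mul_lip (g : R -> R) L : 0 <= L -> (forall v, `|g v| <= 1) -> (forall v, 1 <= `|v| -> g v = 0) ->
  (forall x y, `|g x - g y| <= L * `|x - y|) ->
  [/\ forall v, `|v * g v| <= 1, forall v, 1 <= `|v| -> v * g v = 0 &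
      forall x y, `|x * g x - y * g y| <= (1 + L) * `|x - y|].
Proof.
move=> L0 g1 gout gL; split.
- move=> v; have [v1|/ltW v1] := leP 1 `|v|; first by rewrite gout// mulr0 normr0.
  by rewrite normrM mulr_ile1.
- by move=> v v1; rewrite gout// mulr0.
have H (x y : R) : `|x| <= 1 -> `|x * g x - y * g y| <= (1 + L) * `|x - y|.
  move=> x1; rewrite (_ : _ - _ = (x - y) * g y + x * (g x - g y)); last by ring.
  rewrite [leRHS]mulrDl mul1r (le_trans (ler_normD _ _))// lerD// normrM.
    by rewrite ler_piMr.
  by rewrite (le_trans _ (gL x y))// ler_piMl.
move=> x y; have [x1|/ltW x1] := leP `|x| 1; first exact: H.
have [y1|/ltW y1] := leP `|y| 1; first by rewrite distrC [`|x - y|]distrC H.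
by rewrite !gout// !mulr0 subrr normr0 mulr_ge0// addr_ge0.
Qed.

Definition bump (v : R) := Num.max 0 (1 - v ^+ 2) ^+ 2.
Definition dbump (v : R) := 2 * Num.max 0 (1 - v ^+ 2) * (- (2 * v)).

Lemma bump_out v : 1 <= `|v| -> bump v = 0 /\ dbump v = 0.
Proof.
by move=> /m_out; rewrite /m /bump /dbump => ->; rewrite expr0n mulr0 mul0r.
Qed.

Lemma bump_ge0 v : 0 <= bump v.
Proof. exact: sqr_ge0. Qed.

Lemma bump_half v : `|v| <= 2^-1 -> 2^-1 <= bump v.
Proof.
move=> v1; have v2 : v ^+ 2 <= 4^-1.
  rewrite -real_normK ?num_real// (_ : 4^-1 = 2^-1 ^+ 2 :> R); last by field.
  by rewrite lerXn2r// nnegrE.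
rewrite /bump max_r; last by lra.
by rewrite expr2; nra.
Qed.

Lemma bump_C11 : C11 bump dbump 12.
Proof.
have g1 v : `|m v| <= 1 by have /andP[? ?] := m01 v; rewrite ger0_norm.
have [n1 nout nL] := mul_lip (ler0n R 2) g1 m_out m_lip.
have dE v : dbump v = - 4 * (v * m v) by rewrite /dbump -/(m v); ring.
split.
- move=> x; have H : is_derive x 1 (fun v : R => 1 - v ^+ 2) (- (2 * x)).
    have H2 : is_derive x 1 (fun v : R => v ^+ 2) (2 * x).
      have := @is_deriveX R R id 2 x 1 1 (is_derive_id x 1).
      by move=> H; apply: (is_derive_eq H); rewrite [_ *: _]mulr1 expr1 mulr_natl.
    have := is_deriveB (is_derive_cst (1 : R) x (1 : R)) H2.
    by move=> H'; apply: (is_derive_eq H'); rewrite sub0r.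
  exact: (@is_derive1_comp R (fun t => Num.max 0 t ^+ 2) (fun v => 1 - v ^+ 2) x _ _
    (is_derive_posqr (1 - x ^+ 2)) H).
- move=> x; rewrite /bump -/(m x) normrX; have := g1 x; have : 0 <= `|m x| by [].
  by rewrite expr2; nra.
- move=> x; rewrite dE normrM normrN normr_nat; have := n1 x; lra.
- move=> x y; rewrite !dE -mulrBr normrM normrN normr_nat.
  by have := nL x y; lra.
Qed.

Lemma scaled_bump_C11 (c : R) : 0 < c <= 1 ->
  C11 (fun u => bump (u / c)) (fun u => dbump (u / c) / c) (12 / c ^+ 2).
Proof.
move=> /andP[c0 c1]; have [Db b1 d1 dL] := bump_C11.
have ci : 1 <= c^-1 by rewrite invf_ge1.
have ci0 : 0 <= c^-1 by rewrite invr_ge0 ltW.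
have c2 : c^-1 <= (c ^+ 2)^-1 by rewrite -exprVn expr2 ler_peMr.
split.
- move=> x; have H : is_derive x 1 (fun u : R => u / c) c^-1.
    have -> : (fun u : R => u / c) = c^-1 \*: id by apply/funext => t /=; rewrite mulrC.
    by apply: is_derive_eq; rewrite [_ *: _]mulr1.
  exact: (@is_derive1_comp R bump (fun u => u / c) x _ _ (Db (x / c)) H).
- by move=> x; rewrite (le_trans (b1 _))// ler_peMr// (le_trans ci).
- move=> x; rewrite normrM (ger0_norm ci0) (le_trans (ler_wpM2r ci0 (d1 _)))//.
  by rewrite ler_wpM2l.
- move=> x y; rewrite -mulrBl normrM (ger0_norm ci0) (le_trans (ler_wpM2r ci0 (dL _ _)))//.
  rewrite (_ : x / c - y / c = (x - y) / c); last by ring.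
  rewrite normrM (ger0_norm ci0) le_eqVlt; apply/orP; left; apply/eqP; field.
  by rewrite gt_eqF.
Qed.

(** A compactly supported response, at least [v / 2] for [0 <= v <= 1/2]; this linear growth drives
    the divergence. *)
Definition ramp (v : R) := v * bump v.
Definition dramp (v : R) := bump v + v * dbump v.

Lemma ramp_C11 : C11 ramp dramp 100.
Proof.
have g1 v : `|m v| <= 1 by have /andP[? ?] := m01 v; rewrite ger0_norm.
have [n1 nout nL] := mul_lip (ler0n R 2) g1 m_out m_lip.
have [//|k1 kout kL] := mul_lip (L := 1 + 2) _ n1 nout nL.
have [Db b1 d1 dL] := bump_C11.
have dE v : dramp v = bump v - 4 * (v * (v * m v)) by rewrite /dramp /dbump -/(m v); ring.
split.
- move=> x; have H := is_deriveM (is_derive_id x 1) (Db x).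
  by apply: (is_derive_eq H); rewrite /dramp [_ *: 1]mulr1 addrC.
- move=> x; rewrite /ramp; have [x1|/ltW x1] := leP 1 `|x|.
    by rewrite (bump_out x1).1 mulr0 normr0.
  rewrite normrM; have := b1 x; have : 0 <= `|bump x| by []; have : 0 <= `|x| by []; nra.
- move=> x; rewrite dE (le_trans (ler_normB _ _))// [`|4 * _|]normrM normr_nat.
  by have := b1 x; have := k1 x; lra.
- move=> x y; rewrite !dE.
  have H1 := MVT_lip Db d1 y x; have H2 := kL x y.
  rewrite (_ : _ - _ = (bump x - bump y) - 4 * (x * (x * m x) - y * (y * m y))); last by ring.
  rewrite (le_trans (ler_normB _ _))// [`|4 * _|]normrM normr_nat; have : 0 <= `|x - y| by []; lra.
Qed.

Lemma ramp_out v : 1 <= `|v| -> ramp v = 0.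
Proof. by move=> /bump_out[v0 _]; rewrite /ramp v0 mulr0. Qed.

End Bump.

Section ProductRemainder.
Variables (R : realType) (ka ka' be be' : R -> R) (B : R).
Hypotheses (kC : C11 ka ka' B) (bC : C11 be be' B).

Let B0 : 0 <= B. Proof. by case: kC => _ H _ _; rewrite (le_trans _ (H 0)). Qed.
Let kaB x : `|ka x| <= B. Proof. by case: kC. Qed.
Let ka'B x : `|ka' x| <= B. Proof. by case: kC. Qed.
Let beB x : `|be x| <= B. Proof. by case: bC. Qed.
Let be'B x : `|be' x| <= B. Proof. by case: bC. Qed.

Let min_le (d e : R) : d <= e -> 2 * B * Num.min 1 d <= 2 * B * Num.min 1 e.
Proof.
by move=> de; rewrite ler_wpM2l ?mulr_ge0// le_min ge_min lexx /= ge_min de orbT.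
Qed.

Lemma prod_rem u v u' v' d : `|u' - u| <= d -> `|v' - v| <= d ->
  `|ka u' * be v' - ka u * be v - ka' u * be v * (u' - u) - ka u * be' v * (v' - v)|
    <= 6 * B ^+ 2 * Num.min 1 d * d.
Proof.
move=> ud vd; have d0 : 0 <= d by rewrite (le_trans _ ud).
pose m := 2 * B * Num.min 1 d.
have m0 : 0 <= m by rewrite !mulr_ge0// le_min ler01.
rewrite (_ : _ - _ = (ka u' - ka u - ka' u * (u' - u)) * be v' +
  ka' u * (u' - u) * (be v' - be v) + ka u * (be v' - be v - be' v * (v' - v))); last by ring.
have H1 : `|(ka u' - ka u - ka' u * (u' - u)) * be v'| <= m * d * B.
  rewrite normrM ler_pM// (le_trans (C11_rem _ _ kC))// ler_pM ?min_le//.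
  by rewrite !mulr_ge0// le_min ler01 /=.
have H2 : `|ka' u * (u' - u) * (be v' - be v)| <= B * d * m.
  by rewrite normrM normrM ler_pM ?mulr_ge0// ?ler_pM// (le_trans (C11_lip _ _ bC))// min_le.
have H3 : `|ka u * (be v' - be v - be' v * (v' - v))| <= B * (m * d).
  rewrite normrM ler_pM// (le_trans (C11_rem _ _ bC))// ler_pM ?min_le//.
  by rewrite !mulr_ge0// le_min ler01 /=.
rewrite (le_trans (ler_normD _ _))// (le_trans (lerD (ler_normD _ _) (lexx _)))//.
rewrite (le_trans (lerD (lerD H1 H2) H3))//.
by rewrite /m le_eqVlt; apply/orP; left; apply/eqP; ring.
Qed.

Lemma prod_lip (f g : R -> R) (u v u' v' d : R) : (forall x, `|f x| <= B) -> (forall x, `|g x| <= B) ->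
  (forall x y, `|f y - f x| <= 2 * B * Num.min 1 `|y - x|) ->
  (forall x y, `|g y - g x| <= 2 * B * Num.min 1 `|y - x|) ->
  `|u' - u| <= d -> `|v' - v| <= d ->
  `|f u' * g v' - f u * g v| <= 4 * B ^+ 2 * Num.min 1 d.
Proof.
move=> fB gB fL gL ud vd.
rewrite (_ : _ - _ = (f u' - f u) * g v' + f u * (g v' - g v)); last by ring.
have H1 : `|(f u' - f u) * g v'| <= 2 * B * Num.min 1 d * B.
  by rewrite normrM ler_pM// (le_trans (fL _ _))// min_le.
have H2 : `|f u * (g v' - g v)| <= B * (2 * B * Num.min 1 d).
  by rewrite normrM ler_pM// (le_trans (gL _ _))// min_le.
rewrite (le_trans (ler_normD _ _))// (le_trans (lerD H1 H2))//.
by rewrite le_eqVlt; apply/orP; left; apply/eqP; ring.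
Qed.

End ProductRemainder.

(** * The perturbed map and its regularity *)

Section Map.
Variables (R : realType) (w : R -> R) (l1 l2 : R).
Hypotheses (hw : modulus_of_continuity w)
  (hl1 : 0 < `|l1|) (hl12 : `|l1| <= `|l2|) (hl2 : `|l2| < 1).

Let q := `|l1|.
Let p := `|l2|.
Let th := p / q.
Let q0 : 0 < q. Proof. by []. Qed.
Let p0 : 0 < p. Proof. exact: lt_le_trans hl12. Qed.
Let q1 : q < 1. Proof. exact: le_lt_trans hl12 hl2. Qed.
Let l10 : l1 != 0. Proof. by rewrite -normr_gt0. Qed.
Let l20 : l2 != 0. Proof. by rewrite -normr_gt0. Qed.
Let wg : gauge w. Proof. exact: modulus_gauge. Qed.
Let w0 t : 0 <= t -> 0 <= w t. Proof. by case: wg => _ H _ _; exact: H. Qed.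
Let th0 : 0 < th. Proof. exact: divr_gt0. Qed.
Let th1 : 1 <= th. Proof. by rewrite ler_pdivlMr// mul1r. Qed.

(* Half-width of the strips [|x1 / l1^k - 1| < c] carrying the perturbation:
   small enough for the strips to be pairwise disjoint. *)
Definition strip_c := (1 - q) / 2.
(* Large enough for the orbit of [(l1^N, l2^N (b + s))] to miss the support of
   the perturbation in every strip but the one it is meant to visit. *)
Definition strip_b := 2 / (1 - p).
Let c := strip_c.
Let b := strip_b.
Let c01 : 0 < c <= 1.
Proof. by rewrite /c /strip_c; have := q1; have := q0; move=> *; apply/andP; split; lra. Qed.

Let B := 12 / c ^+ 2 + 100.
Let ka (u : R) := bump (u / c).
Let ka' (u : R) := dbump (u / c) / c.

Let C11_le f f' A A' : A <= A' -> C11 f f' A -> @C11 R f f' A'.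
Proof.
move=> AA [Df f1 f2 f3]; split=> // [x|x|x y]; rewrite ?(le_trans (f1 x)) ?(le_trans (f2 x))//.
by rewrite (le_trans (f3 x y))// ler_wpM2r.
Qed.

Let kaC : C11 ka ka' B.
Proof. by apply: C11_le (scaled_bump_C11 c01); rewrite lerDl. Qed.

Let raC : C11 (@ramp R) (@dramp R) B.
Proof.
apply: C11_le (ramp_C11 R); rewrite lerDr divr_ge0// exprn_ge0//.
by case/andP: c01 => /ltW.
Qed.

Let ka_out u : c <= `|u| -> ka u = 0 /\ ka' u = 0.
Proof.
move=> cu; have cp : 0 < c by case/andP: c01.
have [H1 H2] : bump (u / c) = 0 /\ dbump (u / c) = 0.
  by apply: bump_out; rewrite normrM normfV (gtr0_norm cp) ler_pdivlMr// mul1r.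
by rewrite /ka /ka' H1 H2 mul0r.
Qed.

(** Deviations from the point [(l1^k, b l2^k)], measured in units of size [q^k] in both coordinates:
    for [X2] because [th^k / p^k = q^-k]. *)
Let X1 k (x : 'rV[R]_2) := x 0 0 / l1 ^+ k - 1.
Let X2 k (x : 'rV[R]_2) := (x 0 1 / l2 ^+ k - b) * th ^+ k.

(** Each derivative costs [q^-k], so [D1] and [D2], the partial derivatives, are of order [w(q^k)]
    and vary on the scale [q^k]: the most that a modulus [w] with constants uniform in [k]
    permits. *)
Let T k x := l1 ^+ k.+1 * w (q ^+ k) * (ka (X1 k x) * ramp (X2 k x)).
Let D1 k x := l1 * w (q ^+ k) * (ka' (X1 k x) * ramp (X2 k x)).
Let D2 k x := l1 * (l1 ^+ k * th ^+ k / l2 ^+ k) * w (q ^+ k) * (ka (X1 k x) * dramp (X2 k x)).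

Let qk k : 0 < q ^+ k. Proof. exact: exprn_gt0. Qed.

Let X1_lip k x y : `|X1 k y - X1 k x| <= `|y - x| / q ^+ k.
Proof.
have -> : X1 k y - X1 k x = (y - x) 0 0 / l1 ^+ k by rewrite /X1 !mxE; ring.
by rewrite normrM normfV normrX ler_wpM2r ?invr_ge0 ?(ltW (qk k))// mx_norm_ge.
Qed.

Let X2_lip k x y : `|X2 k y - X2 k x| <= `|y - x| / q ^+ k.
Proof.
have -> : X2 k y - X2 k x = (y - x) 0 1 * (th ^+ k / l2 ^+ k) by rewrite /X2 !mxE; ring.
rewrite normrM (_ : `|th ^+ k / l2 ^+ k| = (q ^+ k)^-1).
  by rewrite ler_wpM2r ?invr_ge0 ?(ltW (qk k))// mx_norm_ge.
rewrite normrM normfV !normrX (gtr0_norm th0) -/p /th expr_div_n; field.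
by rewrite !expf_neq0// gt_eqF.
Qed.

(** Monotonicity for [t >= q^k], concavity below. *)
Let w_min k t : 0 <= t -> w (q ^+ k) * Num.min 1 (t / q ^+ k) <= w t.
Proof.
have [w00 _ wle wC] := wg; move=> t0; have [h|h] := leP 1 (t / q ^+ k).
  by rewrite mulr1 wle ?(ltW (qk k))//; move: h; rewrite ler_pdivlMr// mul1r.
have [->|tn0] := eqVneq t 0; first by rewrite mul0r mulr0 w0.
have tp : 0 < t by rewrite lt_neqAle eq_sym tn0.
have qt : 1 <= q ^+ k / t.
  by rewrite ler_pdivlMr// mul1r; move: h; rewrite ltr_pdivrMr// mul1r => /ltW.
have := wC _ _ qt t0; rewrite divfK// => H.
apply: (le_trans (ler_wpM2r _ H)); first by rewrite divr_ge0// ltW.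
rewrite le_eqVlt; apply/orP; left; apply/eqP; field.
by rewrite tn0 expf_neq0// gt_eqF.
Qed.

Let Cst := 6 * B ^+ 2.
Let B00 : 0 <= B ^+ 2. Proof. exact: sqr_ge0. Qed.

Let T_rem k x y : `|T k y - T k x - D1 k x * (y 0 0 - x 0 0) - D2 k x * (y 0 1 - x 0 1)|
  <= Cst * w `|y - x| * `|y - x|.
Proof.
have H := prod_rem kaC raC (X1_lip k x y) (X2_lip k x y).
have -> : T k y - T k x - D1 k x * (y 0 0 - x 0 0) - D2 k x * (y 0 1 - x 0 1) =
    l1 ^+ k.+1 * w (q ^+ k) * (ka (X1 k y) * ramp (X2 k y) - ka (X1 k x) * ramp (X2 k x) -
    ka' (X1 k x) * ramp (X2 k x) * (X1 k y - X1 k x) -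
    ka (X1 k x) * dramp (X2 k x) * (X2 k y - X2 k x)).
  have E1 : X1 k y - X1 k x = (y 0 0 - x 0 0) / l1 ^+ k by rewrite /X1; ring.
  have E2 : X2 k y - X2 k x = (y 0 1 - x 0 1) * th ^+ k / l2 ^+ k by rewrite /X2; ring.
  rewrite E1 E2 /T /D1 /D2; move: (ka _) (ka _) (ka' _) (ramp _) (ramp _) (dramp _) => *.
  by rewrite exprS; field; rewrite !expf_neq0.
have wk : 0 <= w (q ^+ k) by rewrite w0// ltW.
rewrite normrM normrM (ger0_norm wk) normrX -/q.
apply: (@le_trans _ _ (q ^+ k.+1 * w (q ^+ k) * (6 * B ^+ 2 * Num.min 1 (`|y - x| / q ^+ k) * (`|y - x| / q ^+ k)))).
  by rewrite ler_wpM2l// mulr_ge0// exprn_ge0// ltW.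
rewrite exprS (_ : _ * _ = q * (Cst * (w (q ^+ k) * Num.min 1 (`|y - x| / q ^+ k)) * `|y - x|)); last first.
  by rewrite /Cst; field; rewrite gt_eqF.
have C0 : 0 <= Cst by rewrite mulr_ge0.
rewrite (le_trans _ (_ : Cst * (w (q ^+ k) * Num.min 1 (`|y - x| / q ^+ k)) * `|y - x| <= _))//.
  have M0 : 0 <= Num.min 1 (`|y - x| / q ^+ k) by rewrite le_min ler01 divr_ge0// ltW.
  exact: ler_piMl (mulr_ge0 (mulr_ge0 C0 (mulr_ge0 wk M0)) (normr_ge0 _)) (ltW q1).
by rewrite ler_wpM2r// ler_wpM2l// w_min.
Qed.

Let D_lip k x y : `|D1 k y - D1 k x| <= Cst * w `|y - x| /\
  `|D2 k y - D2 k x| <= Cst * w `|y - x|.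
Proof.
have wk : 0 <= w (q ^+ k) by rewrite w0// ltW.
have [_ kaB ka'B _] := kaC; have [_ raB ra'B _] := raC.
have fin (z u : R) : `|z| = q -> `|u| <= 4 * B ^+ 2 * Num.min 1 (`|y - x| / q ^+ k) ->
    `|z * w (q ^+ k) * u| <= Cst * w `|y - x|.
  move=> zq uB; rewrite normrM normrM (ger0_norm wk) zq.
  apply: (@le_trans _ _ (1 * w (q ^+ k) * (4 * B ^+ 2 * Num.min 1 (`|y - x| / q ^+ k)))).
    by rewrite ler_pM ?mulr_ge0 ?(ltW q0)// ler_wpM2r ?(ltW q1).
  rewrite mul1r mulrCA -[leRHS]mulr1.
  have W := w_min k (normr_ge0 (y - x)); have Wp := w0 (normr_ge0 (y - x)).
  apply: (@le_trans _ _ (4 * B ^+ 2 * w `|y - x|)); first by rewrite ler_wpM2l// mulr_ge0.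
  by rewrite mulr1 /Cst ler_wpM2r// ler_wpM2r// ler_nat.
split.
  rewrite /D1 -mulrBr; apply: fin => //.
  exact: (prod_lip kaC ka'B raB (fun x y => C11_dlip x y kaC) (fun x y => C11_lip x y raC)
    (X1_lip k x y) (X2_lip k x y)).
rewrite /D2 -mulrBr; apply: fin.
  rewrite !normrM normfV !normrX (gtr0_norm th0) -/p -/q /th expr_div_n; field.
  by rewrite !expf_neq0// gt_eqF.
exact: (prod_lip kaC kaB ra'B (fun x y => C11_lip x y kaC) (fun x y => C11_dlip x y raC)
    (X1_lip k x y) (X2_lip k x y)).
Qed.

Let strip_uniq k l x : `|X1 k x| < c -> `|X1 l x| < c -> k = l.
Proof.
wlog kl : k l / (k < l)%N => [H hk hl|].
  by have [kl|lk|//] := ltngtP k l; [exact: H|symmetry; exact: H].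
rewrite /X1; set z := x 0 0 => hk hl; exfalso.
have zk : 1 - c <= `|z / l1 ^+ k|.
  have := ler_distD (z / l1 ^+ k) 1 0; rewrite !subr0 normr1.
  by rewrite [`|1 - _|]distrC; move: hk; lra.
have zl : `|z / l1 ^+ l| < 1 + c.
  by have := ler_normD (z / l1 ^+ l - 1) 1; rewrite subrK normr1; move: hl; lra.
have E : `|z / l1 ^+ k| = `|z / l1 ^+ l| * q ^+ (l - k).
  rewrite -{1}(subnKC (ltnW kl)) exprD !normrM !normfV !normrM !normrX -/q.
  by field; rewrite !expf_neq0// gt_eqF.
have qle : q ^+ (l - k) <= q.
  by rewrite -{2}(expr1 q) ler_wiXn2l ?(ltW q0) ?(ltW q1)// subn_gt0.
have : `|z / l1 ^+ k| <= `|z / l1 ^+ l| * q by rewrite E ler_wpM2l.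
have : `|z / l1 ^+ l| * q <= (1 + c) * q by rewrite ler_wpM2r ?(ltW q0)// ltW.
(* With [c = (1 - q) / 2] this amounts to [(1 - q)^2 > 0]. *)
have c1 : (1 + c) * q < 1 - c.
  by rewrite /c /strip_c; have := sqr_ge0 (1 - q); have := q1; have := q0; rewrite expr2; nra.
lra.
Qed.

Let idx x := xget 0%N [set k | `|X1 k x| < c].

Let idx_out k x : k != idx x -> T k x = 0 /\ D1 k x = 0 /\ D2 k x = 0.
Proof.
move=> ki; suff /ka_out[k0 k0'] : c <= `|X1 k x| by rewrite /T /D1 /D2 k0 k0' !(mul0r, mulr0).
rewrite leNgt; apply/negP => kc; move: ki; rewrite /idx; case: xgetP => [l _ lc|none _].
  by rewrite (strip_uniq kc lc) eqxx.
exact: (none k).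
Qed.

Let f x := T (idx x) x.
Let f1 x := D1 (idx x) x.
Let f2 x := D2 (idx x) x.

(* [f] is the sum of the [T k], of which [T (idx x) x] is the only term that may
   be nonzero; [idx x] is a junk value when they all vanish. *)
Definition resonant_map (x : 'rV[R]_2) := row2 (l1 * x 0 0 + f x) (l2 * x 0 1).
Definition Jresonant_map (x : 'rV[R]_2) := mx2 (l1 + f1 x) 0 (f2 x) l2.

Let Cst0 : 0 <= Cst. Proof. exact: mulr_ge0. Qed.
Let Cst20 : 0 <= 2 * Cst. Proof. exact: mulr_ge0. Qed.

(** If the indices differ, the term of [x] vanishes at [y], and that of [y] vanishes at [x] with its
    derivatives; the two remainders add up, whence the factor 2. *)
Let f_rem x y : `|f y - f x - f1 x * (y 0 0 - x 0 0) - f2 x * (y 0 1 - x 0 1)|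
  <= 2 * Cst * w `|y - x| * `|y - x|.
Proof.
have Wp : 0 <= Cst * w `|y - x| * `|y - x|.
  exact: mulr_ge0 (mulr_ge0 Cst0 (w0 (normr_ge0 _))) (normr_ge0 _).
rewrite /f /f1 /f2; have [E|xy] := eqVneq (idx x) (idx y).
  by rewrite -E (le_trans (T_rem _ _ _))//; lra.
have yx : idx y != idx x by rewrite eq_sym.
have [Tx [D1x D2x]] := idx_out yx; have [Ty _] := idx_out xy.
have R1 := T_rem (idx x) x y; have R2 := T_rem (idx y) x y.
move: R1 R2; rewrite Tx D1x D2x Ty !mul0r !subr0 sub0r => R1 R2.
rewrite (_ : _ - _ = T (idx y) y + (- T (idx x) x - D1 (idx x) x * (y 0 0 - x 0 0) -
  D2 (idx x) x * (y 0 1 - x 0 1))); last by ring.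
by rewrite (le_trans (ler_normD _ _))//; lra.
Qed.

Let f_lip x y : `|f1 y - f1 x| <= 2 * Cst * w `|y - x| /\ `|f2 y - f2 x| <= 2 * Cst * w `|y - x|.
Proof.
have Wp : 0 <= Cst * w `|y - x| by exact: mulr_ge0 Cst0 (w0 (normr_ge0 _)).
rewrite /f1 /f2; have [E|xy] := eqVneq (idx x) (idx y).
  by rewrite -E; have [H1 H2] := D_lip (idx x) x y; split; lra.
have yx : idx y != idx x by rewrite eq_sym.
have [_ [D1x D2x]] := idx_out yx; have [_ [D1y D2y]] := idx_out xy.
have [H1 H2] := D_lip (idx x) x y; have [H3 H4] := D_lip (idx y) x y.
move: H1 H2 H3 H4; rewrite D1x D2x D1y D2y !subr0 !sub0r !normrN => H1 H2 H3 H4.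
by split; rewrite (le_trans (ler_normB _ _))//; lra.
Qed.

(** On the axis [X1 = -1] lies outside every strip, so the junk index does no harm. *)
Let idx_axis z : T (idx (row2 0 z)) (row2 0 z) = 0 /\ D1 (idx (row2 0 z)) (row2 0 z) = 0
  /\ D2 (idx (row2 0 z)) (row2 0 z) = 0.
Proof.
have /ka_out[k0 k0'] : c <= `|X1 (idx (row2 0 z)) (row2 0 z)|.
  by rewrite /X1 mx2E mul0r sub0r normrN normr1; case/andP: c01.
by rewrite /T /D1 /D2 k0 k0' !(mul0r, mulr0).
Qed.

Lemma resonant_map_axis z : resonant_map (row2 0 z) = row2 0 (l2 * z).
Proof. by rewrite /resonant_map /f (idx_axis z).1 !mx2E mulr0 addr0. Qed.

Let row20 : (0 : 'rV[R]_2) = row2 0 0.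
Proof. by apply: eq_row2; rewrite !mxE. Qed.

Lemma resonant_map0 : resonant_map 0 = 0.
Proof. by rewrite row20 resonant_map_axis mulr0. Qed.

Lemma Jresonant_map0 : Jresonant_map 0 = diag2 l1 l2.
Proof.
have [_ [d1 d2]] := idx_axis 0.
by rewrite diag2E /Jresonant_map /f1 /f2 row20 d1 d2 addr0.
Qed.

Lemma Jresonant_map_lip x y :
  `|Jresonant_map y - Jresonant_map x| <= 2 * Cst * w `|y - x|.
Proof.
have [H1 H2] := f_lip x y; have Wp : 0 <= 2 * Cst * w `|y - x| by exact: mulr_ge0 Cst20 (w0 (normr_ge0 _)).
apply: norm_mx2_le; rewrite /Jresonant_map !mxE /= ?subrr ?normr0//.
by rewrite opprD addrACA subrr add0r.
Qed.

Let w_small e : 0 < e -> exists2 t, 0 < t & 2 * Cst * w t <= e.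
Proof.
move=> e0; have C1 : 0 < 2 * Cst + 1 by rewrite ltr_wpDl.
have [t t0 te] := modulus_small hw (divr_gt0 e0 C1); exists t => //.
apply: (@le_trans _ _ ((2 * Cst + 1) * w t)); first by rewrite ler_wpM2r ?w0 ?lerDl// ltW.
by rewrite mulrC -ler_pdivlMr.
Qed.

Lemma resonant_map_jac x : has_jac resonant_map x (Jresonant_map x).
Proof.
move=> e /w_small[t t0 te]; exists t => // y yx.
have -> : resonant_map y - resonant_map x - (y - x) *m Jresonant_map x =
    row2 (f y - f x - f1 x * (y 0 0 - x 0 0) - f2 x * (y 0 1 - x 0 1)) 0.
  by apply: eq_row2; rewrite !mxE sum2E !mxE /=; ring.
have H := f_rem x y; have [_ _ wle _] := wg.
have H2 : 2 * Cst * w `|y - x| * `|y - x| <= e * `|y - x|.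
  by rewrite ler_wpM2r// (le_trans _ te)// ler_wpM2l ?Cst20// wle// ltW.
apply: norm_row2_le; rewrite mxE /=; first exact: le_trans H2.
by rewrite normr0 (le_trans _ H2)// (le_trans _ H).
Qed.

Lemma resonant_map_C1 r : C1_ball resonant_map Jresonant_map r.
Proof.
move=> x _; split; first exact: resonant_map_jac.
move=> e /w_small[t t0 te]; exists t => // y yx; have [_ _ wle _] := wg.
by rewrite (le_trans (Jresonant_map_lip _ _))// (le_trans _ te)// ler_wpM2l ?Cst20// wle// ltW.
Qed.

Lemma resonant_map_J x : 'J resonant_map x = Jresonant_map x.
Proof. by have /has_jacP[_ ->] := resonant_map_jac x. Qed.

Lemma resonant_map_C1w : C1w_diffeo w resonant_map.
Proof.
split.
  apply: (inverse_function (r0 := 1) ltr01 resonant_map0 (@resonant_map_C1 1)).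
  rewrite Jresonant_map0 diag2E unitmxE (_ : \det _ = l1 * l2) ?unitfE ?mulf_neq0//.
  by rewrite (expand_det_row _ 0) sum2E !mx2E mul0r addr0 /cofactor det_mx11 !mxE /= expr0 mul1r.
exists setT, (2 * (2 * Cst) + 1); split; first exact: filterT.
  by rewrite ltr_wpDl// mulr_ge0.
move=> x y _ _; rewrite !resonant_map_J (le_trans (opnorm_le _))//.
apply: (@le_trans _ _ (2 * (2 * Cst * w `|x - y|))).
  by rewrite ler_wpM2l// Jresonant_map_lip.
by rewrite mulrA ler_wpM2r ?w0// lerDl.
Qed.

(** Strips of index [k > j] are missed because [|x1|] is too large for them. As [U] has no upper
    bound, the point may well enter a strip of index [k < j]; there the second coordinate is off the
    support of [ramp], since [p (b + s) <= b - 1]. *)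
Lemma resonant_map_orbit j U s : 0 <= U -> 0 <= s <= 1 ->
  resonant_map (row2 (l1 ^+ j * (1 + U)) (l2 ^+ j * (b + s))) =
  row2 (l1 ^+ j.+1 * (1 + (U + w (q ^+ j) * (bump (U / c) * ramp (s * th ^+ j)))))
       (l2 ^+ j.+1 * (b + s)).
Proof.
move=> U0 /andP[s0 s1]; set x := row2 _ _.
have l1j k : l1 ^+ k != 0 by rewrite expf_neq0.
have l2j k : l2 ^+ k != 0 by rewrite expf_neq0.
have Tj : T j x = l1 ^+ j.+1 * (w (q ^+ j) * (bump (U / c) * ramp (s * th ^+ j))).
  rewrite /T /X1 /X2 /x !mx2E (_ : _ / l1 ^+ j - 1 = U); last by field.
  by rewrite (_ : l2 ^+ j * _ / l2 ^+ j - b = s) ?mulrA//; field.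
suff fE : f x = T j x.
  rewrite /resonant_map fE Tj; apply: eq_row2; rewrite !mx2E !exprS; ring.
have [->//|ji] := eqVneq j (idx x); rewrite (idx_out ji).1 /f; move: ji; set k := idx x.
rewrite neq_ltn => /orP[jk|kj].
  have [k0 _] : ka (X1 k x) = 0 /\ ka' (X1 k x) = 0.
    apply: ka_out; rewrite /X1 /x mx2E.
    have z1 : q^-1 <= `|l1 ^+ j * (1 + U) / l1 ^+ k|.
      have -> : l1 ^+ j * (1 + U) / l1 ^+ k = (1 + U) / l1 ^+ (k - j).
        rewrite -{1}(subnKC (ltnW jk)) exprD invfM mulrACA mulfV// mul1r.
        by [].
      have U1 : 0 <= 1 + U by rewrite addr_ge0.
      rewrite normrM normfV normrX (ger0_norm U1) -/q.
      rewrite -[leLHS]mul1r ler_pM ?invr_ge0 ?(ltW q0) ?lerDl// lef_pV2 ?posrE//.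
      by rewrite -[leRHS]expr1 ler_wiXn2l ?(ltW q0) ?(ltW q1)// subn_gt0.
    have q2 : 1 < q^-1 by rewrite invf_gt1.
    have cq : c <= q^-1 - 1.
      have := mulVf (lt0r_neq0 q0); rewrite /c /strip_c; have := q1; have := q0; nra.
    by rewrite (le_trans cq)// (le_trans _ (lerB_dist _ _))// normr1 lerD2r.
  by rewrite /T k0 mul0r mulr0.
have v1 : 1 <= `|X2 k x|.
  rewrite /X2 /x mx2E normrM normrX (gtr0_norm th0) -[leLHS]mulr1.
  have E : l2 ^+ j * (b + s) / l2 ^+ k = l2 ^+ (j - k) * (b + s).
    by rewrite -{1}(subnKC (ltnW kj)) exprD mulrC -!mulrA mulKf.
  have p1 : 0 < 1 - p by rewrite subr_gt0.
  have bE : b * (1 - p) = 2 by rewrite /b /strip_b divfK// gt_eqF.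
  have bs0 : 0 <= b + s by rewrite addr_ge0// /b /strip_b divr_ge0// ltW.
  have H : l2 ^+ (j - k) * (b + s) <= p * (b + s).
    rewrite ler_wpM2r// (le_trans (ler_norm _))// normrX -/p -[leRHS]expr1.
    by rewrite ler_wiXn2l ?(ltW p0) ?(ltW hl2)// subn_gt0.
  rewrite ler_pM//; last by rewrite exprn_ege1.
  have sp : s * p <= 1 by rewrite mulr_ile1// ltW.
  have pb : p * (b + s) - b <= - 1.
    rewrite (_ : _ - b = s * p - b * (1 - p)); last by ring.
    by rewrite bE (_ : - 1 = 1 - 2 :> R) ?lerD2r// -[2]/(1 + 1) opprD addrA subrr add0r.
  by rewrite E -normrN (le_trans _ (ler_norm _))// lerNr (le_trans _ pb)// lerD2r.
by rewrite /T (ramp_out v1) !mulr0.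
Qed.

End Map.

(** * Divergence along the resonant orbits *)

Section Divergence.
Variables (R : realType) (w : R -> R) (l1 l2 : R).
Hypotheses (hw : modulus_of_continuity w)
  (hl1 : 0 < `|l1|) (hl12 : `|l1| <= `|l2|) (hl2 : `|l2| < 1).

Let q := `|l1|.
Let p := `|l2|.
Let th := p / q.
Let c := strip_c l1.
Let b := strip_b l2.
Let F := resonant_map w l1 l2.
Let p0 : 0 < p. Proof. exact: lt_le_trans hl12. Qed.
Let q1 : q < 1. Proof. exact: le_lt_trans hl12 hl2. Qed.
Let l10 : l1 != 0. Proof. by rewrite -normr_gt0. Qed.
Let w0 t : 0 <= t -> 0 <= w t. Proof. by case: hw => _ H _ _ _; exact: H. Qed.
Let th0 : 0 < th. Proof. exact: divr_gt0. Qed.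
Let c0 : 0 < c. Proof. by rewrite /c /strip_c divr_gt0// subr_gt0. Qed.
Let b0 : 0 < b. Proof. by rewrite /b /strip_b divr_gt0// subr_gt0. Qed.
Let qk k : 0 <= q ^+ k. Proof. by apply: exprn_ge0; exact: normr_ge0. Qed.

Let ramp_ge0 (v : R) : 0 <= v -> 0 <= ramp v.
Proof. by move=> v0; rewrite /ramp mulr_ge0// bump_ge0. Qed.

(* Relative displacement, in the first coordinate, of the orbit of
   [(l1^N, l2^N (b + s))] away from the linear one. *)
Fixpoint drift (N : nat) (s : R) (n : nat) : R :=
  if n is k.+1 then
    drift N s k + w (q ^+ (N + k)) *
      (bump (drift N s k / c) * ramp (s * th ^+ (N + k)))
  else 0.

Let drift_step N s n : 0 <= s -> drift N s n <= drift N s n.+1.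
Proof.
move=> s0 /=; rewrite lerDl; apply: mulr_ge0; first exact: w0.
apply: mulr_ge0; first exact: bump_ge0.
by apply: ramp_ge0; apply: mulr_ge0 => //; apply: exprn_ge0; exact: ltW.
Qed.

Lemma drift_le N s m n : 0 <= s -> (m <= n)%N -> drift N s m <= drift N s n.
Proof.
move=> s0; elim: n => [|n IH]; first by rewrite leqn0 => /eqP->.
rewrite leq_eqVlt => /orP[/eqP->//|/IH H]; exact: le_trans H (drift_step _ _ s0).
Qed.

Lemma drift_ge0 N s n : 0 <= s -> 0 <= drift N s n.
Proof. by move=> s0; have := @drift_le N s 0 n s0 (leq0n n). Qed.

Lemma drift0 N n : drift N 0 n = 0.
Proof. by elim: n => //= n ->; rewrite /ramp !mul0r !mulr0 addr0. Qed.

(** Both smallness conditions propagate to earlier times by monotonicity, and there [bump >= 1/2]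
    and [ramp v >= v / 2]: hence the 1/4. *)
Lemma drift_lower N s m : 0 <= s -> drift N s m <= c / 2 -> s * th ^+ (N + m) <= 2^-1 ->
  s / 4 * (\sum_(i < m) th ^+ (N + i) * w (q ^+ (N + i))) <= drift N s m.
Proof.
move=> s0; elim: m => [|m IH] Dm sm; first by rewrite big_ord0 mulr0.
have Dm' : drift N s m <= c / 2 by rewrite (le_trans _ Dm)//; exact: drift_step.
have e0 : 0 <= s * th ^+ (N + m).
  by apply: mulr_ge0 => //; apply: exprn_ge0; exact: ltW.
have sm' : s * th ^+ (N + m) <= 2^-1.
  rewrite (le_trans _ sm)// ler_wpM2l// addnS exprS ler_peMl//; last first.
    by rewrite ler_pdivlMr// mul1r.
  by apply: exprn_ge0; exact: ltW.
rewrite big_ord_recr /= mulrDr lerD ?IH//.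
have H1 : 2^-1 <= bump (drift N s m / c).
  apply: bump_half; rewrite ger0_norm; last by rewrite divr_ge0 ?drift_ge0// ltW.
  by rewrite ler_pdivrMr// mulrC.
have H2 : s * th ^+ (N + m) / 2 <= ramp (s * th ^+ (N + m)).
  by rewrite /ramp ler_wpM2l// bump_half// ger0_norm.
have E2 : s * th ^+ (N + m) / 2 * 2^-1 <= bump (drift N s m / c) * ramp (s * th ^+ (N + m)).
  by rewrite mulrC ler_pM// divr_ge0.
have := ler_wpM2l (w0 (qk (N + m))) E2; move: (w _) (th ^+ _) => W Th H.
apply: le_trans H; rewrite le_eqVlt; apply/orP; left; apply/eqP.
by field.
Qed.

Let orbit N s n : 0 <= s <= 1 ->
  iter n F (row2 (l1 ^+ N) (l2 ^+ N * (b + s))) =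
  row2 (l1 ^+ (N + n) * (1 + drift N s n)) (l2 ^+ (N + n) * (b + s)).
Proof.
move=> /[dup] s01 /andP[s0 _]; elim: n => [|n IH]; first by rewrite /= addn0 addr0 mulr1.
by rewrite iterS IH addnS /= -resonant_map_orbit// drift_ge0.
Qed.

Let axis n z : iter n F (row2 0 z) = row2 0 (l2 ^+ n * z).
Proof.
elim: n => [|n IH]; first by rewrite /= mul1r.
by rewrite iterS IH /F resonant_map_axis// mulrA -exprS.
Qed.

Let contract : exists2 r, 0 < r & forall x, `|x| < r -> `|F x| <= (1 + p) / 2 * `|x|.
Proof.
have p4 : 0 < (1 - p) / 4 by rewrite divr_gt0// subr_gt0.
have [|_ /(_ _ p4)[d d0 JF]] := resonant_map_C1 hw hl1 hl12 hl2 (r := 1) (x := 0).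
  by rewrite normr0.
exists d => // x; apply: (C1_ball_contract hl12 (resonant_map0 w hl1 hl12 hl2)).
  exact: (resonant_map_C1 hw hl1 hl12 hl2).
by move=> z zd; rewrite -(Jresonant_map0 w hl1 hl12 hl2) JF// subr0.
Qed.


(* The relative displacement of the orbit is read off the first component of a
   linearization [Phi]: dividing by [l1^(N+n)] gives a quantity which does not
   depend on [n] and which is Lipschitz in [s]. *)
Let drift_bound Phi r N : 0 < r -> C1_ball Phi (jacobian Phi) r -> 'J Phi 0 = 1%:M ->
  (forall x, `|x| < r -> `|F x| <= (1 + p) / 2 * `|x|) ->
  (forall x, `|x| < r -> Phi (F x) = Phi x *m diag2 l1 l2) ->
  (forall z, `|z| < r -> `|'J Phi z - 1%:M| <= 4^-1) ->
  p ^+ N * (b + 1) < r ->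
  forall s m, 0 <= s <= 1 -> drift N s m <= 4 * th ^+ N * s.
Proof.
move=> r0 PJ P1 Fr conj P4 Nr.
have mu01 : 0 < (1 + p) / 2 < 1.
  rewrite divr_gt0// ?ltr_pdivrMr// ?mul1r; first by rewrite ltrD2l.
  by rewrite ltr_wpDr// ltW.
have qp N' : q ^+ N' <= p ^+ N' by rewrite lerXn2r// nnegrE ltW.
have pN n : 0 <= p ^+ n by apply: exprn_ge0; exact: ltW.
pose z s : 'rV[R]_2 := row2 0 (l2 ^+ N * (b + s)).
pose x s : 'rV[R]_2 := row2 (l1 ^+ N) (l2 ^+ N * (b + s)).
have bs s : 0 <= s <= 1 -> `|l2 ^+ N * (b + s)| < r.
  move=> /andP[s0 s1]; rewrite normrM normrX [`|b + s|]ger0_norm ?addr_ge0 ?(ltW b0)//.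
  rewrite (le_lt_trans _ Nr)//. apply: ler_wpM2l; first exact: pN.
  by rewrite lerD2l.
have b1 : 1 <= b + 1 by rewrite lerDr ltW.
have xr s : 0 <= s <= 1 -> `|x s| < r.
  move=> s01; apply: (@le_lt_trans _ _ (Num.max (p ^+ N * (b + 1)) `|l2 ^+ N * (b + s)|)).
    apply: norm_row2_le; rewrite /x !mx2E le_max ?lexx ?orbT//.
    by rewrite normrX (le_trans (qp N))// ler_peMr.
  by rewrite gt_max Nr bs.
have zr s : 0 <= s <= 1 -> `|z s| < r.
  by move=> s01; rewrite (le_lt_trans _ (bs s s01))//; apply: norm_row2_le; rewrite /z !mx2E ?normr0.
have Pn n v : `|v| < r -> Phi (iter n F v) 0 0 = l1 ^+ n * Phi v 0 0.
  move=> vr; elim: n => [|n IH]; first by rewrite mul1r.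
  have [_ nr] := iter_contract n mu01 Fr vr.
  by rewrite iterS conj// diag2E mulmx2E !mx2E mulr0 addr0 IH exprS mulrC mulrA.
pose y s := (Phi (x s) 0 0 - Phi (z s) 0 0) / l1 ^+ N.
(* The iterates of [x s] and of the axis point [z s] differ by a horizontal vector of length
   [q^(N+n) (1 + drift)], and deep in the orbit [DPhi] is within [e / 2] of the identity; hence
   [y s] is the limit of [1 + drift]. *)
have yE s e : 0 <= s <= 1 -> 0 < e -> exists K, forall n, (K <= n)%N ->
    `|y s - (1 + drift N s n)| <= e * (1 + drift N s n).
  move=> s01 e0; have s0 : 0 <= s by case/andP: s01.
  have z0 : `|0 : 'rV[R]_2| < r by rewrite normr0.
  have [_ /(_ _ (divr_gt0 e0 (ltr0n _ 2)))[d d0 Pd]] := PJ 0 z0.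
  have dr : 0 < Num.min d r by rewrite lt_min d0.
  have r1 : 0 < 1 + r by rewrite addr_gt0.
  have [|K KP] := tends0_geometric (r := (1 + p) / 2) _ (divr_gt0 dr r1).
    by case/andP: mu01 => /ltW-> ->.
  exists K => n Kn; set D := drift N s n.
  have D1 : 0 < 1 + D by rewrite ltr_wpDr// drift_ge0.
  have small v : `|v| < r -> `|iter n F v| < Num.min d r.
    move=> vr; have [vn _] := iter_contract n mu01 Fr vr.
    rewrite (le_lt_trans vn)// (@le_lt_trans _ _ (Num.min d r / (1 + r) * `|v|))//.
      by rewrite ler_wpM2r// KP.
    rewrite mulrAC ltr_pdivrMr// ltr_pM2l// (lt_le_trans vr)// lerDr ler01.
    by [].
  have dle : Num.min d r <= r by rewrite ge_min lexx orbT.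
  have Pd' v : `|v| < Num.min d r -> `|'J Phi v - 1%:M| <= e / 2.
    by move=> vd; rewrite -P1 Pd// subr0 (lt_le_trans vd)// ge_min lexx.
  have := C1_ball_mean (C1_ball_le dle PJ) Pd' (small _ (zr s s01)) (small _ (xr s s01)).
  rewrite mulmx1 [_ * (e / _)]mulrC divfK// => H.
  have dx : iter n F (x s) - iter n F (z s) = row2 (l1 ^+ (N + n) * (1 + D)) 0.
    rewrite axis orbit//; apply: eq_row2; rewrite !mxE /= ?subr0//.
    by rewrite mulrA -exprD addnC subrr.
  have ndx : `|iter n F (x s) - iter n F (z s)| <= q ^+ (N + n) * (1 + D).
    rewrite dx; apply: norm_row2_le; rewrite mx2E.
      by rewrite normrM normrX (gtr0_norm D1).
    by rewrite normr0 mulr_ge0// ltW.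
  have := le_trans (mx_norm_ge _ 0 0) (le_trans H (ler_wpM2l (ltW e0) ndx)).
  rewrite dx !mxE /= !Pn ?xr ?zr//.
  rewrite (_ : _ - _ = l1 ^+ (N + n) * (y s - (1 + D))); last first.
    rewrite [RHS]mulrBr; congr (_ - _); rewrite -mulrBr exprD /y [l1 ^+ N * _]mulrC -mulrA.
    by rewrite [X in _ = _ * X]mulrCA mulfV ?mulr1// expf_neq0.
  rewrite normrM normrX mulrCA ler_pM2l ?exprn_gt0//.
have z01 : 0 <= (0 : R) <= 1 by rewrite lexx ler01.
have y1 : y 0 = 1.
  apply/eqP; rewrite -subr_eq0 -normr_le0; apply/ler_addgt0Pr => e e0.
  have [K /(_ K (leqnn K))] := yE 0 e z01 e0.
  by rewrite drift0 addr0 mulr1 add0r.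
(* [Phi] is 2-Lipschitz on the ball and is used at two points moving by [p^N s]; division by [q^N]
   gives [4 th^N s]. *)
have yl s : 0 <= s <= 1 -> y s - y 0 <= 4 * th ^+ N * s.
  move=> s01; have s0 : 0 <= s by case/andP: s01.
  have lip u v : `|u| < r -> `|v| < r -> `|v - u| <= p ^+ N * s ->
      `|Phi v 0 0 - Phi u 0 0| <= 2 * (p ^+ N * s).
    move=> ur vr uv; have := C1_ball_mean PJ P4 ur vr; rewrite mulmx1 => H.
    have := le_trans (mx_norm_ge _ 0 0) H; rewrite !mxE => {}H.
    have := le_trans (mx_norm_ge (v - u) 0 0) uv; rewrite !mxE => H2.
    rewrite -(subrK (v 0 0 - u 0 0) (_ - _)) (le_trans (ler_normD _ _))//.
    rewrite (le_trans (lerD H H2))//.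
    by move: uv (normr_ge0 (v - u)); move: `|v - u| (_ * s) => A B; lra.
  have nz (a t : R) : `|row2 a (l2 ^+ N * (b + s)) - row2 a (l2 ^+ N * (b + 0))| <= p ^+ N * s.
    have E : p ^+ N * s = `|l2 ^+ N * s| by rewrite normrM normrX (ger0_norm s0).
    rewrite E; apply: norm_row2_le; rewrite !mxE /= ?subrr ?normr0//.
    by rewrite -mulrBr opprD addrACA subrr add0r subr0.
  have H1 := lip _ _ (xr 0 z01) (xr s s01) (nz _ 0).
  have H2 := lip _ _ (zr 0 z01) (zr s s01) (nz _ 0).
  rewrite /y -mulrBl (le_trans (ler_norm _))// normrM normfV normrX ler_pdivrMr ?exprn_gt0//.
  rewrite expr_div_n -!mulrA [s * _]mulrC [_^-1 * _]mulrA mulVf ?mul1r ?expf_neq0 ?gt_eqF//.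
  rewrite opprD addrACA -[- _ - - _]opprD.
  rewrite (le_trans (ler_normB _ _))// (le_trans (lerD H1 H2))//.
  by rewrite -mulrDl -natrD.
move=> s m s01; have s0 : 0 <= s by case/andP: s01.
suff : 1 + drift N s m <= y s by have := yl s s01; rewrite y1; lra.
apply/ler_addgt0Pr => d d0; set D := 1 + drift N s m.
have D0 : 0 < D by rewrite ltr_wpDr// drift_ge0.
have Dd : 0 < D + d by rewrite addr_gt0.
(* This relative error costs at most [d] at the value [D]; monotonicity of the drift covers the
   later times required by [yE]. *)
have e0 : 0 < d / (D + d) by rewrite divr_gt0.
have [K KP] := yE s _ s01 e0.
have := KP _ (leq_maxl K m); have := drift_le N s0 (leq_maxr K m).
move: (drift N s (maxn K m)) => D'; rewrite -(lerD2l 1) -/D => DD.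
rewrite distrC => /(le_trans (ler_norm _)) H.
have e1 : (1 - d / (D + d)) * D <= (1 - d / (D + d)) * (1 + D').
  apply: ler_wpM2l DD; rewrite subr_ge0 ler_pdivrMr// mul1r lerDr; exact: ltW.
have e2 : d / (D + d) * D <= d.
  by rewrite mulrAC ler_pdivrMr// ler_pM2l// lerDl ltW.
by move: H e1 e2; rewrite !mulrBl !mul1r; lra.
Qed.

Theorem resonant_map_not_linearizable :
  ~ summ (fun k => th ^+ k * w (q ^+ k)) -> ~ locally_C1_linearizable F.
Proof.
move=> nsumm [Phi [[Phi0 [U [V [G [oU _ _ _ [PC _]]]]]] P1 conj]]; apply: nsumm.
have [r1 r10 [PJ _]] := C1_onP oU PC.
have [r2 r20 Fr] := contract.
have /near_normP[r3 r30 cj] := conj.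
have z0 : `|0 : 'rV[R]_2| < r1 by rewrite normr0.
have [_ /(_ 4^-1)[|r4 r40 P4]] := PJ 0 z0; first by rewrite invr_gt0.
pose r := Num.min (Num.min r1 r2) (Num.min r3 r4).
have r0 : 0 < r by rewrite !lt_min r10 r20 r30.
have [rr1 rr2 rr3 rr4] : [/\ r <= r1, r <= r2, r <= r3 & r <= r4].
  by rewrite /r !ge_min !lexx !orbT.
have rb : 0 < r / 2 / (b + 1) by rewrite !divr_gt0// addr_gt0.
have [|N /(_ N (leqnn N)) NP] := tends0_geometric (r := p) _ rb.
  by rewrite (ltW p0).
have Db := @drift_bound Phi r N r0 (C1_ball_le rr1 PJ) P1.
have C0 : 0 <= 4 * th ^+ N by rewrite mulr_ge0// exprn_ge0// ltW.
exists (\sum_(k < N) th ^+ k * w (q ^+ k) + 4 * (4 * th ^+ N)) => n.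
have e0 k : 0 <= th ^+ k * w (q ^+ k).
  by apply: mulr_ge0; [apply: exprn_ge0; exact: ltW|exact: w0].
apply: (@le_trans _ _ (\sum_(k < N + n) th ^+ k * w (q ^+ k))).
  rewrite -!(big_mkord xpredT (fun k => th ^+ k * w (q ^+ k))).
  by rewrite (big_cat_nat _ (leq_addl N n))//= lerDl sumr_ge0.
rewrite big_split_ord /= lerD2l.
have {}Db s : 0 <= s <= 1 -> drift N s n <= 4 * th ^+ N * s.
  move=> s01; apply: Db => //.
  - by move=> v vr; apply: Fr; exact: lt_le_trans rr2.
  - move=> v vr; rewrite cj ?subr0 ?(lt_le_trans vr)//.
    by rewrite /F resonant_map_J// Jresonant_map0.
  - by move=> v vr; rewrite -P1 P4// subr0 (lt_le_trans vr).
  - rewrite -ltr_pdivlMr ?addr_gt0// (le_lt_trans NP)// ltr_pM2r ?invr_gt0 ?addr_gt0//.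
    by rewrite ltr_pdivrMr// ltr_pMr// ltr1n.
pose A := 4 * th ^+ N; pose B := th ^+ (N + n).
have A0 : 0 < A by rewrite mulr_gt0// exprn_gt0.
have B0 : 0 < B by rewrite exprn_gt0.
(* [s] depends on [n], but the lower bound of [drift_lower] and the upper bound [A s] are both
   linear in [s]; it cancels and the bound on the partial sums is uniform in [n]. *)
pose s := Num.min 1 (Num.min (c / 2 / A) (2^-1 / B)).
have cA : 0 < c / 2 / A by exact: divr_gt0 (divr_gt0 c0 (ltr0n _ 2)) A0.
have Bi : 0 < 2^-1 / B by rewrite divr_gt0// invr_gt0.
have s0 : 0 < s by rewrite !lt_min ltr01 cA.
have [s1 s2 s3] : [/\ s <= 1, s <= c / 2 / A & s <= 2^-1 / B].
  by rewrite /s !ge_min !lexx !orbT.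
have s01 : 0 <= s <= 1 by rewrite (ltW s0).
have Ds := Db s s01.
have := @drift_lower N s n (ltW s0).
rewrite -/B -ler_pdivlMr// => /(_ _ s3) H.
have {}H := le_trans (H _) Ds.
rewrite -(ler_pM2l (divr_gt0 s0 (ltr0n _ 4))).
rewrite [leRHS](_ : _ = A * s); last by rewrite -/A [LHS]mulrA divfK 1?mulrC.
apply: H.
by rewrite (le_trans Ds)// mulrC -ler_pdivlMr.
Qed.

End Divergence.

(** * The critical exponent *)

Lemma powR_gt_anti (R : realType) (q x y : R) : 0 < q < 1 -> x < y -> q `^ y < q `^ x.
Proof.
move=> /[dup] q01 /andP[q0 _] xy.
by rewrite /powR gt_eqF// ltr_expR ltr_nM2r// ln_lt0.
Qed.

Section Exponent.
Variables (R : realType) (l1 l2 : R).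
Hypotheses (hl1 : 0 < `|l1|) (hl12 : `|l1| <= `|l2|) (hl2 : `|l2| < 1).

Let p0 : 0 < `|l2|. Proof. exact: lt_le_trans hl12. Qed.
Let q01 : 0 < `|l1| < 1. Proof. by rewrite hl1 (le_lt_trans hl12). Qed.
Let lq : ln `|l1| < 0. Proof. exact: ln_lt0. Qed.
Let lp : ln `|l2| < 0. Proof. by rewrite ln_lt0// p0. Qed.

Lemma alpha0_bounds : 0 <= alpha0 l1 l2 < 1.
Proof.
rewrite /alpha0 subr_ge0 ler_ndivrMr// mul1r ler_ln ?posrE// hl12 /=.
by rewrite ltrBlDr ltrDl nmulr_lgt0// invr_lt0.
Qed.

Lemma powR_1alpha0 : `|l1| `^ (1 - alpha0 l1 l2) = `|l2|.
Proof.
by rewrite /alpha0 opprB addrC subrK /powR gt_eqF// divfK ?lt_eqF// lnK ?posrE.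
Qed.

Lemma powR_alpha0 : `|l1| `^ alpha0 l1 l2 = (`|l2| / `|l1|)^-1.
Proof.
have E : `|l1| `^ alpha0 l1 l2 * `|l2| = `|l1|.
  rewrite -[X in _ * X]powR_1alpha0 -powRD; last by rewrite (gt_eqF hl1) implybT.
  by rewrite addrC subrK powRr1// ltW.
by rewrite invf_div -[X in X / _]E mulfK// gt_eqF.
Qed.

Lemma alpha0_gt0 : `|l1| < `|l2| -> 0 < alpha0 l1 l2.
Proof.
move=> h; have /andP[a0 _] := alpha0_bounds; rewrite lt_neqAle a0 andbT.
by apply: contraTneq h => h; have := powR_1alpha0; rewrite -h subr0 powRr1 ?ltW// => ->; rewrite ltxx.
Qed.

(* Since [(1 - alpha0) (1 + alpha0) < 1], there is room for a growth exponent
   [g > alpha0] and an expansion rate [nu = q^-tau], [tau > 1 - alpha0], with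
   [tau (1 + g) < 1]. *)
Lemma gauge_exponents : exists2 g, alpha0 l1 l2 < g & `|l1| < `|l2| ->
  exists nu, [/\ 1 <= nu, `|l2|^-1 < nu & `|l1| * (nu * nu `^ g) < 1].
Proof.
have /andP[a0 a1] := alpha0_bounds; have q0 : `|l1| != 0 by rewrite gt_eqF.
set a := alpha0 l1 l2 in a0 a1 *.
have [pq|qp] := ltP `|l1| `|l2|; last by exists (a + 1); rewrite ?ltrDl// ltNge qp.
have ap : 0 < a := alpha0_gt0 pq.
(* With [a^2 = 4 d], the product below is [(1 + d)^2 - a^2 = (1 - d)^2]. *)
pose d := a ^+ 2 / 4; have d0 : 0 < d by rewrite divr_gt0// exprn_gt0.
have d1 : (1 - a + d) * (1 + (a + d)) < 1.
  have ad : a * a = 4 * d by rewrite /d expr2 [RHS]mulrC divfK.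
  have dd : d * d <= d.
    have aa : a * a <= 1 by rewrite mulr_ile1// ltW.
    by rewrite ler_piMl ?(ltW d0)//; move: ad aa d0; clearbody d; move: (a * a) => y; lra.
  move: ad dd d0; clearbody d; lra.
exists (a + d) => [|_]; first by rewrite ltrDl.
have nu0 : `|l1| `^ (- (1 - a + d)) = `|l1| `^ (- (1 - a + d)) `^ 1 by rewrite powRr1 ?powR_ge0.
exists (`|l1| `^ (- (1 - a + d))); split.
- rewrite -[leLHS](powRr0 `|l1|); apply/ltW/powR_gt_anti => //.
  by rewrite oppr_lt0 addr_gt0// subr_gt0.
- rewrite -powR_1alpha0 -powRN; apply: powR_gt_anti => //.
  by rewrite ltrN2 ltrDl.
- rewrite {1}nu0 -powRD; last by rewrite (gt_eqF (powR_gt0 _ hl1)) implybT.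
  rewrite -powRrM -[X in X * _]powRr1 ?ltW// -powRD ?q0 ?implybT//.
  rewrite -[ltRHS](powRr0 `|l1|); apply: powR_gt_anti => //.
  by rewrite mulNr subr_gt0.
Qed.

End Exponent.
Theorem theorem2 (R : realType) (w : R -> R) (l1 l2 : R)
    (hw : modulus_of_continuity w)
    (hl1 : 0 < `|l1|) (hl12 : `|l1| <= `|l2|) (hl2 : `|l2| < 1) :
  [/\ 0 <= alpha0 l1 l2 < 1,
      (dini_integral w (alpha0 l1 l2) < +oo)%E ->
        forall F : 'rV[R]_2 -> 'rV[R]_2,
          C1w_diffeo w F -> 'J F 0 = diag2 l1 l2 ->
          locally_C1_linearizable F,
      dini_integral w (alpha0 l1 l2) = +oo%E ->
        exists F : 'rV[R]_2 -> 'rV[R]_2,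
          [/\ C1w_diffeo w F, 'J F 0 = diag2 l1 l2 &
              ~ locally_C1_linearizable F] &
      (forall F : 'rV[R]_2 -> 'rV[R]_2,
          C1w_diffeo w F -> 'J F 0 = diag2 l1 l2 ->
          locally_C1_linearizable F) <->
        (dini_integral w (alpha0 l1 l2) < +oo)%E].
Proof.
have q01 : 0 < `|l1| < 1 by rewrite hl1 (le_lt_trans hl12).
have /andP[a0 a1] := alpha0_bounds hl1 hl12 hl2.
have th1 : 1 <= `|l2| / `|l1| by rewrite ler_pdivlMr// mul1r.
have th0 : 0 < `|l2| / `|l1| by rewrite (lt_le_trans ltr01).
have qa := powR_alpha0 hl1 hl12 hl2.
have lin F : (dini_integral w (alpha0 l1 l2) < +oo)%E -> C1w_diffeo w F ->
    'J F 0 = diag2 l1 l2 -> locally_C1_linearizable F.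
  move=> /(summ_of_dini hw q01 th0 qa a0) sm.
  have [g ag exp] := gauge_exponents hl1 hl12 hl2.
  have g0 : 0 < g by exact: le_lt_trans ag.
  have gw := modulus_gauge hw; have [_ sg0 _ _] := supgauge_gauge gw g0.
  apply: (@linearizable_of_summ R w (supgauge w g) l1 l2 (w 1)) => //.
  - exact: supgauge_gauge.
  - by move=> t; exact: supgauge_ge.
  - by have [w0 _ _ wlt _] := hw; rewrite -w0 wlt.
  - by move=> t; exact: supgauge_linear.
  - apply: supgauge_summ => //.
    (* As [th = q^-a], the condition [th q^g < 1] is [g > a]. *)
    by rewrite mulrC -ltr_pdivlMr// div1r -qa powR_gt_anti.
  - move=> /exp[nu [n1 pn nk]]; exists nu, (nu * nu `^ g).
    have n0 : 0 <= nu by rewrite (le_trans _ n1).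
    split=> // [|t t0].
      by rewrite ler_peMr// -(powRr0 nu) ler_powR// ltW.
    by rewrite -mulrA ler_wpM2l// supgauge_scale.
have res : ~ (dini_integral w (alpha0 l1 l2) < +oo)%E ->
    ~ locally_C1_linearizable (resonant_map w l1 l2).
  move=> nd; apply: resonant_map_not_linearizable => // sm; apply: nd.
  exact: (dini_of_summ hw q01 th0 qa a0).
have resJ : 'J (resonant_map w l1 l2) 0 = diag2 l1 l2.
  by rewrite resonant_map_J// Jresonant_map0.
split; first by rewrite a0.
- by move=> dfin F; exact: lin.
- move=> doo; exists (resonant_map w l1 l2); split=> //.
    exact: resonant_map_C1w.
  by apply: res; rewrite doo ltxx.
- split=> [all_lin|dfin F]; last exact: lin.
  apply: contrapT => /res; apply; apply: all_lin => //.
  exact: resonant_map_C1w.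
Qed.
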